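(* For every fixed pair of distinct real weights $a,b$, there is an algorithm that, given an $n$-vertex tree $T$, decides whether $T$ admits a proper $\{a,b\}$-edge-weighting and, if so, constructs one, in $O(n)$ time using $O(n)$ space.
   Context: All graphs are finite and simple; the one-vertex tree is allowed. An $\{a,b\}$-edge-weighting of a graph $G$ is a map $\omega:E(G)\to\{a,b\}$; it induces the weighted degree $s_\omega(v)=\sum_{e\ni v}\omega(e)$ at each vertex $v$, and it is proper if $s_\omega(u)\neq s_\omega(v)$ for every edge $uv$ of $G$. Computational model: the bounds hold on a word RAM with word size $\Theta(\log n)$. The weights $a$ and $b$ are fixed constants (not part of the input), so the algorithm and the constants in the $O$-notation may depend on $a,b$. Weighted degrees are represented as follows. If $a$ and $b$ are linearly independent over $\mathbb{Q}$, the weighted degree of a vertex is represented by the ordered pair consisting of the numbers of its incident edges of weights $a$ and $b$. Otherwise, write $(a,b)=c(p,q)$ for a nonzero real number $c$ and fixed coprime integers $p,q$, and represent the weighted degree $xa+yb$ by the integer $px+qy$. Equality of represented values is equivalent to equality of weighted degrees, and each represented value uses $O(\log n)$ bits. *)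

(* Defs.v *)
From HB Require Import structures.
From mathcomp Require Import all_boot all_order all_algebra reals.
Set Implicit Arguments.
Unset Strict Implicit.
Unset Printing Implicit Defensive.
Import Order.TTheory GRing.Theory Num.Theory.

Record sgraph (V : finType) := SGraph {
  adj : rel V;
  adj_sym : symmetric adj;
  adj_irrefl : irreflexive adj }.

Definition edges (V : finType) (G : sgraph V) : {set {set V}} :=
  [set [set p.1; p.2] | p : V * V & adj G p.1 p.2].

Definition connected_graph (V : finType) (G : sgraph V) : Prop :=
  0 < #|V| /\ forall x y : V, connect (adj G) x y.

(* An edge traversed back and forth is a ucycle of size 2 of the relation     *)
(* adj G, so graph cycles are the ucycles of size at least 3.                 *)
Definition acyclic_graph (V : finType) (G : sgraph V) : Prop :=
  forall c : seq V, 2 < size c -> ~ ucycle (adj G) c.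

Definition is_tree (V : finType) (G : sgraph V) : Prop :=
  connected_graph G /\ acyclic_graph G.

Section Weightings.
Variables (R : realType) (a b : R) (V : finType) (G : sgraph V).
Local Open Scope ring_scope.

(* Values of w outside edges G are irrelevant.                                *)
Definition edge_weighting (w : {set V} -> R) : Prop :=
  forall f : {set V}, f \in edges G -> w f = a \/ w f = b.

Definition weighted_degree (w : {set V} -> R) (v : V) : R :=
  \sum_(f in edges G | v \in f) w f.

Definition proper_weighting (w : {set V} -> R) : Prop :=
  edge_weighting w /\
  forall u v : V, adj G u v -> weighted_degree w u <> weighted_degree w v.

Definition admits_proper_weighting : Prop :=
  exists w : {set V} -> R, proper_weighting w.

End Weightings.

(* Word RAM.  Words of size w are the naturals below 2 ^ w; all arithmetic is *)
(* modulo 2 ^ w.  There are finitely many registers (those named in the       *)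
(* program) and a random access memory M of words.  Division by zero        *)
(* follows the conventions of divn and modn.                                  *)

Inductive binop :=
  | BAdd | BSub | BMul | BDiv | BMod
  | BAnd | BOr | BXor | BShl | BShr
  | BEq | BLt.

Inductive instr :=
  | IConst of nat & nat            (* IConst r c  : r := c                    *)
  | IOp of binop & nat & nat & nat (* IOp o r x y : r := x o y                *)
  | ILoad of nat & nat             (* ILoad r x   : r := M[x]                 *)
  | IStore of nat & nat            (* IStore x y  : M[x] := y                 *)
  | IJump of nat                   (* IJump l     : goto l                    *)
  | IJumpZ of nat & nat            (* IJumpZ x l  : if x = 0 then goto l      *)
  | IHalt.

Definition program := seq instr.

Record config := Config { pc : nat; regs : nat -> nat; memory : nat -> nat }.

Definition eval_binop (w : nat) (o : binop) (x y : nat) : nat :=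
  match o with
  | BAdd => x + y
  | BSub => x + (2 ^ w - y)
  | BMul => x * y
  | BDiv => x %/ y
  | BMod => x %% y
  | BAnd => Nat.land x y
  | BOr => Nat.lor x y
  | BXor => Nat.lxor x y
  | BShl => x * 2 ^ y
  | BShr => x %/ 2 ^ y
  | BEq => x == y
  | BLt => x < y
  end %% 2 ^ w.

(* Running past the end of the program halts.                                 *)
Definition fetch (P : program) (c : config) : instr := nth IHalt P (pc c).

Definition halted (P : program) (c : config) : Prop := fetch P c = IHalt.

(* One step with word size w and m memory cells.  The result is None if the   *)
(* machine has halted, or if it accesses an address outside [0, m).           *)
Definition step (w m : nat) (P : program) (c : config) : option config :=
  let: Config i r s := c in
  match fetch P c with
  | IConst d k => Some (Config i.+1 [eta r with d |-> k %% 2 ^ w] s)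
  | IOp o d x y =>
      Some (Config i.+1 [eta r with d |-> eval_binop w o (r x) (r y)] s)
  | ILoad d x =>
      if r x < m then Some (Config i.+1 [eta r with d |-> s (r x)] s) else None
  | IStore x y =>
      if r x < m then Some (Config i.+1 r [eta s with r x |-> r y]) else None
  | IJump l => Some (Config l r s)
  | IJumpZ x l => Some (Config (if r x == 0 then l else i.+1) r s)
  | IHalt => None
  end.

Definition run (w m : nat) (P : program) (t : nat) (c : config) :
  option config := iter t (obind (step w m P)) (Some c).

Definition init_config (input : seq nat) : config :=
  Config 0 (fun=> 0) (nth 0 input).

(* Input format: a graph on vertices 0, ..., n-1 is given by n followed by    *)
(* the endpoints of its edges, each edge being listed once, in an arbitrary   *)
(* order and with an arbitrary orientation.                                   *)

Definition edge_of (n : nat) (p : 'I_n * 'I_n) : {set 'I_n} := [set p.1; p.2].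

Definition edge_list (n : nat) (G : sgraph 'I_n) (es : seq ('I_n * 'I_n)) :=
  perm_eq [seq edge_of p | p <- es] (enum (edges G)).

Definition encode (n : nat) (es : seq ('I_n * 'I_n)) : seq nat :=
  n :: flatten [seq [:: val p.1; val p.2] | p <- es].

(* Output format: cell 0 holds the answer (1 for yes, 0 for no); if it is     *)
(* yes, cell i+1 holds the weight of the i-th listed edge, with 0 standing    *)
(* for a and 1 for b.                                                         *)

Definition output_weighting (R : realType) (a b : R) (n : nat)
    (es : seq ('I_n * 'I_n)) (s : nat -> nat) (w : {set 'I_n} -> R) : Prop :=
  forall (i : nat) (p : 'I_n * 'I_n), onth es i = Some p ->
    (s i.+1 = 0 /\ w (edge_of p) = a) \/ (s i.+1 = 1 /\ w (edge_of p) = b).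

Definition correct_output (R : realType) (a b : R) (n : nat) (G : sgraph 'I_n)
    (es : seq ('I_n * 'I_n)) (s : nat -> nat) : Prop :=
  (admits_proper_weighting a b G ->
     s 0 = 1 /\
     exists w : {set 'I_n} -> R,
       proper_weighting a b G w /\ output_weighting a b es s w) /\
  (~ admits_proper_weighting a b G -> s 0 = 0).

(* Main.v *)
(* Dynamic programming on the tree, bottom-up along an order in which leaves  *)
(* are removed one at a time (a queue of leaves gives it in linear time; the  *)
(* last neighbour of a removed leaf is its parent, and it is found without    *)
(* adjacency lists by maintaining the sum of the remaining neighbours).       *)
(* Write codes for weighted degrees: a vertex of degree [d] with [j] incident *)
(* edges of weight [b] gets an integer code, affine in [j], such that codes   *)
(* are equal iff the weighted degrees are.  For a fixed weight of its parent  *)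
(* edge, a vertex excludes at most one code of its parent when it has only    *)
(* one admissible [j], and none when it has two; hence the first and the last *)
(* admissible [j] carry all the information.  A vertex with code given allows *)
(* [j] iff no child is blocked for both weights and the numbers of children   *)
(* forced to [a] and to [b] leave room for [j]; these numbers are kept in     *)
(* [d + 3] slots per vertex, which makes the total work proportional to the   *)
(* sum of the degrees.  Weights are then chosen top-down, a child that may    *)
(* take both weights taking [b] as long as its parent still needs some.       *)
Require Import Defs.
From HB Require Import structures.
From mathcomp Require Import all_boot all_order all_algebra reals.
From mathcomp Require Import boolp zify ring.
Set Implicit Arguments.
Unset Strict Implicit.
Unset Printing Implicit Defensive.
Import Order.TTheory GRing.Theory Num.Theory.

(** * A structured language compiled to the word RAM *)

(** Root the tree, give the edges bits (0 for [a], 1 for [b]), and let [j] be one plus the number of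
    1-bits at a vertex. The weighted degree depends only on the degree and on [j], and [code_exists]
    replaces it by a natural number that increases strictly with [j] and is quadratic in [n], so it
    fits in O(log n) bits.

    Fix the bit [e] of the edge from [v] to its parent. A value [j] at [v] can be extended to the
    subtree below iff every child can take some bit, and the number [j - 1 - e] of 1-bits on child
    edges is at least the number of children forced to 1 and at most the number of children not
    forced to 0; every number in between is reached through the free children. This is [admissible].
    A child can take bit [e'] iff it has an admissible value for [e'] whose code differs from that
    of [v]. Two admissible values always leave one, so the first and the last suffice
    ([select_sound], [select_complete]). Necessity of admissibility is [admissible_bit_degree];
    sufficiency is the top-down reconstruction, whose bookkeeping is [settled] and whose step is
    [inv5_step].

    For linear time, the values of [v] that block a given child for a given bit are all of them,
    exactly one, or none. So the child increments a single counter ([slot_select]), and deciding all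
    [j] at [v] is a scan of length [deg v + 1]. The degrees sum to [2n - 2] ([sum_card_nb]). The
    bottom-up order comes from a queue of leaves: a tree with at least two vertices has a leaf
    ([exists_leaf]), and removing a leaf keeps it connected ([conn_del]).

    The algorithm is written in a small while language over exact naturals. Its compilation is
    correct as long as no operation leaves the word range ([ecomp_ok], [scomp_ok]), and step counts
    are carried by [triple]. *)

Inductive expr :=
  | Cst of nat
  | Var of nat
  | Bin of binop & expr & expr
  | Ld of nat & expr
  | Cond of expr & expr & expr.

Inductive stmt :=
  | Asg of nat & expr
  | St of nat & expr & expr.

Inductive cmd :=
  | Blk of seq stmt
  | Seq of cmd & cmd
  | While of expr & cmd.

(** Values are unbounded naturals; the word size enters only through the safety predicates
    [op_safe], [esafe] and [ssafe], under which exact and modular arithmetic agree. The operators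
    that [opv] sends to the default 0 are never safe. *)
Record state := State { vr : nat -> nat; ar : nat -> nat -> nat }.

Definition setv (s : state) (x a : nat) : state :=
  State (fun y => if y == x then a else vr s y) (ar s).

Definition seta (s : state) (k x a : nat) : state :=
  State (vr s) (fun k' => if k' == k then
     fun y => if y == x then a else ar s k' y else ar s k').

Definition opv (o : binop) (x y : nat) : nat :=
  match o with
  | BAdd => x + y
  | BSub => x - y
  | BMul => x * y
  | BDiv => x %/ y
  | BEq => x == y
  | BLt => x < y
  | _ => 0
  end.

Fixpoint ev (s : state) (e : expr) : nat :=
  match e with
  | Cst k => k
  | Var x => vr s x
  | Bin o e1 e2 => opv o (ev s e1) (ev s e2)
  | Ld k e => ar s k (ev s e)
  | Cond e1 e2 e3 => if ev s e1 != 0 then ev s e2 else ev s e3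
  end.

(* Cell [x] of array [k] is stored at address [k * N + x], so that array 0    *)
(* holds the input and the output; register 0 contains the array length [N],  *)
(* and the registers from [nreg] on are temporaries.                          *)
Definition nreg := 40.
Definition narr := 20.

Fixpoint ewf (e : expr) : bool :=
  match e with
  | Cst k => true
  | Var x => x < nreg
  | Bin o e1 e2 => ewf e1 && ewf e2
  | Ld k e => (k < narr) && ewf e
  | Cond e1 e2 e3 => [&& ewf e1, ewf e2 & ewf e3]
  end.

Definition swf (c : stmt) : bool :=
  match c with
  | Asg x e => [&& 0 < x, x < nreg & ewf e]
  | St k e1 e2 => [&& k < narr, ewf e1 & ewf e2]
  end.

Definition addr_code (k t : nat) : seq instr :=
  [:: IConst t.+1 k; IOp BMul t.+1 t.+1 0; IOp BAdd t t t.+1].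

(* [ecomp e t i] leaves the value of [e] in register [t], for code loaded at  *)
(* address [i].                                                               *)
Fixpoint ecomp (e : expr) (t i : nat) : seq instr :=
  match e with
  | Cst k => [:: IConst t k]
  | Var x => [:: IConst t 0; IOp BAdd t x t]
  | Bin o e1 e2 =>
      let c1 := ecomp e1 t i in
      c1 ++ ecomp e2 t.+1 (i + size c1) ++ [:: IOp o t t t.+1]
  | Ld k e => ecomp e t i ++ addr_code k t ++ [:: ILoad t t]
  | Cond e1 e2 e3 =>
      let c1 := ecomp e1 t i in
      let i2 := (i + size c1).+1 in
      let c2 := ecomp e2 t i2 in
      let i3 := (i2 + size c2).+1 in
      let c3 := ecomp e3 t i3 in
      c1 ++ IJumpZ t i3 :: c2 ++ IJump (i3 + size c3) :: c3
  end.

Definition scomp (c : stmt) (i : nat) : seq instr :=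
  match c with
  | Asg x e =>
      ecomp e nreg i ++ [:: IConst nreg.+1 0; IOp BAdd x nreg nreg.+1]
  | St k e1 e2 =>
      let c1 := ecomp e1 nreg i in
      c1 ++ ecomp e2 nreg.+1 (i + size c1) ++
      [:: IConst nreg.+2 k; IOp BMul nreg.+2 nreg.+2 0;
          IOp BAdd nreg nreg nreg.+2; IStore nreg nreg.+1]
  end.

Fixpoint lcomp (l : seq stmt) (i : nat) : seq instr :=
  if l is c :: l' then let c1 := scomp c i in c1 ++ lcomp l' (i + size c1)
  else [::].

Fixpoint ccomp (c : cmd) (i : nat) : seq instr :=
  match c with
  | Blk l => lcomp l i
  | Seq c1 c2 => let a := ccomp c1 i in a ++ ccomp c2 (i + size a)
  | While e c =>
      let a := ecomp e nreg i in
      let b := ccomp c (i + size a).+1 in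
      a ++ IJumpZ nreg ((i + size a).+1 + size b).+1 :: b ++ [:: IJump i]
  end.

(** The code length also bounds the running time of an expression, because all its jumps go
    forward. *)
Fixpoint esize (e : expr) : nat :=
  match e with
  | Cst k => 1
  | Var x => 2
  | Bin o e1 e2 => esize e1 + (esize e2 + 1)
  | Ld k e => esize e + 4
  | Cond e1 e2 e3 => esize e1 + (esize e2 + (esize e3).+1).+1
  end.

Lemma size_ecomp e t i : size (ecomp e t i) = esize e.
Proof.
elim: e t i => //= [o e1 IH1 e2 IH2 | k e IH | e1 IH1 e2 IH2 e3 IH3] t i;
  by rewrite ?size_cat /= ?size_cat /= ?IH1 ?IH2 ?IH3 ?IH.
Qed.

Definition ssize (c : stmt) : nat :=
  match c with
  | Asg x e => esize e + 2
  | St k e1 e2 => esize e1 + (esize e2 + 4)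
  end.

Lemma size_scomp c i : size (scomp c i) = ssize c.
Proof. by case: c => *; rewrite /= ?size_cat /= ?size_cat ?size_ecomp. Qed.

Definition lcost (l : seq stmt) : nat := sumn (map ssize l).

(** * Correctness and running time of compiled code *)

Section Machine.
Variables (w N : nat).
Let W := 2 ^ w.
Let m := narr * N.
Hypothesis W_gt1 : 1 < W.
Hypothesis W_mem : m <= W.
Hypothesis W_narr : narr < W.

Definition op_safe (o : binop) (x y : nat) : Prop :=
  match o with
  | BAdd => x + y < W
  | BMul => x * y < W
  | BSub => y <= x
  | BDiv | BEq | BLt => True
  | _ => False
  end.

Fixpoint esafe (s : state) (e : expr) : Prop :=
  match e with
  | Cst k => k < W
  | Var x => True
  | Bin o e1 e2 => [/\ esafe s e1, esafe s e2 & op_safe o (ev s e1) (ev s e2)]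
  | Ld k e => esafe s e /\ ev s e < N
  | Cond e1 e2 e3 =>
     esafe s e1 /\ (if ev s e1 != 0 then esafe s e2 else esafe s e3)
  end.

Lemma eval_binop_safe o x y : x < W -> y < W -> op_safe o x y ->
  eval_binop w o x y = opv o x y /\ opv o x y < W.
Proof.
move=> xW yW; rewrite /eval_binop -/W; case: o => //= h.
- by rewrite modn_small.
- have -> : x + (W - y) = x - y + W by lia.
  by rewrite modnDr modn_small; lia.
- by rewrite modn_small.
- by rewrite modn_small; have := leq_div x y; lia.
- by rewrite modn_small; case: (x == y); lia.
- by rewrite modn_small; case: (x < y); lia.
Qed.

Section Run.
Variable P : program.

Definition steps (t : nat) (c c' : config) : Prop :=
  run w m P t c = Some c'.

Lemma steps0 c : steps 0 c c. Proof. by []. Qed.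

Lemma steps_trans t1 t2 c1 c2 c3 :
  steps t1 c1 c2 -> steps t2 c2 c3 -> steps (t1 + t2) c1 c3.
Proof. by rewrite /steps /run addnC iterD => ->. Qed.

Lemma steps1 t c1 c2 c3 :
  step w m P c1 = Some c2 -> steps t c2 c3 -> steps t.+1 c1 c3.
Proof. by move=> h; rewrite -add1n; apply: steps_trans; rewrite /steps /run /=. Qed.

Definition code_at (i : nat) (l : seq instr) : Prop :=
  forall j, j < size l -> nth IHalt P (i + j) = nth IHalt l j.

Lemma code_at_cat i l1 l2 :
  code_at i (l1 ++ l2) -> code_at i l1 /\ code_at (i + size l1) l2.
Proof.
move=> h; split=> j hj.
  by rewrite h ?nth_cat ?hj // size_cat; apply: leq_trans hj (leq_addr _ _).
rewrite -addnA h ?size_cat ?ltn_add2l // nth_cat ltnNge leq_addr /=.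
by rewrite addKn.
Qed.

Lemma code_at_cons i x l :
  code_at i (x :: l) -> nth IHalt P i = x /\ code_at i.+1 l.
Proof.
move=> h; split; first by rewrite -[i]addn0 h.
by move=> j hj; rewrite addSnnS h.
Qed.

(** Nothing is required of the registers from [nreg] on, so temporaries may be overwritten freely
    ([represents_eqreg]). *)
Record represents (s : state) (rg mm : nat -> nat) : Prop := Represents {
  repr_reg : forall r, r < nreg -> rg r = vr s r;
  repr_vr : forall r, r < nreg -> vr s r < W;
  repr_N : vr s 0 = N;
  repr_mem : forall k x, k < narr -> x < N -> mm (k * N + x) = ar s k x;
  repr_ar : forall k x, k < narr -> x < N -> ar s k x < W }.

Lemma represents_eqreg s rg rg' mm :
  (forall r, r < nreg -> rg' r = rg r) -> represents s rg mm -> represents s rg' mm.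
Proof. by move=> h [h1 h2 h3 h4 h5]; split=> // r hr; rewrite h // h1. Qed.

Ltac exec1 H := apply: (@steps1 _ _ _ _ _);
  [rewrite /step /fetch /= H /=; reflexivity | ].

Lemma addr_ok k t i rg mm x :
  code_at i (addr_code k t) -> k < narr -> x < N -> rg t = x -> 0 < t ->
  rg 0 = N ->
  exists rg', [/\ steps 3 (Config i rg mm) (Config (i + 3) rg' mm),
    rg' t = k * N + x & forall r, r < t -> rg' r = rg r].
Proof.
move=> /code_at_cons[h1 /code_at_cons[h2 /code_at_cons[h3 _]]] hk hx ht t0 h0.
have kW : k < W by apply: ltn_trans hk W_narr.
have xm : k * N + x < W.
  apply: leq_trans W_mem; rewrite /m; have : k.+1 * N <= narr * N by rewrite leq_mul2r hk orbT.
  by rewrite mulSn; lia.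
have t1 : (t == t.+1) = false by apply/eqP; lia.
have t2 : (0 == t.+1) = false by [].
eexists; split.
- exec1 h1. exec1 h2. exec1 h3.
  rewrite addn3; exact: steps0.
- rewrite /= eqxx t1 /= eqxx ht h0 /eval_binop -/W (modn_small kW).
  rewrite [k * N %% _]modn_small; last by apply: leq_ltn_trans xm; rewrite leq_addr.
  by rewrite addnC modn_small.
- move=> r hr /=.
  have -> : (r == t) = false by apply/eqP; lia.
  by have -> : (r == t.+1) = false by apply/eqP; lia.
Qed.

(** The temporaries form a stack growing upwards from [t]: the second operand is evaluated at
    [t.+1], and the clause on registers below the target keeps the first operand intact. *)
Lemma ecomp_ok e t i rg mm s :
  ewf e -> nreg <= t -> code_at i (ecomp e t i) -> represents s rg mm -> esafe s e ->
  ev s e < W /\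
  exists k rg', [/\ k <= esize e,
    steps k (Config i rg mm) (Config (i + esize e) rg' mm),
    rg' t = ev s e & forall r, r < t -> rg' r = rg r].
Proof.
elim: e t i rg => [k|x|o e1 IH1 e2 IH2|k e IH|e1 IH1 e2 IH2 e3 IH3] t i rg /=.
- move=> _ _ /code_at_cons[h1 _] ms kW; split=> //.
  exists 1; eexists; split; [by [] | | | ].
  + exec1 h1. rewrite addn1; exact: steps0.
  + by rewrite /= eqxx modn_small.
  + by move=> r hr /=; have -> : (r == t) = false by apply/eqP; lia.
- move=> xR tR /code_at_cons[h1 /code_at_cons[h2 _]] ms _.
  have xW : vr s x < W by apply: repr_vr ms _ _.
  split=> //; exists 2; eexists; split; [by [] | | | ].
  + exec1 h1. exec1 h2. rewrite addn2; exact: steps0.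
  + rewrite /= !eqxx /eval_binop mod0n addn0.
    have -> : (x == t) = false by apply/eqP; lia.
    by rewrite (repr_reg ms xR) modn_small.
  + by move=> r hr /=; have -> : (r == t) = false by apply/eqP; lia.
- case/andP=> w1 w2 tR /code_at_cat[c1 /code_at_cat[c2 c3]] ms [s1 s2 so].
  have [v1 [k1 [rg1 [le1 st1 r1 f1]]]] := IH1 _ _ _ w1 tR c1 ms s1.
  have ms1 : represents s rg1 mm by apply: represents_eqreg ms => r hr; rewrite f1 //; lia.
  have tR1 : nreg <= t.+1 by lia.
  rewrite !size_ecomp in c2 c3.
  have [v2 [k2 [rg2 [le2 st2 r2 f2]]]] := IH2 _ _ _ w2 tR1 c2 ms1 s2.
  have [h1 _] := code_at_cons c3.
  have [e1e e1W] := eval_binop_safe v1 v2 so.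
  split=> //; exists (k1 + (k2 + 1)); eexists; split; first by lia.
  + apply: steps_trans st1 _; apply: steps_trans st2 _.
    exec1 h1. rewrite !addnA addn1; exact: steps0.
  + rewrite /= eqxx r2 f2 //; first by rewrite r1.
  + move=> r hr /=; have -> : (r == t) = false by apply/eqP; lia.
    by rewrite f2 ?f1 //; lia.
- case/andP=> kn w1 tR /code_at_cat[c1 c2] ms [s1 sN].
  have [v1 [k1 [rg1 [le1 st1 r1 f1]]]] := IH _ _ _ w1 tR c1 ms s1.
  have ms1 : represents s rg1 mm by apply: represents_eqreg ms => r hr; rewrite f1 //; lia.
  have /(@code_at_cat _ (addr_code k t)) [ca /code_at_cons[h1 _]] := c2.
  rewrite !size_ecomp /= in ca h1.
  have t0 : 0 < t by rewrite (leq_trans _ tR).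
  have z0 : rg1 0 = N by rewrite (repr_reg ms1) // (repr_N ms1).
  have [rg2 [st2 r2 f2]] := addr_ok mm ca kn sN r1 t0 z0.
  have am : k * N + ev s e < m.
    rewrite /m; have : k.+1 * N <= narr * N by rewrite leq_mul2r kn orbT.
    by rewrite mulSn; lia.
  split; first exact: repr_ar ms _ _ kn sN.
  exists (k1 + (3 + 1)); eexists; split; first by lia.
  + apply: steps_trans st1 _; apply: steps_trans st2 _.
    apply: (@steps1 _ _ _ _ _).
      rewrite /step /fetch /= h1 /= r2 am; reflexivity.
    have -> : i + (esize e + 4) = (i + esize e + 3).+1 by lia.
    exact: steps0.
  + by rewrite /= eqxx (repr_mem ms1).
  + move=> r hr /=; have -> : (r == t) = false by apply/eqP; lia.
    by rewrite f2 ?f1 //; lia.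
- case/and3P=> w1 w2 w3 tR /code_at_cat[c1 /code_at_cons[h1 /code_at_cat[c2 /code_at_cons[h2 c3]]]] ms [s1 s23].
  have [v1 [k1 [rg1 [le1 st1 r1 f1]]]] := IH1 _ _ _ w1 tR c1 ms s1.
  have ms1 : represents s rg1 mm by apply: represents_eqreg ms => r hr; rewrite f1 //; lia.
  rewrite !size_ecomp in h1 c2 h2 c3.
  have [e10|e1n] := eqVneq (ev s e1) 0; rewrite ?e10 ?e1n /= in s23 *.
  + have [v3 [k3 [rg3 [le3 st3 r3 f3]]]] := IH3 _ _ _ w3 tR c3 ms1 s23.
    split=> //; exists (k1 + k3.+1), rg3; split=> //; first by lia.
    * apply: steps_trans st1 _; exec1 h1; rewrite r1 e10 /=.
      by have -> : i + (esize e1 + (esize e2 + (esize e3).+1).+1) =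
                 ((i + esize e1).+1 + esize e2).+1 + esize e3 by lia.
    * by move=> r hr; rewrite f3 ?f1.
  + have [v3 [k3 [rg3 [le3 st3 r3 f3]]]] := IH2 _ _ _ w2 tR c2 ms1 s23.
    split=> //; exists (k1 + (k3 + 1).+1), rg3; split=> //; first by lia.
    * apply: steps_trans st1 _; exec1 h1; rewrite r1 (negbTE e1n) /=.
      apply: steps_trans st3 _; exec1 h2.
      have -> : i + (esize e1 + (esize e2 + (esize e3).+1).+1) =
                 ((i + esize e1).+1 + esize e2).+1 + esize e3 by lia.
      exact: steps0.
    * by move=> r hr; rewrite f3 ?f1.
Qed.

End Run.

Definition sexec (c : stmt) (s : state) : state :=
  match c with
  | Asg x e => setv s x (ev s e)
  | St k e1 e2 => seta s k (ev s e1) (ev s e2)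
  end.

Definition ssafe (c : stmt) (s : state) : Prop :=
  match c with
  | Asg x e => esafe s e
  | St k e1 e2 => [/\ esafe s e1, esafe s e2 & ev s e1 < N]
  end.

(** A weakest precondition for straight-line code, unfolded by symbolic execution. *)
Fixpoint ok (l : seq stmt) (s : state) (Q : state -> Prop) : Prop :=
  if l is c :: l' then ssafe c s /\ ok l' (sexec c s) Q else Q s.

(* [c], started in state [s], stops within [B] steps in a state satisfying [Q]. *)
Definition triple (c : cmd) (s : state) (B : nat) (Q : state -> Prop) : Prop :=
  forall P i rg mm, code_at P i (ccomp c i) -> represents s rg mm ->
  exists k rg' mm' s', [/\ k <= B,
    steps P k (Config i rg mm) (Config (i + size (ccomp c i)) rg' mm'),
    represents s' rg' mm' & Q s'].

Lemma scomp_ok P c i rg mm s : swf c -> code_at P i (scomp c i) ->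
  represents s rg mm -> ssafe c s ->
  exists k rg' mm', [/\ k <= ssize c,
    steps P k (Config i rg mm) (Config (i + ssize c) rg' mm') &
    represents (sexec c s) rg' mm'].
Proof.
case: c => [x e|k e1 e2] /=.
- case/and3P=> x0 xR w1 /code_at_cat[c1 c2] ms s1.
  have [v1 [k1 [rg1 [le1 st1 r1 f1]]]] := ecomp_ok w1 (leqnn _) c1 ms s1.
  rewrite size_ecomp in c2.
  case/code_at_cons: c2 => h1 /code_at_cons[h2 _].
  exists (k1 + 2); do 2!eexists; split; first by lia.
  + apply: steps_trans st1 _.
    apply: (@steps1 _ _ _ _ _ _); first by rewrite /step /fetch /= h1 /=; reflexivity.
    apply: (@steps1 _ _ _ _ _ _); first by rewrite /step /fetch /= h2 /=; reflexivity.
    rewrite addnA addn2; exact: steps0.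
  + case: ms => m1 m2 m3 m4 m5; split=> //=.
    * move=> r hr; rewrite /eval_binop mod0n addn0 r1 modn_small //.
      have -> : (r == nreg.+1) = false by apply/eqP; lia.
      case: eqP => // _.
      by rewrite f1 ?m1.
    * move=> r hr; case: (r == x) => //; exact: m2.
    * by case: eqP => // h; lia.
- case/and3P=> kn w1 w2 /code_at_cat[c1 /code_at_cat[c2 c3]] ms [s1 s2 sN].
  have [v1 [k1 [rg1 [le1 st1 r1 f1]]]] := ecomp_ok w1 (leqnn _) c1 ms s1.
  have ms1 : represents s rg1 mm by apply: represents_eqreg ms => r hr; rewrite f1 //; lia.
  rewrite !size_ecomp in c2 c3.
  have [v2 [k2 [rg2 [le2 st2 r2 f2]]]] := ecomp_ok w2 (leqnSn _) c2 ms1 s2.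
  have ms2 : represents s rg2 mm by apply: represents_eqreg ms1 => r hr; rewrite f2 //; lia.
  case/code_at_cons: c3 => h1 /code_at_cons[h2 /code_at_cons[h3 /code_at_cons[h4 _]]].
  have am : k * N + ev s e1 < m.
    rewrite /m; have : k.+1 * N <= narr * N by rewrite leq_mul2r kn orbT.
    by rewrite mulSn; lia.
  have aW : k * N + ev s e1 < W by lia.
  have kW : k < W by lia.
  have rN : rg2 nreg = ev s e1 by rewrite f2 // r1.
  have r0 : rg2 0 = N by rewrite (repr_reg ms2) // (repr_N ms2).
  exists (k1 + (k2 + 4)); do 2!eexists; split; first by lia.
  + apply: steps_trans st1 _; apply: steps_trans st2 _.
    apply: (@steps1 _ _ _ _ _ _); first by rewrite /step /fetch /= h1 /=; reflexivity.
    apply: (@steps1 _ _ _ _ _ _); first by rewrite /step /fetch /= h2 /=; reflexivity.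
    apply: (@steps1 _ _ _ _ _ _); first by rewrite /step /fetch /= h3 /=; reflexivity.
    apply: (@steps1 _ _ _ _ _ _).
      rewrite /step /fetch /= h4 /= r0 rN /eval_binop -/W (modn_small kW).
      rewrite [k * N %% _]modn_small; last by lia.
      rewrite [_ + k * N]addnC (modn_small aW) am /= r2; reflexivity.
    have -> : i + (esize e1 + (esize e2 + 4)) = (i + esize e1 + esize e2).+4 by lia.
    exact: steps0.
  + case: ms2 => m1 m2 m3 m4 m5; split=> //=.
    * move=> r hr.
      have -> : (r == nreg) = false by apply/eqP; lia.
      have -> : (r == nreg.+2) = false by apply/eqP; lia.
      exact: m1.
    * move=> k' x kn' xN.
      case: (eqVneq k' k) => [->|nk].
        by rewrite eqn_add2l; case: eqP => // _; rewrite m4.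
      rewrite -(m4 _ _ kn' xN); case: eqP => // /eqP.
      (* Distinct arrays occupy disjoint address blocks of length [N]. *)
      have [lk|lk] : k' < k \/ k < k' by lia.
        have : k'.+1 * N <= k * N by rewrite leq_mul2r lk orbT.
        by rewrite mulSn => ? /eqP; lia.
      have : k.+1 * N <= k' * N by rewrite leq_mul2r lk orbT.
      by rewrite mulSn => ? /eqP; lia.
    * move=> k' x kn' xN; case: (k' == k); last exact: m5.
      by case: eqP => // _; exact: m5.
Qed.

Lemma triple_blk l s Q : all swf l -> ok l s Q -> triple (Blk l) s (lcost l) Q.
Proof.
elim: l s => [|c l IH] s /=.
  move=> _ q P i rg mm _ ms; exists 0, rg, mm, s; split=> //.
  by rewrite addn0; exact: steps0.
case/andP=> wc wl [sc okl] P i rg mm /code_at_cat[cc cl] ms.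
have [k1 [rg1 [mm1 [le1 st1 ms1]]]] := scomp_ok wc cc ms sc.
rewrite size_scomp in cl.
have [k2 [rg2 [mm2 [s2 [le2 st2 ms2 q]]]]] := IH _ wl okl _ _ _ _ cl ms1.
exists (k1 + k2), rg2, mm2, s2; split=> //; first by rewrite /lcost /= -/(lcost l); lia.
rewrite size_cat size_scomp addnA; exact: steps_trans st1 st2.
Qed.

Lemma triple_weaken c s B B' (Q Q' : state -> Prop) :
  triple c s B Q -> B <= B' -> (forall s', Q s' -> Q' s') -> triple c s B' Q'.
Proof.
move=> h hB hQ P i rg mm cc ms.
have [k [rg1 [mm1 [s1 [le1 st1 ms1 q1]]]]] := h _ _ _ _ cc ms.
exists k, rg1, mm1, s1; split=> //; [exact: leq_trans hB | exact: hQ].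
Qed.

Lemma triple_blk_le l s B Q :
  all swf l -> ok l s Q -> lcost l <= B -> triple (Blk l) s B Q.
Proof. by move=> h1 h2 h3; apply: triple_weaken (triple_blk h1 h2) h3 _. Qed.

Lemma triple_seq c1 c2 s B1 B2 Q1 Q :
  triple c1 s B1 Q1 -> (forall s1, Q1 s1 -> triple c2 s1 B2 Q) ->
  triple (Seq c1 c2) s (B1 + B2) Q.
Proof.
move=> h1 h2 P i rg mm /= /code_at_cat[cc1 cc2] ms.
have [k1 [rg1 [mm1 [s1 [le1 st1 ms1 q1]]]]] := h1 _ _ _ _ cc1 ms.
have [k2 [rg2 [mm2 [s2 [le2 st2 ms2 q2]]]]] := h2 _ q1 _ _ _ _ cc2 ms1.
exists (k1 + k2), rg2, mm2, s2; split=> //; first by lia.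
rewrite size_cat addnA; exact: steps_trans st1 st2.
Qed.

Definition For (x : nat) (e : expr) (c : cmd) : cmd :=
  Seq (Blk [:: Asg x (Cst 0)])
   (While (Bin BLt (Var x) e) (Seq c (Blk [:: Asg x (Bin BAdd (Var x) (Cst 1))]))).

Lemma triple_while_done e c s (Q : state -> Prop) :
  ewf e -> esafe s e -> ev s e = 0 -> Q s -> triple (While e c) s (esize e + 1) Q.
Proof.
move=> we se e0 q P i rg mm /= /code_at_cat[ca cb] ms.
have [v1 [k1 [rg1 [le1 st1 r1 f1]]]] := ecomp_ok we (leqnn _) ca ms se.
case/code_at_cons: cb => h1 _; rewrite size_ecomp in h1.
exists (k1 + 1), rg1, mm, s; split=> //; first by lia.
- apply: steps_trans st1 _.
  apply: (@steps1 _ _ _ _ _ _); first by rewrite /step /fetch /= h1 /= r1 e0 /=; reflexivity.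
  rewrite /= !size_cat /= !size_cat /= !size_ecomp.
  set a := (X in steps _ _ (Config X _ _) _).
  set b := (X in steps _ _ _ (Config X _ _)).
  have -> : a = b by rewrite /a /b; lia.
  exact: steps0.
- by apply: represents_eqreg ms => r hr; rewrite f1 //; lia.
Qed.

Lemma triple_while_step e c s B B' (Q1 Q : state -> Prop) :
  ewf e -> esafe s e -> ev s e != 0 -> triple c s B Q1 ->
  (forall s1, Q1 s1 -> triple (While e c) s1 B' Q) ->
  triple (While e c) s (esize e + 2 + B + B') Q.
Proof.
move=> we se e0 hc hw P i rg mm ccw ms.
case/code_at_cat: (ccw) => [ca cb].
have [v1 [k1 [rg1 [le1 st1 r1 f1]]]] := ecomp_ok we (leqnn _) ca ms se.
have ms1 : represents s rg1 mm by apply: represents_eqreg ms => r hr; rewrite f1 //; lia.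
case/code_at_cons: cb => h1 /code_at_cat[cc /code_at_cons[h2 _]].
have [k2 [rg2 [mm2 [s2 [le2 st2 ms2 q2]]]]] := hc _ _ _ _ cc ms1.
have [k3 [rg3 [mm3 [s3 [le3 st3 ms3 q3]]]]] := hw _ q2 _ _ _ _ ccw ms2.
exists (k1 + (k2 + k3.+1).+1), rg3, mm3, s3; split=> //; first by lia.
apply: steps_trans st1 _.
rewrite !size_ecomp in h1 h2 st2 *.
apply: (@steps1 _ _ _ _ _ _).
  by rewrite /step /fetch /= h1 /= r1 (negbTE e0); reflexivity.
apply: steps_trans st2 _.
apply: (@steps1 _ _ _ _ _ _); first by rewrite /step /fetch /= h2 /=; reflexivity.
exact: st3.
Qed.

(** The cost [B i] may vary with the iteration, as it must for the bottom-up pass, where it is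
    proportional to a degree. The constant 12 covers the test, the jumps and the increment of the
    counter. *)
Lemma triple_for x e c s M (I : nat -> state -> Prop) (B : nat -> nat) :
  0 < x < nreg -> ewf e -> M < W ->
  I 0 (setv s x 0) ->
  (forall i s', I i s' -> i <= M -> esafe s' e /\ ev s' e = M) ->
  (forall i s', i < M -> I i s' -> vr s' x = i ->
     triple c s' (B i) (fun s2 => vr s2 x = i /\ I i.+1 (setv s2 x i.+1))) ->
  triple (For x e c) s (\sum_(i < M) (B i + (esize e + 12)) + (esize e + 12))
    (fun s' => I M s').
Proof.
case/andP=> x0 xR we MW I0 Ie Ic.
have -> : \sum_(i < M) (B i + (esize e + 12)) + (esize e + 12) =
   lcost [:: Asg x (Cst 0)] + (\sum_(i < M) (B i + (esize e + 12)) + (esize e + 9)).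
  by rewrite /lcost /=; lia.
apply: (@triple_seq _ _ _ _ _ (fun s' => I 0 s' /\ vr s' x = 0)).
  by apply: triple_blk; rewrite /= ?x0 ?xR // eqxx; split=> //; lia.
move=> {s I0} s [I0 v0]; set wh := While _ _.
suff main d : forall i s, i + d = M -> I i s -> vr s x = i ->
    triple wh s (\sum_(i <= k < M) (B k + (esize e + 12)) + (esize e + 9))
      (fun s' => I M s').
  by move: (main M 0 s (erefl _) I0 v0); rewrite big_mkord.
have wt : ewf (Bin BLt (Var x) e) by rewrite /= xR we.
elim: d => [|d IH] i {I0 v0}s iM Ii vi.
  have iM' : i = M by lia.
  have [se ee] := Ie _ _ Ii ltac:(lia).
  apply: (triple_weaken (B := esize (Bin BLt (Var x) e) + 1)
                   (Q := fun s' => I M s')) => //=; last by rewrite addnS addSn; lia.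
  apply: triple_while_done => //=; first by rewrite vi ee iM' ltnn.
  by rewrite -iM'.
have lt_iM : i < M by lia.
have [se ee] := Ie _ _ Ii ltac:(lia).
rewrite big_ltn //.
set S := \sum_(_ <= _ < _) _.
apply: (triple_weaken (B := esize (Bin BLt (Var x) e) + 2 +
    (B i + lcost [:: Asg x (Bin BAdd (Var x) (Cst 1))]) + (S + (esize e + 9)))
    (Q := fun s' => I M s')) => //; last by rewrite /lcost /=; lia.
apply: (triple_while_step (Q1 := fun s' => I i.+1 s' /\ vr s' x = i.+1)) => //=.
- by rewrite vi ee lt_iM.
- apply: triple_seq (Ic i s lt_iM Ii vi) _ => s1 [vx I1].
  apply: triple_blk; first by rewrite /= x0 xR.
  by rewrite /= vx addn1 eqxx; split=> //; split=> //; lia.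
- by move=> s1 [I1 v1]; apply: IH => //; lia.
Qed.

Lemma triple_for_const x e c s M (I : nat -> state -> Prop) (b : nat) B :
  0 < x < nreg -> ewf e -> M < W ->
  M * (b + (esize e + 12)) + (esize e + 12) <= B ->
  I 0 (setv s x 0) ->
  (forall i s', I i s' -> i <= M -> esafe s' e /\ ev s' e = M) ->
  (forall i s', i < M -> I i s' -> vr s' x = i ->
     triple c s' b (fun s2 => vr s2 x = i /\ I i.+1 (setv s2 x i.+1))) ->
  triple (For x e c) s B (fun s' => I M s').
Proof.
move=> hx we MW hB I0 Ie Ic.
have := triple_for (B := fun=> b) hx we MW I0 Ie Ic.
by rewrite sum_nat_const card_ord => h; apply: triple_weaken h hB _.
Qed.

Lemma ok_nil s (Q : state -> Prop) : Q s -> ok [::] s Q.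
Proof. by []. Qed.

(** Naming the assigned value [a] lets symbolic execution record its mathematical meaning instead of
    a nested evaluation. *)
Lemma ok_asg x e l s Q a :
  esafe s e -> ev s e = a -> ok l (setv s x a) Q -> ok (Asg x e :: l) s Q.
Proof. by move=> h1 <-. Qed.

Lemma ok_st k e1 e2 l s Q x a :
  esafe s e1 -> esafe s e2 -> ev s e1 = x -> ev s e2 = a -> x < N ->
  ok l (seta s k x a) Q -> ok (St k e1 e2 :: l) s Q.
Proof. by move=> h1 h2 <- <-. Qed.

End Machine.

Arguments ok : simpl never.

(** Reads [n] from cell 0 and leaves the array length [6 * n] in register 0. This length suffices:
    the input has [2n - 1] cells, and the slot counters need at most [5n] ([offs_le]). *)
Definition prelude : seq instr :=
  [:: IConst 1 0; ILoad 0 1; IConst 1 6; IOp BMul 0 0 1].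

Definition program_of (c : cmd) : program := prelude ++ ccomp c 4.

Definition start (n : nat) (input : seq nat) : state :=
  State (fun r => if r == 0 then 6 * n else if r == 1 then 6 else 0)
    (fun k x => nth 0 input (k * (6 * n) + x)).

Lemma run_program_of w n input c B Q :
  0 < n -> nth 0 input 0 = n -> narr * (6 * n) <= 2 ^ w ->
  (forall x, nth 0 input x <= n) ->
  triple w (6 * n) c (start n input) B Q ->
  exists (t : nat) (cf : config) (s : state), [/\ t <= B + 4,
    run w (narr * 6 * n) (program_of c) t (init_config input) = Some cf,
    halted (program_of c) cf, Q s &
    forall x, x < 6 * n -> memory cf x = ar s 0 x].
Proof.
move=> n0 e0 hW hin hT.
have W6 : 120 * n <= 2 ^ w by move: hW; rewrite /narr; lia.
(* The four register writes of [prelude], the last one outermost. *)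
pose rg : nat -> nat := [eta [eta [eta [eta fun=> 0 with 1 |-> 0] with 0 |-> n]
  with 1 |-> 6 %% 2 ^ w] with 0 |-> eval_binop w BMul n (6 %% 2 ^ w)].
have cc : code_at (program_of c) 4 (ccomp c 4).
  by move=> j hj; rewrite /program_of nth_cat; case: ltnP => [h|_]; [by move: h => /=; lia | by rewrite addKn].
have ms : represents w (6 * n) (start n input) rg (nth 0 input).
  split=> //=; last 1 first.
  - by move=> k x _ _; have := hin (k * (6 * n) + x); lia.
  - move=> r _; rewrite /rg /eval_binop /=; case: eqP => // _.
      by rewrite (modn_small (m := 6)) 1?mulnC ?modn_small //; lia.
    by case: eqP => // _; rewrite modn_small //; lia.
  - by move=> r _; case: eqP => // _; [lia|case: eqP => // _; lia].
have [k [rg' [mm' [s' [le st ms' q]]]]] := hT _ _ _ _ cc ms.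
exists (4 + k), (Config (4 + size (ccomp c 4)) rg' mm'), s'; split=> //.
- by rewrite addnC leq_add2r.
- rewrite -mulnA.
  apply: steps_trans st; rewrite /steps /run /= /step /fetch /= mod0n.
  by rewrite !muln_gt0 n0 /= e0.
- rewrite /halted /fetch nth_default // /program_of size_cat; exact: leqnn.
- by move=> x hx; rewrite /= -(repr_mem ms').
Qed.

(** * Trees and edge lists *)

Section Trees.
Variables (V : finType) (G : sgraph V).
Implicit Types (U : {set V}) (u v x y : V).

Definition nb U v : {set V} := [set u in U | adj G v u].

Definition adj_in U : rel V := [rel x y | [&& x \in U, y \in U & adj G x y]].

Definition conn U : Prop := {in U &, forall x y, connect (adj_in U) x y}.

Lemma adj_inW U x y : adj_in U x y -> adj G x y.
Proof. by case/and3P. Qed.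

Lemma path_adj_inW U x p : path (adj_in U) x p -> path (adj G) x p.
Proof. by apply: sub_path => ? ?; apply: adj_inW. Qed.

Lemma nb_gt0 U v : conn U -> 1 < #|U| -> v \in U -> 0 < #|nb U v|.
Proof.
move=> cU U1 vU.
have [u] : exists u, u \in U :\ v.
  by apply/set0Pn; rewrite -card_gt0 -ltnS; move: U1; rewrite (cardsD1 v) vU.
rewrite !inE => /andP[uv uU].
case/connectP: (cU _ _ vU uU) => [[|y p]] /= pth; first by move=> e; rewrite e eqxx in uv.
case/andP: pth => /and3P[_ yU avy] _ _.
by apply/card_gt0P; exists y; rewrite !inE yU.
Qed.

(* A longest simple path of a graph without leaves closes up to a cycle.      *)
Lemma exists_leaf U : acyclic_graph G -> conn U -> 1 < #|U| ->
  exists2 v, v \in U & #|nb U v| = 1.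
Proof.
move=> acG cU U1.
have [/exists_inP[v vU /eqP e]|/exists_inPn noleaf] :=
  boolP [exists v in U, #|nb U v| == 1]; first by exists v.
have deg2 v : v \in U -> 1 < #|nb U v|.
  by move=> vU; have := nb_gt0 cU U1 vU; have := noleaf v vU; lia.
suff grow k : exists x p, [/\ x \in U, path (adj_in U) x p, uniq (x :: p) & size p = k.+1].
  have [x [p [_ _ uq sz]]] := grow #|V|.
  by have := max_card (mem (x :: p)); rewrite (card_uniqP uq) /= sz ltnNge leqnSn.
elim: k => [|k [x [p [xU pth uq sz]]]].
  have [x xU] : exists x, x \in U by apply/set0Pn; rewrite -card_gt0; lia.
  have /card_gt0P[y] := ltnW (deg2 x xU).
  rewrite !inE => /andP[yU axy]; exists x, [:: y].
  rewrite /= /adj_in /= !inE xU yU axy ?andbT; split=> //; rewrite ?andbT.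
  by apply: contraTneq axy => ->; rewrite adj_irrefl.
case: p sz pth uq => [//|y p] [sz] pth uq.
have [z] : exists z, z \in nb U x :\ y.
  apply/set0Pn; rewrite -card_gt0 -ltnS; have := deg2 x xU.
  by rewrite (cardsD1 y); case: (y \in _); lia.
rewrite !inE => /and3P[zy zU axz].
have zx : z != x by apply: contraTneq axz => ->; rewrite adj_irrefl.
have [zp|zp] := boolP (z \in x :: y :: p); last first.
  exists z, (x :: y :: p); split=> //=; last by rewrite sz.
  - by apply/andP; split; [rewrite /adj_in /= zU xU adj_sym | exact: pth].
  - by rewrite zp; exact: uq.
exfalso; move: zp; rewrite !inE (negbTE zx) (negbTE zy) /= => zp.
case/splitPr: zp pth uq {sz} => p1 p2 pth uq.
apply: (acG (x :: y :: rcons p1 z)); first by rewrite /= size_rcons.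
have e : x :: y :: p1 ++ z :: p2 = (x :: y :: rcons p1 z) ++ p2.
  by rewrite /= cat_rcons.
apply/andP; split; last first.
  by move: uq; rewrite e cat_uniq => /and3P[].
move/path_adj_inW: pth.
rewrite /= -cat_rcons cat_path rcons_path => /and3P[axy p1a _].
by rewrite !rcons_path p1a axy /= last_rcons adj_sym.
Qed.

(** A simple path between two other vertices that met [v] would enter and leave it through two
    distinct neighbours, so it avoids [v]. *)
Lemma conn_del U v : conn U -> #|nb U v| <= 1 -> conn (U :\ v).
Proof.
move=> cU nbv x y; rewrite !inE => /andP[xv xU] /andP[yv yU].
case/connectP: (cU _ _ xU yU) => p0 pth0 ey.
case/shortenP: pth0 ey => p pth uq _ ey.
have vp : v \notin p.
  apply/negP => vp; case/splitPr: vp pth uq ey => p1 p2 pth uq ey.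
  case: p2 pth uq ey => [|z p2] pth uq ey.
    by rewrite last_cat /= in ey; rewrite ey eqxx in yv.
  move: pth; rewrite cat_path /= => /and4P[_ /and3P[aU _ a1] /and3P[_ zU a2] _].
  have : #|[set last x p1; z]| <= 1.
    apply: leq_trans nbv; apply/subset_leq_card/subsetP => t.
    rewrite !inE => /orP[]/eqP->; last by rewrite zU a2.
    by rewrite aU adj_sym a1.
  rewrite cards2; case: eqP => // e _.
  move: uq; rewrite -cat_cons cat_uniq => /and3P[_ /hasPn/(_ z) h _].
  have zin : z \in v :: z :: p2 by rewrite !inE eqxx orbT.
  by have := h zin; rewrite -e; apply/negP; rewrite negbK; exact: mem_last.
apply/connectP; exists p => //.
elim: p x xv xU pth vp {ey uq} => [//|z p IH] x xv xU /andP[/and3P[_ zU a] pth].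
rewrite inE negb_or => /andP[vz vp].
have zv : z != v by rewrite eq_sym.
by rewrite /= {1}/adj_in /= !inE xv xU zv zU a /=; apply: IH.
Qed.

Lemma nb_del U v u : nb (U :\ v) u = nb U u :\ v.
Proof. by apply/setP => x; rewrite !inE andbA. Qed.

Lemma card_nb_del U v u :
  #|nb (U :\ v) u| = #|nb U u| - ((v \in U) && adj G u v).
Proof. by rewrite nb_del [#|nb U u|](cardsD1 v) !inE; lia. Qed.

(** Removing a leaf lowers the degree sum by two: its own degree, and one at its only neighbour.
    This identity gives both the number of edges and the linear time bound. *)
Lemma sum_card_nb U : acyclic_graph G -> conn U -> 0 < #|U| ->
  \sum_(v in U) #|nb U v| + 2 = 2 * #|U|.
Proof.
move=> acG; move: {2}#|U| (leqnn #|U|) => k.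
elim: k U => [|k IH] U leU cU U0; first by lia.
have [U1|U1] := leqP #|U| 1.
  have /eqP/cards1P[x ->] : #|U| = 1 by lia.
  rewrite big_set1 cards1.
  suff -> : nb [set x] x = set0 by rewrite cards0.
  apply/setP => y; rewrite !inE; apply/andP => -[/eqP->]; by rewrite adj_irrefl.
have [v vU nv] := exists_leaf acG cU U1.
have cU' := conn_del cU (eq_leq nv).
have eU := cardsD1 v U; rewrite vU add1n in eU.
have IHv := IH (U :\ v) ltac:(lia) cU' ltac:(lia).
rewrite (big_setD1 v vU) /= nv eU mulnS -IHv.
have [p pn] : exists p, nb U v = [set p] by apply/cards1P; rewrite nv.
have : p \in nb U v by rewrite pn set11.
rewrite !inE => /andP[pU avp].
have pU' : p \in U :\ v.
  by rewrite !inE pU andbT; apply: contraTneq avp => ->; rewrite adj_irrefl.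
rewrite (big_setD1 p pU') /= [in RHS](big_setD1 p pU') /=.
rewrite card_nb_del vU adj_sym avp /=.
have pos : 0 < #|nb U p| by apply/card_gt0P; exists v; rewrite !inE vU adj_sym.
have -> : \sum_(i in (U :\ v) :\ p) #|nb (U :\ v) i| =
  \sum_(i in (U :\ v) :\ p) #|nb U i|.
  apply: eq_bigr => i; rewrite !inE => /and3P[ip iv iU].
  rewrite card_nb_del vU /= adj_sym.
  have : (i \in nb U v) = false by rewrite pn inE (negbTE ip).
  by rewrite inE iU /= => ->; rewrite subn0.
by lia.
Qed.

End Trees.

(** * Neighbour sums computed from a list of edges *)

Section EdgeList.
Variables (n : nat) (G : sgraph 'I_n) (es : seq ('I_n * 'I_n)).
Hypothesis es_G : edge_list G es.

Definition eidx (u v : 'I_n) : nat := index [set u; v] [seq edge_of p | p <- es].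

Lemma eidxC u v : eidx u v = eidx v u.
Proof. by rewrite /eidx setUC. Qed.

Lemma mem_edges u v : ([set u; v] \in edges G) = adj G u v.
Proof.
apply/imsetP/idP => [[[x y]]|a]; last by exists (u, v); rewrite ?inE.
rewrite inE /= => a e.
have ux : u \in [set x; y] by rewrite -e set21.
have xu : x \in [set u; v] by rewrite e set21.
have yu : y \in [set u; v] by rewrite e set22.
have xy : x != y by apply: contraTneq a => ->; rewrite adj_irrefl.
case/set2P: ux => ?; subst u.
  by case/set2P: yu => e'; [rewrite e' eqxx in xy | rewrite -e'].
by case/set2P: xu => e'; [rewrite e' eqxx in xy | rewrite adj_sym -e'].
Qed.

Lemma edges_uniq : uniq [seq edge_of p | p <- es].
Proof. by rewrite (perm_uniq es_G) enum_uniq. Qed.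

Lemma mem_es f : (f \in [seq edge_of p | p <- es]) = (f \in edges G).
Proof. by rewrite (perm_mem es_G) mem_enum. Qed.

Lemma eidx_lt u v : adj G u v -> eidx u v < size es.
Proof. by move=> a; rewrite -(size_map (@edge_of n)) index_mem mem_es mem_edges. Qed.

Lemma nth_eidx x0 u v : adj G u v -> edge_of (nth x0 es (eidx u v)) = [set u; v].
Proof.
move=> a; rewrite -(nth_map _ (edge_of x0)); last exact: eidx_lt.
by apply: nth_index; rewrite mem_es mem_edges.
Qed.

Lemma es_adj i x0 : i < size es -> adj G (nth x0 es i).1 (nth x0 es i).2.
Proof.
move=> hi; rewrite -mem_edges -mem_es.
by apply/mapP; exists (nth x0 es i) => //; apply: mem_nth.
Qed.

Lemma eidx_nth i x0 : i < size es ->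
  eidx (nth x0 es i).1 (nth x0 es i).2 = i.
Proof.
move=> hi; rewrite /eidx -[[set _; _]]/(edge_of (nth x0 es i)).
by rewrite -(nth_map _ (edge_of x0)) // index_uniq ?size_map // edges_uniq.
Qed.

(** The total accumulated at [v] by a pass over the first [k] edges. Taking for [g] the constant 1,
    the name of the other endpoint, or the edge position gives the contents of [aDEG], [aSN] and
    [aSE]. *)
Definition half_sum (g : nat -> nat -> nat) (x0 : 'I_n * 'I_n) (k v : nat) : nat :=
  \sum_(i < k) (((nth x0 es i).1 == v :> nat) * g i (nth x0 es i).2 +
                ((nth x0 es i).2 == v :> nat) * g i (nth x0 es i).1).

Lemma half_sumE (g : nat -> nat -> nat) x0 (v : 'I_n) :
  half_sum g x0 (size es) v = \sum_(u in nb G setT v) g (eidx v u) u.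
Proof.
rewrite /half_sum.
(* Double counting: the edge at position [i] contributes through the neighbour [u] of [v] with
   [eidx v u = i], if any; then the sums are exchanged. *)
transitivity (\sum_(i < size es) \sum_(u in nb G setT v | eidx v u == i) g i u).
  apply: eq_bigr => i _.
  have ai := es_adj x0 (ltn_ord i); have ei := eidx_nth x0 (ltn_ord i).
  have fi := @nth_eidx x0 _ _ ai; rewrite ei in fi.
  set p := nth x0 es i in ai ei fi *.
  have p12 : p.1 != p.2 by apply: contraTneq ai => ->; rewrite adj_irrefl.
  have key u : (u \in nb G setT v) && (eidx v u == i) =
     ((p.1 == v) && (u == p.2)) || ((p.2 == v) && (u == p.1)).
    rewrite !inE /=; apply/andP/orP => [[a /eqP e]|].
      have e2 : [set p.1; p.2] = [set v; u] by rewrite -(nth_eidx x0 a) e.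
      have /set2P h1 : p.1 \in [set v; u] by rewrite -e2 set21.
      have /set2P h2 : p.2 \in [set v; u] by rewrite -e2 set22.
      case: h1 h2 => h1 [] h2; rewrite h1 h2 ?eqxx; try by [left|right].
      - by rewrite h1 h2 eqxx in p12.
      - by rewrite h1 h2 eqxx in p12.
    by case=> /andP[/eqP<- /eqP->]; split=> //; rewrite ?ei // ?[eidx p.2 _]eidxC ?ei // adj_sym.
  rewrite (eq_bigl _ _ key) !val_eqE.
  have [pv1|pv1] := eqVneq p.1 v; have [pv2|pv2] := eqVneq p.2 v => /=.
  - by rewrite pv1 pv2 eqxx in p12.
  - rewrite (eq_bigl (pred1 p.2)); last by move=> u; rewrite orbF.
    by rewrite big_pred1_eq mul1n mul0n addn0.
  - by rewrite big_pred1_eq mul1n mul0n.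
  - by rewrite big_pred0 // !mul0n.
rewrite (exchange_big_dep (mem (nb G setT v))) /=; last by move=> i j _ /andP[].
apply: eq_bigr => u; rewrite !inE /= => a.
rewrite (big_pred1 (Ordinal (eidx_lt a))) // => i.
rewrite a /=; apply/idP/idP => [/eqP e|/eqP->]; last exact: eqxx.
by apply/eqP; apply: val_inj; rewrite /= e.
Qed.

(** Summing degrees over the edge list counts every edge twice, to be compared with
    [sum_card_nb]. *)
Lemma size_edge_list : is_tree G -> size es + 1 = n.
Proof.
case=> -[n0 cG] acG.
have cT : conn G setT.
  move=> x y _ _; rewrite (eq_connect (e' := adj G)) // => u v.
  by rewrite /adj_in /= !inE.
have := sum_card_nb acG cT; rewrite cardsT => /(_ n0).
have x0 : 'I_n by rewrite card_ord in n0; exact: Ordinal n0.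
have -> : \sum_(v in [set: 'I_n]) #|nb G [set: 'I_n] v| =
  \sum_(v : 'I_n) half_sum (fun _ _ => 1) (x0, x0) (size es) v.
  apply: eq_big => v; rewrite ?inE // => _.
  by rewrite (half_sumE (fun _ _ => 1)) sum1_card.
rewrite /half_sum exchange_big /= (eq_bigr (fun=> 2)).
  by rewrite sum_nat_const card_ord card_ord; lia.
move=> i _; rewrite big_split /=.
have one (p : 'I_n) : \sum_(v : 'I_n) (p == v :> nat) * 1 = 1.
  rewrite (bigD1 p) //= eqxx big1 // => v vp.
  by rewrite val_eqE eq_sym (negbTE vp).
by rewrite !one.
Qed.

End EdgeList.

(** * Admissible choices at a vertex *)

(* Degrees [j] are shifted by one throughout, so that 0 can mean "none":      *)
(* [F] and [L] are the first and the last admissible value, and [select] is   *)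
(* an admissible value whose code [b + j * C] differs from [sg], if any.      *)
Definition select (b C F L sg : nat) : nat :=
  if F != 0 then if b + F * C == sg then if b + L * C == sg then 0 else L
                 else F
  else 0.

Definition first_last (loc : pred nat) (m F L : nat) : Prop :=
  [/\ F = 0, L = 0 & forall j, 0 < j <= m -> ~~ loc j] \/
  [/\ 0 < F <= m /\ 0 < L <= m, loc F, loc L &
      F = L -> forall j, 0 < j <= m -> loc j -> j = F].

Lemma first_last_step (loc : pred nat) m F L : first_last loc m F L ->
  first_last loc m.+1 (if loc m.+1 then (if F != 0 then F else m.+1) else F)
                      (if loc m.+1 then m.+1 else L).
Proof.
case=> [[-> -> h]|[[hF hL] lF lL h]] /=; case: ifP => lm.
- right; split; [by rewrite leqnn | by [] | by [] |].
  move=> _ j /andP[j0]; rewrite leq_eqVlt => /orP[/eqP->//|jm] lj.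
  by have := h j; rewrite j0 lj => /(_ jm).
- left; split=> // j /andP[j0]; rewrite leq_eqVlt => /orP[/eqP->|jm].
    by rewrite lm.
  by apply: h; rewrite j0.
- have -> : F != 0 by lia.
  by right; split; [lia | by [] | by [] | lia].
- right; split; [lia | by [] | by [] |].
  move=> e j /andP[j0]; rewrite leq_eqVlt => /orP[/eqP->|jm] lj.
    by rewrite lm in lj.
  by apply: h; rewrite ?j0.
Qed.

Lemma select_sound (loc : pred nat) m b C F L sg : first_last loc m F L ->
  select b C F L sg != 0 ->
  [/\ 0 < select b C F L sg <= m, loc (select b C F L sg) &
      b + select b C F L sg * C != sg].
Proof.
rewrite /select => -[[-> -> h]|[[hF hL] lF lL h]] //.
have -> : F != 0 by lia.
have [eF|nF] := eqVneq (b + F * C) sg; last by split.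
by have [eL|nL] := eqVneq (b + L * C) sg; last by split.
Qed.

(** If both [F] and [L] have code [sg], then [F = L] because codes are injective in [j]; the only
    admissible value is then the excluded one, contradicting the choice of [j]. *)
Lemma select_complete (loc : pred nat) m b C F L sg j : 0 < C ->
  first_last loc m F L -> 0 < j <= m -> loc j -> b + j * C != sg ->
  select b C F L sg != 0.
Proof.
rewrite /select => C0 [[-> -> h]|[[hF hL] lF lL h]] hj lj nj.
  by have := h j hj; rewrite lj.
have F0 : F != 0 by lia.
rewrite F0; have [eF|//] := eqVneq (b + F * C) sg.
have [eL|nL] := eqVneq (b + L * C) sg; last by lia.
have FL : F = L.
  by apply/eqP; rewrite -(eqn_pmul2r C0) -(eqn_add2l b) eF eL.
by have ej := h FL j hj lj; rewrite ej eF eqxx in nj.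
Qed.

(* The slot, at a vertex with code [bp + j * C], in which a child with codes     *)
(* [b + F * C] and [b + L * C] is counted: slot [j] if the choice [j] is the  *)
(* only one that blocks the child, slot 0 if every choice does, and [dp] if   *)
(* none does.                                                                 *)
Definition slot (b C F L bp dp : nat) : nat :=
  let q := if bp < b + F * C then (b + F * C - bp) %/ C else 0 in
  if F != 0 then
    if F == L then
      if bp + q * C == b + F * C then
        if q < dp then if q != 0 then q else dp else dp
      else dp
    else dp
  else 0.

(** The intersection of two sets of blocking choices, each being everything (0), a singleton, or
    empty ([dp]). *)
Definition both_slot (t0 t1 dp : nat) : nat :=
  if t0 != 0 then if t1 != 0 then if t0 == t1 then t0 else dp else t0 else t1.

Lemma slot_le b C F L bp dp : slot b C F L bp dp <= dp.
Proof.
rewrite /slot; set q := if bp < _ then _ else _.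
case: (F != 0) => //; case: (F == L) => //; case: (_ == b + _) => //.
by case: (ltnP q dp) => // h; case: (q != 0) => //; apply: ltnW.
Qed.

Lemma both_slot_le t0 t1 dp : t0 <= dp -> t1 <= dp -> both_slot t0 t1 dp <= dp.
Proof. by rewrite /both_slot => *; do 3?case: ifP. Qed.

(** The truncated quotient [q] is the only candidate for a blocking choice. The equality test in
    [slot] rejects an inexact quotient, and a value outside the range of choices is sent to [dp]. *)
Lemma slot_select (loc : pred nat) m b C F L bp dp j : 0 < C ->
  first_last loc m F L -> 0 < j < dp ->
  (slot b C F L bp dp == 0) || (slot b C F L bp dp == j) =
  (select b C F L (bp + j * C) == 0).
Proof.
move=> C0 hFL /andP[j0 jd]; rewrite /slot /select.
case: hFL => [[-> -> _]|[[hF hL] _ _ _]] //.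
have -> : F != 0 by lia.
have [<-|nFL] := eqVneq F L; last first.
  have -> : (dp == 0) || (dp == j) = false by lia.
  have [eF|_] := eqVneq (b + F * C) _; last by lia.
  have [eL|_] := eqVneq (b + L * C) _; last by lia.
  case/negP: nFL; apply/eqP/eqP.
  by rewrite -(eqn_pmul2r C0) -(eqn_add2l b) eF eL.
have [->|nX] := eqVneq (b + F * C) (bp + j * C).
  have -> : bp < bp + j * C by nia.
  by rewrite addKn mulnK // eqxx jd -lt0n j0 eqxx orbT.
rewrite [F == 0](_ : _ = false); last by lia.
set q := if bp < _ then _ else _.
have [eq|_] := eqVneq (bp + q * C) _; last by lia.
have qj : q != j by apply: contra_neq nX => <-; rewrite eq.
by case: ifP => _; last (by lia); case: ifP => q0; lia.
Qed.

Lemma both_slotE t0 t1 dp j : 0 < j < dp ->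
  (both_slot t0 t1 dp == 0) || (both_slot t0 t1 dp == j) =
  ((t0 == 0) || (t0 == j)) && ((t1 == 0) || (t1 == j)).
Proof.
move=> hj; rewrite /both_slot.
have [->|n0] /= := eqVneq t0 0; first by [].
have [->|n1] /= := eqVneq t1 0; first by rewrite (negbTE n0) andbT.
have [->|n2] := eqVneq t0 t1; first by rewrite (negbTE n1) andbb.
by lia.
Qed.

Lemma mem_full n (qs : seq 'I_n) v : uniq qs -> size qs = n -> v \in qs.
Proof.
move=> uq sz; apply/negPn/negP => h.
have u : uniq (v :: qs) by rewrite /= h uq.
have := max_card (mem (v :: qs)).
by rewrite (card_uniqP u) card_ord /= sz ltnn.
Qed.

Lemma first_last_eq (loc loc' : pred nat) m F L :
  (forall j, 0 < j <= m -> loc j = loc' j) ->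
  first_last loc m F L -> first_last loc' m F L.
Proof.
move=> e [[-> -> h]|[[hF hL] lF lL h]]; [left | right]; split; rewrite -?e //.
- by move=> j hj; rewrite -e // h.
- by move=> FL j hj; rewrite -e //; apply: h.
Qed.

Lemma first_last_le (loc : pred nat) m F L : first_last loc m F L -> F <= m /\ L <= m.
Proof. by case=> [[-> ->]|[[/andP[_ ->] /andP[_ ->]]]]. Qed.

(** * Elimination orders and completeness of the recursion *)

Section Order.
Variables (n : nat) (G : sgraph 'I_n) (x0 : 'I_n).
Variables (qs : seq 'I_n) (par : 'I_n -> 'I_n).

Definition tree_root := nth x0 qs n.-1.
Definition elim_index (v : 'I_n) := index v qs.

(** The root is the vertex removed last; [eo_par] says that a vertex has no later neighbour other
    than its parent. *)
Record elim_order : Prop := ElimOrder {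
  eo_uniq : uniq qs;
  eo_size : size qs = n;
  eo_adj : forall v, v != tree_root -> adj G v (par v);
  eo_lt : forall v, v != tree_root -> elim_index v < elim_index (par v);
  eo_par : forall u v, adj G u v -> elim_index u < elim_index v -> par u = v }.

Hypothesis EO : elim_order.

Lemma n_pos : 0 < n. Proof. exact: leq_ltn_trans (leq0n _) (ltn_ord x0). Qed.

Lemma mem_qs v : v \in qs.
Proof. exact: mem_full (eo_uniq EO) (eo_size EO). Qed.

Lemma elim_index_lt v : elim_index v < n.
Proof. by rewrite -(eo_size EO) index_mem mem_qs. Qed.

Lemma nth_elim_index v : nth x0 qs (elim_index v) = v.
Proof. by rewrite nth_index // mem_qs. Qed.

Lemma elim_index_nth i : i < n -> elim_index (nth x0 qs i) = i.
Proof. by move=> hi; rewrite /elim_index index_uniq ?(eo_uniq EO) // (eo_size EO). Qed.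

Lemma elim_index_inj : injective elim_index.
Proof. by move=> u v e; rewrite -[u]nth_elim_index e nth_elim_index. Qed.

Lemma elim_index_root : elim_index tree_root = n.-1.
Proof. by rewrite elim_index_nth // prednK ?n_pos. Qed.

Lemma elim_index_nonroot v : (v != tree_root) = (elim_index v < n.-1).
Proof.
rewrite -(inj_eq elim_index_inj) elim_index_root.
by have := elim_index_lt v; have := n_pos; lia.
Qed.

Definition is_child (c v : 'I_n) : bool := (c != tree_root) && (par c == v).

Lemma child_elim_index c v : is_child c v -> elim_index c < elim_index v.
Proof. by case/andP=> cr /eqP<-; apply: eo_lt. Qed.

Lemma mem_nbT v u : (u \in nb G setT v) =
  ((v != tree_root) && (u == par v)) || is_child u v.
Proof.
rewrite !inE /=; apply/idP/orP; last first.
  case=> /andP[h /eqP]; first by move=> ->; apply: eo_adj.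
  by move=> <-; rewrite adj_sym; apply: eo_adj.
move=> a; have [lt|lt] : elim_index v < elim_index u \/ elim_index u < elim_index v.
  have : elim_index u != elim_index v.
    by rewrite (inj_eq elim_index_inj); apply: contraTneq a => ->; rewrite adj_irrefl.
  by case: ltngtP; auto.
- left; rewrite (eo_par EO a lt) eqxx andbT elim_index_nonroot.
  by have := elim_index_lt u; lia.
- right; rewrite /is_child (@eo_par EO u v) ?eqxx ?andbT // 1?adj_sym // elim_index_nonroot.
  by have := elim_index_lt v; lia.
Qed.

(** Stated over a commutative monoid so as to serve both for degrees and for sums of real
    weights. *)
Lemma big_nb (R : Type) (idx : R) (op : Monoid.com_law idx) (f : 'I_n -> R) v :
  \big[op/idx]_(u in nb G setT v) f u =
  op (if v != tree_root then f (par v) else idx) (\big[op/idx]_(c | is_child c v) f c).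
Proof.
rewrite (eq_bigl _ _ (mem_nbT v)).
case: ifP => vr /=; last by rewrite Monoid.mul1m.
rewrite (bigD1 (par v)) /= ?eqxx //; congr (op _ _).
apply: eq_bigl => u; have [->|_] /= := eqVneq u (par v); last by rewrite andbT.
apply/esym/negP => /child_elim_index; have := eo_lt EO vr; lia.
Qed.

Definition nch v : nat := \sum_(c | is_child c v) 1.

Lemma deg_nch v : #|nb G setT v| = (v != tree_root) + nch v.
Proof. by rewrite -sum1_card big_nb; case: ifP. Qed.

Section Local.
Variables (base : 'I_n -> nat) (C : nat) (pk : 'I_n -> bool -> nat -> nat).

(* With weight bit [e] on its parent edge, [v] can have [j - 1] incident      *)
(* edges of bit 1, given the choices [pk] of its children.                    *)
Definition admissible (v : 'I_n) (e : bool) (j : nat) : bool :=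
  let sg := base v + j * C in
  [&& \sum_(c | is_child c v) ((pk c false sg == 0) && (pk c true sg == 0)) == 0,
      \sum_(c | is_child c v) (pk c false sg == 0) + e < j &
      j + \sum_(c | is_child c v) (pk c true sg == 0) < nch v + 2 + e].

(** Here [x v] is the bit of the edge from [v] to its parent, and the final 1 is the shift of all
    values [j]. *)
Definition bit_degree (x : 'I_n -> bool) (v : 'I_n) : nat :=
  ((v != tree_root) && x v) + \sum_(c | is_child c v) x c + 1.

Lemma bits_le x v : bit_degree x v <= #|nb G setT v|.+1.
Proof.
rewrite deg_nch /bit_degree addn1 ltnS; apply: leq_add; first by case: (_ != _); case: (x v).
by apply: leq_sum => c _; case: (x c).
Qed.

(** A proper assignment of bits passes every test of the dynamic programme. By induction along the
    order, each child [c] is not blocked for its actual bit [x c]; hence forced children do carry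
    the bit they are forced to, and the two counts bound the number of 1-bits. *)
Lemma admissible_bit_degree (F L : 'I_n -> bool -> nat) x : 0 < C ->
  (forall v e sg, pk v e sg = select (base v) C (F v e) (L v e) sg) ->
  (forall v e, first_last (admissible v e) #|nb G setT v|.+1 (F v e) (L v e)) ->
  (forall v, v != tree_root ->
     base v + bit_degree x v * C != base (par v) + bit_degree x (par v) * C) ->
  forall v, admissible v ((v != tree_root) && x v) (bit_degree x v).
Proof.
move=> C0 pkE FL prop v; have [k] := ubnP (elim_index v).
elim: k v => // k IH v; rewrite ltnS => lt_vk.
set sg := base v + bit_degree x v * C.
have ok c : is_child c v -> pk c (x c) sg != 0.
  move=> cv; have lt_cv := child_elim_index cv; case/andP: cv => cr /eqP pc.
  rewrite pkE; apply: (select_complete (j := bit_degree x c) C0 (FL c (x c))).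
  - by rewrite bits_le /bit_degree addn1.
  - by have := IH c (leq_trans lt_cv lt_vk); rewrite cr.
  - by rewrite /sg -pc; apply: prop.
have n0 : \sum_(c | is_child c v) (pk c false sg == 0) <= \sum_(c | is_child c v) x c.
  apply: leq_sum => c /ok; case: (x c) => [_|/negbTE->] //.
  by case: (_ == 0).
have n1 : \sum_(c | is_child c v) (pk c true sg == 0) + \sum_(c | is_child c v) x c
    <= nch v.
  rewrite -big_split; apply: leq_sum => c /ok /=; case: (x c) => [/negbTE->|_] //.
  by case: (_ == 0).
apply/and3P; split.
- rewrite sum_nat_eq0; apply/forall_inP => c /ok; rewrite -/sg.
  by case: (x c) => /negbTE->; rewrite ?andbF.
- by rewrite -/sg /bit_degree; lia.
- by rewrite -/sg {1}/bit_degree; lia.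
Qed.

End Local.
End Order.

(** * The algorithm *)

(* [aDEG], [aSN] and [aSE] hold the number of remaining neighbours of a       *)
(* vertex, the sum of their names and the sum of the positions of the edges   *)
(* to them: for a removed vertex, [aSN] and [aSE] are its parent and its      *)
(* parent edge.  [aC e] counts, per slot, the children that cannot have       *)
(* weight bit [e] on their parent edge, and [aCB] those with neither.         *)
(* [aREM] is the number of free children that must still take bit 1.          *)
Notation aIO := 0 (only parsing).
Notation aDEG := 1 (only parsing).
Notation aSN := 2 (only parsing).
Notation aSE := 3 (only parsing).
Notation aD0 := 4 (only parsing).
Notation aOFF := 5 (only parsing).
Notation aBASE := 6 (only parsing).
Notation aQ := 7 (only parsing).
Notation aJ := 8 (only parsing).
Notation aREM := 9 (only parsing).
Notation aF e := (if e then 11 else 10) (only parsing).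
Notation aL e := (if e then 13 else 12) (only parsing).
Notation aC e := (if e then 15 else 14) (only parsing).
Notation aCB := 16 (only parsing).

Notation rn := 1 (only parsing).
Notation rn1 := 2 (only parsing).
Notation rA := 3 (only parsing).
Notation ri := 4 (only parsing).
Notation rv := 5 (only parsing).
Notation rp := 6 (only parsing).
Notation rtail := 7 (only parsing).
Notation roff := 8 (only parsing).
Notation rd := 9 (only parsing).
Notation rk := 10 (only parsing).
Notation ro := 11 (only parsing).
Notation rj := 12 (only parsing).
Notation rj1 := 13 (only parsing).
Notation rc e := (if e then 15 else 14) (only parsing).
Notation rcb := 16 (only parsing).
Notation rx e := (if e then 18 else 17) (only parsing).
Notation rxb := 19 (only parsing).
Notation rg := 20 (only parsing).
Notation rbp := 21 (only parsing).
Notation rdp := 22 (only parsing).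
Notation rinc := 23 (only parsing).
Notation rq := 24 (only parsing).
Notation rt e := (if e then 26 else 25) (only parsing).
Notation rtb := 27 (only parsing).
Notation rX := 28 (only parsing).
Notation rlim := 29 (only parsing).
Notation re := 30 (only parsing).
Notation rd1 := 31 (only parsing).
Notation rop := 32 (only parsing).

Declare Scope expr_scope.
Delimit Scope expr_scope with E.
Bind Scope expr_scope with expr.
Infix "+" := (Bin BAdd) : expr_scope.
Infix "-" := (Bin BSub) : expr_scope.
Infix "*" := (Bin BMul) : expr_scope.
Infix "/" := (Bin BDiv) : expr_scope.
Infix "==" := (Bin BEq) : expr_scope.
Infix "<" := (Bin BLt) : expr_scope.
Coercion Cst : nat >-> expr.
Notation "'$' x" := (Var x) (at level 2, format "'$' x") : expr_scope.
Notation "k @[ e ]" := (Ld k e%E) (at level 2, no associativity, format "k @[ e ]") : expr_scope.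

Section Program.
Variables (al be B C : nat).
Local Open Scope expr_scope.

(* The multiplier of the degree in codes is the register [rA], of value       *)
(* [al * n + be]: it is [n] for incommensurable weights, where codes encode   *)
(* pairs, and a constant otherwise.                                           *)
Definition phase0 := Blk [::
  Asg rn (aIO@[0]); Asg rn1 ($rn - 1); Asg rA (al * $rn + be)].

Definition half_edge (x y : nat) : seq stmt := [::
  St aDEG ($x) (aDEG@[$x] + 1);
  St aSN ($x) (aSN@[$x] + $y);
  St aSE ($x) (aSE@[$x] + $ri)].

Definition phase1 := For ri ($rn1) (Blk (
  [:: Asg rv (aIO@[$ri + $ri + 1]); Asg rp (aIO@[$ri + $ri + 2])] ++
  half_edge rv rp ++ half_edge rp rv)).

(** Every vertex is written at the tail of the queue, and only the advance of the tail is
    conditional. The test [$rd < 2] also admits degree 0, so that the one-vertex tree gets its root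
    queued. *)
Definition phase2 := Seq (Blk [:: Asg roff 0; Asg rtail 0])
  (For rv ($rn) (Blk [::
    Asg rd (aDEG@[$rv]);
    St aD0 ($rv) ($rd);
    St aOFF ($rv) ($roff);
    Asg roff ($roff + $rd + 3);
    St aBASE ($rv) ($rd * $rA + ($rn - $rd) * B);
    St aQ ($rtail) ($rv);
    Asg rtail ($rtail + ($rd < 2))])).

(** The neighbour is queued when its degree drops to exactly 1. If it drops to 0, the neighbour is
    the last vertex left and is already in the queue. *)
Definition phase3_body : seq stmt := [::
  Asg rv (aQ@[$ri]);
  Asg rp (aSN@[$rv]);
  St aDEG ($rp) (aDEG@[$rp] - 1);
  St aSN ($rp) (aSN@[$rp] - $rv);
  St aSE ($rp) (aSE@[$rp] - aSE@[$rv]);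
  St aQ ($rtail) ($rp);
  Asg rtail ($rtail + (aDEG@[$rp] == 1))].

Definition phase3 := For ri ($rn1) (Blk phase3_body).

Definition scan_update (e : bool) : seq stmt := [::
  Asg rg (Cond ($rxb) 0 (Cond ($(rx false) + e < $rj1)
                              ($rj1 + $(rx true) < $rk + (2 + e)%N) 0));
  St (aL e) ($rv) (Cond ($rg) ($rj1) ((aL e)@[$rv]));
  St (aF e) ($rv) (Cond ($rg) (Cond ((aF e)@[$rv]) ((aF e)@[$rv]) ($rj1))
                              ((aF e)@[$rv]))].

Definition scan_body : seq stmt :=
  [:: Asg rj1 ($rj + 1);
      Asg (rx false) ($(rc false) + (aC false)@[$ro + $rj1]);
      Asg (rx true) ($(rc true) + (aC true)@[$ro + $rj1]);
      Asg rxb ($rcb + aCB@[$ro + $rj1])] ++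
  scan_update false ++ scan_update true.

Definition scan := For rj ($rd1) (Blk scan_body).

Definition target (e : bool) : seq stmt := [::
  Asg rX (aBASE@[$rv] + (aF e)@[$rv] * C);
  Asg rq (Cond ($rbp < $rX) (($rX - $rbp) / C) 0);
  Asg (rt e) (Cond ((aF e)@[$rv])
    (Cond ((aF e)@[$rv] == (aL e)@[$rv])
      (Cond ($rbp + $rq * C == $rX)
        (Cond ($rq < $rdp) (Cond ($rq) ($rq) ($rdp)) ($rdp)) ($rdp)) ($rdp)) 0)].

Definition visit : seq stmt :=
  [:: Asg rv (aQ@[$ri]); Asg rd (aD0@[$rv]); Asg rd1 ($rd + 1);
      Asg ro (aOFF@[$rv]); Asg rinc ($ri < $rn1); Asg rk ($rd - $rinc);
      Asg (rc false) ((aC false)@[$ro]); Asg (rc true) ((aC true)@[$ro]);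
      Asg rcb (aCB@[$ro])].

(** At the root [rinc] is 0, so the counters of its dummy parent are left unchanged. *)
Definition push : seq stmt :=
  [:: Asg rp (aSN@[$rv]); Asg rbp (aBASE@[$rp]); Asg rdp (aD0@[$rp] + 2);
      Asg rop (aOFF@[$rp])] ++
  target false ++ target true ++
  [:: Asg rtb (Cond ($(rt false))
        (Cond ($(rt true))
          (Cond ($(rt false) == $(rt true)) ($(rt false)) ($rdp))
          ($(rt false)))
        ($(rt true)));
      St (aC false) ($rop + $(rt false)) ((aC false)@[$rop + $(rt false)] + $rinc);
      St (aC true) ($rop + $(rt true)) ((aC true)@[$rop + $(rt true)] + $rinc);
      St aCB ($rop + $rtb) (aCB@[$rop + $rtb] + $rinc)].

Definition phase4 := For ri ($rn) (Seq (Blk visit) (Seq scan (Blk push))).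

Definition pick_expr (e : bool) : expr :=
  Cond ((aF e)@[$rv])
    (Cond (aBASE@[$rv] + (aF e)@[$rv] * C == $rX)
      (Cond (aBASE@[$rv] + (aL e)@[$rv] * C == $rX) 0 ((aL e)@[$rv]))
      ((aF e)@[$rv])) 0.

(** At the root ([ri = 0]) the parent code is set to 0, which differs from every [base + j * C] with
    [j] and [C] positive. The root writes a dummy bit in output cell 1; being first, it is
    overwritten by the edge at position 0. *)
Definition phase5_body : seq stmt := [::
  Asg rv (aQ@[$rn1 - $ri]); Asg rp (aSN@[$rv]); Asg ro (aOFF@[$rv]);
  Asg rX (Cond ($ri) (aBASE@[$rp] + aJ@[$rp] * C) 0);
  Asg (rx false) (pick_expr false);
  Asg (rx true) (pick_expr true);
  Asg rg (0 < aREM@[$rp]);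
  Asg re (Cond ($ri) (Cond ($(rx false)) (Cond ($(rx true)) ($rg) 0) 1) 0);
  Asg rinc (Cond ($ri) (Cond ($(rx false)) (Cond ($(rx true)) ($rg) 0) 0) 0);
  St aREM ($rp) (aREM@[$rp] - $rinc);
  Asg rj1 (Cond ($re) ($(rx true)) ($(rx false)));
  St aJ ($rv) ($rj1);
  St aREM ($rv) ($rj1 - (1 + $re + (aC false)@[$ro + $rj1] + (aC false)@[$ro]));
  St aIO (aSE@[$rv] + 1) ($re)].

Definition phase5 := Seq
  (Blk [:: Asg rv (aQ@[$rn1]);
           St aIO 0 (Cond ((aF false)@[$rv]) 1 0);
           Asg rlim (Cond ((aF false)@[$rv]) ($rn) 0)])
  (For ri ($rlim) (Blk phase5_body)).
Definition algorithm : cmd :=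
  Seq phase0 (Seq phase1 (Seq phase2 (Seq phase3 (Seq phase4 phase5)))).

End Program.

(** * Correctness of the algorithm *)

Section Encode.
Variables (n : nat) (es : seq ('I_n * 'I_n)).

Lemma nth_encode x0 i : i < size es ->
  nth 0 (encode es) (i + i + 1) = (nth x0 es i).1 /\
  nth 0 (encode es) (i + i + 2) = (nth x0 es i).2.
Proof.
rewrite !addnS !addn0 /encode /=.
elim: es i => [|p l IH] [|i] //= lt_i.
by rewrite !addnS /=; apply: IH.
Qed.

Lemma size_encode : size (encode es) = (2 * size es).+1.
Proof. by rewrite /=; elim: es => //= p l [->]; rewrite mulnS. Qed.

Lemma nth_encode_le x : nth 0 (encode es) x <= n.
Proof.
case: x => [|x] //=.
elim: es x => [|p l IH] [|[|x]] //=; by rewrite ltnW.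
Qed.

End Encode.

(** * Reading the tree and removing leaves *)

Section Phases.
Variables (n : nat) (G : sgraph 'I_n) (es : seq ('I_n * 'I_n)) (w : nat).
Variables (al be B C : nat).
Hypothesis n_gt0 : 0 < n.
(** Codes, sums of neighbour names and sums of edge positions are all at most quadratic in [n]. *)
Hypothesis HW : (200 + al + be + B + C) * (n.+1 * n.+1) <= 2 ^ w.

Local Notation N := (6 * n).
Local Notation A := (al * n + be).
Local Notation triple := (triple w N).
Let x0 : 'I_n := Ordinal n_gt0.
Let e0 := (x0, x0).

Lemma small_W a b c : a <= 200 + al + be + B + C -> b <= n.+1 -> c <= n.+1 ->
  a * (b * c) <= 2 ^ w.
Proof. by move=> ha hb hc; apply: leq_trans HW; apply: leq_mul => //; apply: leq_mul. Qed.

Lemma W_lin : 200 * n.+1 <= 2 ^ w.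
Proof. by have := @small_W 200 n.+1 1; rewrite muln1; apply => //; lia. Qed.

Lemma W_sq : 200 * (n.+1 * n.+1) <= 2 ^ w.
Proof. by apply: small_W => //; lia. Qed.

Lemma W_mem : narr * N <= 2 ^ w.
Proof. by have := W_lin; rewrite /narr; lia. Qed.
Lemma W_narr : narr < 2 ^ w.
Proof. by have := W_lin; rewrite /narr; lia. Qed.
Lemma W_gt1 : 1 < 2 ^ w.
Proof. by have := W_lin; lia. Qed.

Hypothesis treeG : is_tree G.
Hypothesis es_G : edge_list G es.

Let Tblk := triple_blk_le W_gt1 W_mem W_narr.

Let Tforc := triple_for_const W_gt1 W_mem W_narr.
Let Tseq := triple_seq W_gt1 W_mem W_narr.

Let size_es : size es = n.-1.
Proof. by have := size_edge_list es_G treeG; lia. Qed.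

Record consts (s : state) : Prop := Consts {
  c_n : vr s rn = n;
  c_n1 : vr s rn1 = n.-1;
  c_A : vr s rA = A }.

Definition zero_from (k0 : nat) (s : state) : Prop :=
  forall k x, k0 <= k < narr -> x < N -> ar s k x = 0.

Record inv1 (m : nat) (s : state) : Prop := Inv1 {
  i1_c : consts s;
  i1_io : forall x, x < N -> ar s aIO x = nth 0 (encode es) x;
  i1_deg : forall x, x < n -> ar s aDEG x = half_sum es (fun _ _ => 1) e0 m x;
  i1_sn : forall x, x < n -> ar s aSN x = half_sum es (fun _ u => u) e0 m x;
  i1_se : forall x, x < n -> ar s aSE x = half_sum es (fun i _ => i) e0 m x;
  i1_z : zero_from 4 s }.

Lemma triple_phase0 : triple (phase0 al be) (start n (encode es)) 100 (inv1 0).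
Proof.
have W1 := W_lin.
have W2 : (al + be) * (n.+1 * n.+1) <= 2 ^ w by apply: small_W => //; lia.
apply: Tblk => //.
apply: (ok_asg (a := n)) => /=; [by split; lia | by [] | ].
  apply: (ok_asg (a := n.-1)) => /=; [by split; lia | by rewrite subn1 | ].
  apply: (ok_asg (a := A)) => //=.
    by split; [split | |]; nia.
  apply: ok_nil.
  (* The input has [2n - 1] entries and so lies within array 0; every other array starts at zero. *)
  have nz k x : 0 < k -> nth 0 (encode es) (k * N + x) = 0.
    by move=> k0; apply: nth_default; rewrite size_encode size_es; nia.
  split=> //=; try by [move=> x _; rewrite nz // /half_sum big_ord0].
  by move=> k x /andP[k0 _] _ /=; rewrite nz //; lia.
Qed.

Lemma half_sum_le (g : nat -> nat -> nat) b m x :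
  (forall i (u : 'I_n), i < m -> g i u <= b) -> half_sum es g e0 m x <= m * (2 * b).
Proof.
move=> hg; have <- : \sum_(i < m) (2 * b) = m * (2 * b) by rewrite sum_nat_const card_ord.
apply: leq_sum => i _.
have h1 := hg i (nth e0 es i).1 (ltn_ord i).
have h2 := hg i (nth e0 es i).2 (ltn_ord i).
by rewrite mul2n -addnn leq_add //; case: eqP => _; rewrite ?mul1n ?mul0n.
Qed.

Lemma triple_phase1 s : inv1 0 s -> triple phase1 s (400 * n) (inv1 n.-1).
Proof.
move=> I0; have W1 := W_lin; have W2 := W_sq.
apply: (Tforc (M := n.-1) (b := 200)) => //; try lia.
- by rewrite /=; lia.
- by case: I0 => -[*]; do 2?split.
- by move=> i s' [[]].
move=> i s1 lt_i [[cn cn1 cA] io deg sn se z] vi.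
apply: Tblk => //.
have lt_ie : i < size es by rewrite size_es.
have [eu ev] := nth_encode e0 lt_ie.
have auv := es_adj es_G e0 lt_ie.
set p := nth e0 es i in eu ev auv.
have uv : (p.1 == p.2 :> nat) = false.
  by apply: contraTF auv => /eqP/val_inj->; rewrite adj_irrefl.
have vu : (p.2 == p.1 :> nat) = false by rewrite eq_sym.
have lu := ltn_ord p.1; have lv := ltn_ord p.2.
have d1 x : half_sum es (fun _ _ => 1) e0 i x <= 2 * n.
  apply: leq_trans (half_sum_le (b := 1) _ _) _ => //; nia.
have d2 x : half_sum es (fun _ u => u) e0 i x <= 2 * (n * n).
  by apply: leq_trans (half_sum_le (b := n) _ _) _; [move=> k u _; apply: ltnW | nia].
have d3 x : half_sum es (fun i _ => i) e0 i x <= 2 * (n * n).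
  by apply: leq_trans (half_sum_le (b := n) _ _) _; [move=> k u ?; lia | nia].
apply: (ok_asg (a := p.1)) => /=.
- by rewrite vi; repeat split; nia.
- by rewrite vi io ?eu //; lia.
apply: (ok_asg (a := p.2)) => /=.
- by rewrite vi; repeat split; nia.
- by rewrite vi io ?ev //; lia.
have e1 := deg _ lu; have e2 := deg _ lv.
have e3 := sn _ lu; have e4 := sn _ lv.
have e5 := se _ lu; have e6 := se _ lv.
have := (d1 p.1, d1 p.2, d2 p.1, d2 p.2, d3 p.1, d3 p.2).
rewrite -e1 -e2 -e3 -e4 -e5 -e6 => -[[[[[f1 f2] f3] f4] f5] f6].
apply: (ok_st (x := p.1) (a := ar s1 aDEG p.1 + 1)) => //=; try lia.
  by repeat split; nia.
apply: (ok_st (x := p.1) (a := ar s1 aSN p.1 + p.2)) => //=; try lia.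
  by repeat split; nia.
apply: (ok_st (x := p.1) (a := ar s1 aSE p.1 + i)) => //=; rewrite ?vi //; try lia.
  by repeat split; nia.
apply: (ok_st (x := p.2) (a := ar s1 aDEG p.2 + 1)) => //=; rewrite ?vu //; try lia.
  by repeat split; nia.
apply: (ok_st (x := p.2) (a := ar s1 aSN p.2 + p.1)) => //=; rewrite ?vu //; try lia.
  by repeat split; nia.
apply: (ok_st (x := p.2) (a := ar s1 aSE p.2 + i)) => //=; rewrite ?vu ?vi //; try lia.
  by repeat split; nia.
apply: ok_nil; split=> //=; split=> //=.
- move=> x hx; rewrite /half_sum big_ord_recr /= -/p ![_ == x :> nat]eq_sym.
  rewrite -/(half_sum es (fun _ _ => 1) e0 i x) -deg //.
  case: (eqVneq x p.2) => [->|_]; first by rewrite vu.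
  by case: (eqVneq x p.1) => [->|_] /=; lia.
- move=> x hx; rewrite /half_sum big_ord_recr /= -/p ![_ == x :> nat]eq_sym.
  rewrite -/(half_sum es (fun _ u => u) e0 i x) -sn //.
  case: (eqVneq x p.2) => [->|_]; first by rewrite vu; lia.
  by case: (eqVneq x p.1) => [->|_] /=; lia.
- move=> x hx; rewrite /half_sum big_ord_recr /= -/p ![_ == x :> nat]eq_sym.
  rewrite -/(half_sum es (fun i _ => i) e0 i x) -se //.
  case: (eqVneq x p.2) => [->|_]; first by rewrite vu; lia.
  by case: (eqVneq x p.1) => [->|_] /=; lia.
- move=> k x hk hx /=; move: (z k x hk hx); case: hk.
  by do 4?[case: k => [//|k]].
Qed.

Definition deg (v : 'I_n) : nat := #|nb G setT v|.

Lemma deg_lt v : deg v < n.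
Proof.
rewrite -[X in _ < X]card_ord -cardsT; apply: proper_card.
by apply/properP; split; [apply: subsetT | exists v; rewrite ?inE ?adj_irrefl].
Qed.

Lemma conn_setT : conn G setT.
Proof.
move=> x y _ _; case: treeG => -[_ cG] _.
by rewrite (eq_connect (e' := adj G)) // => u v; rewrite /adj_in /= !inE.
Qed.

Lemma sum_deg : \sum_v deg v + 2 = 2 * n.
Proof.
case: treeG => _ acG; have := sum_card_nb acG conn_setT.
rewrite cardsT card_ord => /(_ n_gt0) <-; congr (_ + 2).
by apply: eq_bigl => v; rewrite inE.
Qed.

Definition offs (m : nat) : nat := \sum_(u < n | u < m) (deg u + 3).

Lemma offs0 : offs 0 = 0.
Proof. by apply: big_pred0. Qed.

Lemma offsS (v : 'I_n) : offs v.+1 = offs v + (deg v + 3).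
Proof.
rewrite /offs (bigD1 v) //= addnC; congr (_ + _); apply: eq_bigl => u.
by rewrite ltnS ltn_neqAle andbC -val_eqE.
Qed.

(** The degrees add up to [2n - 2], and the three extra slots per vertex to [3n]. *)
Lemma offs_le m : offs m <= 5 * n.
Proof.
apply: (@leq_trans (\sum_(u < n) (deg u + 3))).
  by rewrite /offs [X in _ <= X](bigID (fun u : 'I_n => u < m)) leq_addr.
rewrite big_split /= sum_nat_const card_ord.
by have := sum_deg; set a := \sum_v _; lia.
Qed.

Lemma offs_mono m m' : m <= m' -> offs m <= offs m'.
Proof.
move=> h; rewrite /offs [X in _ <= X](bigID (fun u : 'I_n => u < m)) /=.
apply: leq_trans (leq_addr _ _); apply: eq_leq; apply: eq_bigl => u.
by case: (ltnP u m); rewrite ?andbF // => h2; rewrite (leq_trans h2 h).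
Qed.

Lemma offs_lt (v : 'I_n) t : t < deg v + 3 -> offs v + t < 5 * n.
Proof. by move=> h; have := offs_le v.+1; rewrite offsS; lia. Qed.

Lemma offs_inj (u v : 'I_n) t t' : t < deg u + 3 -> t' < deg v + 3 ->
  (offs u + t == offs v + t') = (u == v) && (t == t').
Proof.
move=> ht ht'; have [->|uv] /= := eqVneq u v; first by rewrite eqn_add2l.
apply/negbTE; have [lt_uv|lt_vu] : (u < v) \/ (v < u).
  by move: uv; rewrite -val_eqE; case: ltngtP; auto.
- by have := offs_mono lt_uv; rewrite offsS; lia.
- by have := offs_mono lt_vu; rewrite offsS; lia.
Qed.

Definition base (v : 'I_n) : nat := deg v * A + (n - deg v) * B.

Lemma code_le v x : x <= n.+1 -> base v + x * C <= (al + be + B + C) * (n.+1 * n.+1).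
Proof. by move=> hx; have := deg_lt v; rewrite /base; nia. Qed.

Lemma code_ltW v x : x <= n.+1 -> base v + x * C < 2 ^ w.
Proof.
move=> hx; apply: leq_ltn_trans (code_le v hx) _; apply: leq_trans HW.
by rewrite ltn_mul2r muln_gt0 /=; lia.
Qed.

Definition queued (qs : seq 'I_n) (s : state) : Prop :=
  [/\ uniq qs, vr s rtail = size qs &
      forall j, j < size qs -> ar s aQ j = nth x0 qs j].

Definition nbsums (U : {set 'I_n}) (s : state) : Prop :=
  forall v, v \in U ->
  [/\ ar s aDEG v = #|nb G U v|, ar s aSN v = \sum_(u in nb G U v) u &
      ar s aSE v = \sum_(u in nb G U v) eidx es v u].

Record inv2 (m : nat) (s : state) : Prop := Inv2 {
  i2_c : consts s;
  i2_nb : nbsums setT s;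
  i2_d : forall v : 'I_n, v < m ->
    [/\ ar s aD0 v = deg v, ar s aOFF v = offs v & ar s aBASE v = base v];
  i2_off : vr s roff = offs m;
  i2_q : exists2 qs, queued qs s &
    forall v : 'I_n, (v \in qs) = (v < m) && (deg v <= 1);
  i2_z : zero_from 8 s }.

Lemma uniq_size_le (qs : seq 'I_n) : uniq qs -> size qs <= n.
Proof.
by move=> u; have := max_card (mem qs); rewrite (card_uniqP u) card_ord.
Qed.

Lemma triple_phase2 s : inv1 n.-1 s -> triple (phase2 B) s (400 * n) (inv2 n).
Proof.
move=> I1; have W1 := W_lin; have W2 := W_sq.
pose J s := [/\ consts s, nbsums setT s, vr s roff = 0, vr s rtail = 0 & zero_from 4 s].
apply: (triple_weaken (B := 20 + 380 * n) (Q := inv2 n)) => //; last by lia.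
apply: (Tseq (Q1 := J)).
  apply: Tblk => //.
  apply: (ok_asg (a := 0)) => //=; first by lia.
  apply: (ok_asg (a := 0)) => //=; first by lia.
  apply: ok_nil; case: I1 => -[cn cn1 cA] _ d1 d2 d3 z; split=> //= v _.
  rewrite /= d1 // d2 // d3 // -size_es.
  rewrite (half_sumE es_G (fun _ _ => 1)) (half_sumE es_G (fun _ u => u)).
  by rewrite (half_sumE es_G (fun i _ => i)) sum1_card.
move=> {I1}s [[cn cn1 cA] hnb off0 tail0 z].
apply: (Tforc (M := n) (b := 200)) => //; try lia.
- by rewrite /=; lia.
- split=> //=; first by rewrite off0 offs0.
    exists [::]; first by split.
    by move=> v.
  by move=> k x /andP[k8 kn] hx; rewrite z ?kn //; lia.
- by move=> i s' [[]].
move=> i s1 lt_i [[{}cn {}cn1 {}cA] {}hnb dd off [qs [uq tl qE] qsE] {}z] vi.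
apply: Tblk => //.
have [v vE] : exists v : 'I_n, nat_of_ord v = i by exists (Ordinal lt_i).
rewrite -{i}vE in lt_i vi dd off qsE *.
have [d1 _ _] := hnb v (in_setT v); rewrite -/(deg v) in d1.
have lv := ltn_ord v; have dn := deg_lt v; have szq : size qs < n.
  have : size (v :: qs) <= n by apply: uniq_size_le; rewrite /= uq qsE ltnn.
  by [].
have o1 := offs_lt (v := v) (t := 0) ltac:(lia).
have cW := code_ltW v (x := 0) ltac:(lia); rewrite mul0n addn0 /base in cW.
apply: (ok_asg (a := deg v)) => /=; [by rewrite vi; split=> //; lia | by rewrite vi d1 | ].
apply: (ok_st (x := v) (a := deg v)) => //=; first by lia.
apply: (ok_st (x := v) (a := offs v)) => //=; first by lia.
apply: (ok_asg (a := offs v.+1)) => /=.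
  by rewrite off; repeat split; lia.
  by rewrite off offsS addnA.
apply: (ok_st (x := v) (a := base v)) => //=.
- rewrite cA cn; repeat split; try nia.
- by rewrite cA cn.
- by lia.
apply: (ok_st (x := size qs) (a := v)) => //=; first by lia.
apply: (ok_asg (a := size qs + (deg v < 2))) => /=.
- by rewrite tl; repeat split; try lia; case: (_ < _); lia.
- by rewrite tl.
apply: ok_nil; split=> //=; split=> //=.
- move=> u; rewrite ltnS leq_eqVlt => /orP[/eqP/val_inj->|lt_u].
    by rewrite /= eqxx.
  have [h1 h2 h3] := dd u lt_u.
  by rewrite /= (ltn_eqF lt_u).
- exists (if deg v < 2 then rcons qs v else qs); last first.
    move=> u; rewrite [u < _]ltnS [u <= _]leq_eqVlt andb_orl -qsE val_eqE.
    case: ifP => d2; rewrite ?mem_rcons ?inE; case: eqVneq => [->|] //=.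
    by rewrite -ltnS d2.
    by rewrite -ltnS d2 /= qsE ltnn.
  case: ifP => d2; split=> //=; rewrite ?rcons_uniq ?uq ?size_rcons ?qsE ?ltnn //.
  - by rewrite addn1.
  - move=> j; rewrite ltnS leq_eqVlt nth_rcons => /orP[/eqP->|lt_j].
      by rewrite eqxx ltnn.
    by rewrite (ltn_eqF lt_j) lt_j qE.
  - by rewrite addn0.
  - by move=> j lt_j; rewrite (ltn_eqF lt_j) qE.
- move=> k x hk hx /=; move: (z k x hk hx); case/andP: hk.
  by do 8?[case: k => [//|k]].
Qed.

Definition rest (qs : seq 'I_n) (i : nat) : {set 'I_n} := ~: [set v in take i qs].

(** At its removal a vertex has a single remaining neighbour, so its two sums are that neighbour and
    the position of the edge to it. They stay so, since later removals only update vertices that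
    still remain. *)
Definition elim (s : state) (qs : seq 'I_n) (j : nat) : Prop :=
  let v := nth x0 qs j in
  exists p : 'I_n, [/\ p \in rest qs j.+1, ar s aSN v = p, ar s aSE v = eidx es v p,
    adj G v p & forall u, u \in rest qs j -> adj G v u -> u = p].

(** The clause on membership in [qs] says that the queue holds exactly the current leaves among the
    remaining vertices; it makes the next queued vertex removable. *)
Record inv3 (i : nat) (s : state) : Prop := Inv3 {
  i3_c : consts s;
  i3_d : forall v : 'I_n,
    [/\ ar s aD0 v = deg v, ar s aOFF v = offs v & ar s aBASE v = base v];
  i3_q : exists qs, [/\ queued qs s /\ i <= size qs, conn G (rest qs i),
    nbsums (rest qs i) s,
    {in rest qs i, forall v, (v \in qs) = (#|nb G (rest qs i) v| <= 1)} &
    forall j, j < i -> elim s qs j];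
  i3_z : zero_from 8 s }.

Lemma nth_rest qs i j : uniq qs -> i <= j < size qs -> nth x0 qs j \in rest qs i.
Proof.
move=> uq /andP[ij js]; rewrite !inE in_take ?mem_nth // index_uniq //.
by rewrite -leqNgt.
Qed.

Lemma restS qs i : i < size qs -> rest qs i.+1 = rest qs i :\ nth x0 qs i.
Proof.
by move=> h; apply/setP => u; rewrite !inE (take_nth x0 h) mem_rcons inE negb_or.
Qed.

Lemma card_rest qs i : uniq qs -> i <= size qs -> #|rest qs i| = n - i.
Proof.
move=> uq h; have := cardsC [set v in take i qs].
rewrite cardsE (card_uniqP (take_uniq i uq)) card_ord size_takel //.
by rewrite /rest => h1; rewrite -[X in X - _]h1 addKn.
Qed.

Lemma rest_rcons qs i p : i <= size qs -> rest (rcons qs p) i = rest qs i.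
Proof. by move=> h; rewrite /rest -cats1 takel_cat. Qed.

Lemma sum_ord_le (U : {set 'I_n}) (f : 'I_n -> nat) b : (forall u, f u <= b) ->
  \sum_(u in U) f u <= n * b.
Proof.
move=> hf; apply: (@leq_trans (\sum_(u in U) b)); first exact: leq_sum.
rewrite sum_nat_const leq_mul2r; apply/orP; right.
by have := max_card (mem U); rewrite card_ord.
Qed.

Lemma ok_phase3 s1 (i v p c a1 a2 a3 tl : nat) (Q : state -> Prop) :
  vr s1 ri = i -> i < n -> ar s1 aQ i = v -> v < n -> ar s1 aSN v = p -> p < n ->
  ar s1 aSE v = a3 -> a3 < n -> ar s1 aDEG p = c.+1 -> c <= n ->
  ar s1 aSN p = v + a1 -> a1 <= n * n -> ar s1 aSE p = a3 + a2 -> a2 <= n * n ->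
  vr s1 rtail = tl -> tl <= n ->
  Q (setv (seta (seta (seta (seta (setv (setv s1 rv v) rp p) aDEG p c) aSN p a1)
    aSE p a2) aQ tl p) rtail (tl + (c == 1))) ->
  ok w N phase3_body s1 Q.
Proof.
move=> vi lt_i qi lv sv lp ev b3 dp b4 sp b1 ep b2 tlE szq q.
have W1 := W_lin; have W2 := W_sq.
apply: (ok_asg (a := v)) => /=; [by rewrite vi; split=> //; lia | by rewrite vi | ].
apply: (ok_asg (a := p)) => /=; [by split=> //; lia | by [] | ].
apply: (ok_st (x := p) (a := c)) => //=.
- by rewrite dp; repeat split; lia.
- by rewrite dp; lia.
- by lia.
apply: (ok_st (x := p) (a := a1)) => //=.
- by rewrite sp; repeat split; lia.
- by rewrite sp; lia.
- by lia.
apply: (ok_st (x := p) (a := a2)) => //=.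
- by rewrite ep ev; repeat split; lia.
- by rewrite ep ev; lia.
- by lia.
apply: (ok_st (x := tl) (a := p)) => //=; first by lia.
apply: (ok_asg (a := tl + (c == 1))) => /=.
- by rewrite eqxx tlE; repeat split; try lia; case: (_ == 1); lia.
- by rewrite eqxx tlE.
exact: ok_nil.
Qed.

Lemma triple_phase3 s : inv2 n s -> triple phase3 s (400 * n) (inv3 n.-1).
Proof.
move=> I2; have W1 := W_lin; have W2 := W_sq.
apply: (Tforc (M := n.-1) (b := 200)) => //; try lia.
- by rewrite /=; lia.
- case: I2 => -[cn cn1 cA] hnb hd _ [qs [uq tl qE] qsE] z; split=> //=.
    by move=> v; apply: hd.
  have rest0 : rest qs 0 = setT by apply/setP => v; rewrite !inE take0.
  exists qs; split=> //=; rewrite ?rest0 //; first exact: conn_setT.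
  by move=> v _; rewrite qsE ltn_ord.
- by move=> i s' [[]].
move=> i s1 lt_i [[cn cn1 cA] hd [qs [[[uq tl qE] leq_i] cU nbU qsU el]] z] vi.
set U := rest qs i in cU nbU qsU.
have lt_in : i < n := leq_trans lt_i (leq_pred n).
have cardU : #|U| = n - i by apply: card_rest.
case: treeG => _ acG.
have U1 : 1 < #|U| by lia.
(* The queue cannot run dry: the remaining tree has a leaf, which is queued but not among the first
   [i] entries. *)
have lt_iq : i < size qs.
  have [v vU dv] := exists_leaf acG cU U1.
  have vq : v \in qs by rewrite qsU // dv.
  move: vU; rewrite !inE in_take // -leqNgt => h; apply: leq_ltn_trans h _.
  by rewrite index_mem.
have [v vdef] : exists v, nth x0 qs i = v by exists (nth x0 qs i).
have vU : v \in U by rewrite -vdef; apply: nth_rest => //; rewrite leqnn.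
have dv : #|nb G U v| = 1.
  apply/eqP; rewrite eqn_leq (nb_gt0 cU U1 vU) andbT -qsU // -vdef; exact: mem_nth.
have [p pE] : exists p, nb G U v = [set p] by apply/cards1P; rewrite dv.
have : p \in nb G U v by rewrite pE set11.
rewrite inE => /andP[pU avp].
have pv : p != v by apply: contraTneq avp => ->; rewrite adj_irrefl.
have vp : v != p by rewrite eq_sym.
have eU' : rest qs i.+1 = U :\ v by rewrite -vdef; apply: restS.
have pU' : p \in U :\ v by rewrite in_setD1 pv pU.
have [_ sv ev] := nbU v vU; rewrite pE !big_set1 in sv ev.
have [dp sp ep] := nbU p pU.
have vnb : v \in nb G U p by rewrite inE vU adj_sym.
rewrite (big_setD1 v vnb) /= in sp; rewrite (big_setD1 v vnb) /= in ep.
rewrite (cardsD1 v) vnb add1n in dp.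
have szq := uniq_size_le uq.
have lv := ltn_ord v; have lp := ltn_ord p.
have b1 := sum_ord_le (nb G U p :\ v) (f := @nat_of_ord n) (b := n) (fun u => ltnW (ltn_ord u)).
have b2 : \sum_(u in nb G U p :\ v) eidx es p u <= n * n.
  apply: sum_ord_le => u; rewrite /eidx; apply: leq_trans (index_size _ _) _.
  by rewrite size_map size_es leq_pred.
have b3 : eidx es p v < n.
  by have := eidx_lt es_G avp; rewrite eidxC size_es => /leq_trans; apply; apply: leq_pred.
have b4 : #|nb G U p :\ v| <= n by have := max_card (mem (nb G U p :\ v)); rewrite card_ord.
rewrite -nb_del in dp sp ep b1 b2 b4.
have [c cE] : exists c, #|nb G (U :\ v) p| = c by eexists.
have [a1 a1E] : exists a, \sum_(u in nb G (U :\ v) p) u = a by eexists.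
have [a2 a2E] : exists a, \sum_(u in nb G (U :\ v) p) eidx es p u = a by eexists.
have [a3 a3E] : exists a, eidx es p v = a by eexists.
have cp : #|nb G U p| = c.+1 by rewrite (cardsD1 v) vnb -nb_del cE.
rewrite eidxC a3E in ev; rewrite cE in dp b4; rewrite a1E in sp b1; rewrite a2E a3E in ep b2.
rewrite a3E in b3.
have vi' : ar s1 aQ i = v by rewrite qE // vdef.
apply: Tblk => //.
apply: (@ok_phase3 _ i v p c a1 a2 a3 (size qs)) => //.
split=> //=; split=> //=; last first.
- move=> k x hk hx /=; move: (z k x hk hx); case/andP: hk.
  by do 8?[case: k => [//|k]].
(* [p] becomes a leaf at this moment iff its new degree is 1; with new degree 0 it was a leaf before
   and is already in [qs]. *)
pose qs' := if c == 1 then rcons qs p else qs.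
have restE j : j <= size qs -> rest qs' j = rest qs j.
  by rewrite /qs'; case: ifP => // _ h; rewrite rest_rcons.
have nthE j : j < size qs -> nth x0 qs' j = nth x0 qs j.
  by rewrite /qs'; case: ifP => // _ h; rewrite nth_rcons h.
have other u : u \in U -> u != p -> (v \in nb G U u) = false.
  move=> uU up; rewrite inE vU adj_sym /=.
  have : (u \in nb G U v) = false by rewrite pE inE (negbTE up).
  by rewrite inE uU.
have nbE u : u \in U -> u != p -> nb G (U :\ v) u = nb G U u.
  move=> uU up; rewrite nb_del; apply/setDidPl; rewrite disjoint_sym disjoints1.
  by rewrite other.
exists qs'; rewrite restE // eU'.
split.
- split; last by rewrite /qs'; case: ifP; rewrite ?size_rcons //; move=> _; apply: ltnW.
  rewrite /qs'; case: ifP => d1; split=> //=.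
  + by rewrite rcons_uniq uq andbT qsU // cp (eqP d1) ltnn.
  + by rewrite size_rcons addn1.
  + move=> j; rewrite size_rcons ltnS leq_eqVlt nth_rcons => /orP[/eqP->|lt_j].
      by rewrite eqxx ltnn.
    by rewrite (ltn_eqF lt_j) lt_j qE.
  + by rewrite ?d1 addn0.
  + by move=> j lt_j; rewrite (ltn_eqF lt_j) qE.
- by apply: conn_del => //; rewrite dv.
- move=> u uU'; have [/= up|up] := eqVneq u p; first by rewrite up /= !eqxx.
  have uU : u \in U by move: uU'; rewrite inE => /andP[].
  have upn : (u == p :> nat) = false by apply: negbTE.
  by rewrite /= upn nbE //; apply: nbU.
- move=> u uU'.
  have uU : u \in U by move: uU'; rewrite inE => /andP[].
  have [up|up] := eqVneq u p; last first.
    rewrite nbE // -qsU // /qs'; case: ifP => // _.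
    by rewrite mem_rcons inE (negbTE up).
  rewrite up /qs'; case: ifP => d1; first by rewrite cE mem_rcons inE eqxx (eqP d1).
  by rewrite qsU // cp cE; case: (c) d1 => [|[|]].
- move=> j; rewrite ltnS leq_eqVlt => /orP[/eqP->|lt_j].
    exists p; rewrite nthE // vdef restE // eU' restE //.
    have pvn : (v == p :> nat) = false by apply: negbTE.
    rewrite /= pvn sv ev -a3E eidxC; split=> // u uU av.
    by apply/set1P; rewrite -pE inE uU.
  have lt_jq : j < size qs := ltn_trans lt_j lt_iq.
  have [p' [h1 h2 h3 h4 h5]] := el j lt_j.
  exists p'; rewrite nthE // !restE //; last exact: ltnW.
  have np : nth x0 qs j != p.
    apply: contraTneq pU => <-; rewrite !inE negbK in_take ?mem_nth //.
    by rewrite index_uniq.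
  have npn : (nth x0 qs j == p :> nat) = false by apply: negbTE.
  by rewrite /= npn; split.
Qed.

(** * The rooted tree and its slot counters *)

Section Static.
Variables (qs : seq 'I_n) (par : 'I_n -> 'I_n).
Local Notation tree_root := (tree_root x0 qs).
Local Notation child := (is_child x0 qs par).
Local Notation elim_index := (elim_index qs).

Record static (s : state) : Prop := Static {
  st_c : consts s;
  st_d : forall v : 'I_n,
    [/\ ar s aD0 v = deg v, ar s aOFF v = offs v & ar s aBASE v = base v];
  st_q : forall j, j < n -> ar s aQ j = nth x0 qs j;
  st_sn : forall v : 'I_n, ar s aSN v = par v;
  st_se : forall v : 'I_n, v != tree_root -> ar s aSE v = eidx es v (par v);
  st_se_root : ar s aSE tree_root = 0 }.

Definition slt (s : state) (e : bool) (c v : 'I_n) : nat :=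
  slot (base c) C (ar s (aF e) c) (ar s (aL e) c) (base v) (deg v + 2).

Definition cnt (s : state) (e : bool) (i : nat) (v : 'I_n) (t : nat) : nat :=
  \sum_(c | (elim_index c < i) && child c v) (slt s e c v == t).

Definition cntb (s : state) (i : nat) (v : 'I_n) (t : nat) : nat :=
  \sum_(c | (elim_index c < i) && child c v)
    (both_slot (slt s false c v) (slt s true c v) (deg v + 2) == t).

Definition pk (s : state) (c : 'I_n) (e : bool) (sg : nat) : nat :=
  select (base c) C (ar s (aF e) c) (ar s (aL e) c) sg.

Local Notation loc s := (admissible x0 qs par base C (pk s)).

Record inv4 (i : nat) (s : state) : Prop := Inv4 {
  i4_st : static s;
  i4_cnt : forall e (v : 'I_n) t, t < deg v + 3 ->
    ar s (aC e) (offs v + t) = cnt s e i v t;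
  i4_cntb : forall (v : 'I_n) t, t < deg v + 3 ->
    ar s aCB (offs v + t) = cntb s i v t;
  i4_fl : forall (v : 'I_n) e, elim_index v < i ->
    first_last (loc s v e) (deg v).+1 (ar s (aF e) v) (ar s (aL e) v);
  i4_z : forall (v : 'I_n) e, i <= elim_index v ->
    ar s (aF e) v = 0 /\ ar s (aL e) v = 0 }.

Lemma cnt_eq s s' e i v t :
  (forall c : 'I_n, elim_index c < i -> ar s' (aF e) c = ar s (aF e) c /\
     ar s' (aL e) c = ar s (aL e) c) ->
  cnt s' e i v t = cnt s e i v t.
Proof.
move=> h; apply: eq_bigr => c /andP[lt_c _].
by rewrite /slt; have [-> ->] := h c lt_c.
Qed.

Lemma cntb_eq s s' i v t :
  (forall (c : 'I_n) e, elim_index c < i -> ar s' (aF e) c = ar s (aF e) c /\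
     ar s' (aL e) c = ar s (aL e) c) ->
  cntb s' i v t = cntb s i v t.
Proof.
move=> h; apply: eq_bigr => c /andP[lt_c _].
have := h c false lt_c; have := h c true lt_c; rewrite /slt /=.
by move=> [-> ->] [-> ->].
Qed.

Hypothesis EO : elim_order G x0 qs par.

Lemma sum_elim_indexS (i : nat) (v u : 'I_n) (f : 'I_n -> nat) : elim_index u = i ->
  \sum_(c | (elim_index c < i.+1) && child c v) f c =
  \sum_(c | (elim_index c < i) && child c v) f c + child u v * f u.
Proof.
move=> ru; have rkE c : c != u -> (elim_index c < i.+1) = (elim_index c < i).
  by rewrite -(inj_eq (elim_index_inj EO)) ru; lia.
rewrite (bigID (pred1 u)) /= addnC; congr (_ + _).
  apply: eq_bigl => c; case: (eqVneq c u) => [->|cu]; first by rewrite ru ltnn andbF.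
  by rewrite rkE // andbT.
case cuv: (child u v); last first.
  rewrite mul0n big_pred0 // => c; case: (eqVneq c u) => [->|]; rewrite ?andbF //.
  by rewrite cuv andbF.
rewrite mul1n (big_pred1 u) // => c /=.
by case: (eqVneq c u) => [->|]; rewrite ?andbF // ru ltnSn cuv.
Qed.

Lemma sum_elim_index_all (i : nat) (v : 'I_n) (f : 'I_n -> nat) : elim_index v <= i ->
  \sum_(c | (elim_index c < i) && child c v) f c = \sum_(c | child c v) f c.
Proof.
move=> h; apply: eq_bigl => c; case cv: (child c v); rewrite ?andbF // andbT.
by have := child_elim_index EO cv; lia.
Qed.

(** The children blocked by the choice [j] are those counted in slot 0 or in slot [j], so two reads
    give the number of children that cannot take bit [e]. *)
Lemma cnt_select s e i (v : 'I_n) j : 0 < C -> elim_index v <= i -> 0 < j < deg v + 2 ->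
  (forall c : 'I_n, elim_index c < elim_index v -> exists loc,
     first_last loc (deg c).+1 (ar s (aF e) c) (ar s (aL e) c)) ->
  cnt s e i v j + cnt s e i v 0 =
  \sum_(c | child c v) (pk s c e (base v + j * C) == 0).
Proof.
move=> C0 hv hj hF; rewrite /cnt !sum_elim_index_all // -big_split; apply: eq_bigr => c cv /=.
have [lc hlc] := hF c (child_elim_index EO cv).
rewrite /pk -(slot_select _ _ C0 hlc hj) -/(slt s e c v).
by case: (eqVneq (slt s e c v) 0) => [->|_]; lia.
Qed.

Lemma cntb_select s i (v : 'I_n) j : 0 < C -> elim_index v <= i -> 0 < j < deg v + 2 ->
  (forall (c : 'I_n) e, elim_index c < elim_index v -> exists loc,
     first_last loc (deg c).+1 (ar s (aF e) c) (ar s (aL e) c)) ->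
  cntb s i v j + cntb s i v 0 =
  \sum_(c | child c v) ((pk s c false (base v + j * C) == 0) &&
                        (pk s c true (base v + j * C) == 0)).
Proof.
move=> C0 hv hj hF; rewrite /cntb !sum_elim_index_all // -big_split; apply: eq_bigr => c cv /=.
have [lc hlc] := hF c false (child_elim_index EO cv).
have [lc' hlc'] := hF c true (child_elim_index EO cv).
rewrite /pk -(slot_select _ _ C0 hlc hj) -(slot_select _ _ C0 hlc' hj).
rewrite -/(slt s false c v) -/(slt s true c v) -(both_slotE _ _ hj).
by case: (eqVneq (both_slot _ _ _) 0) => [->|_]; lia.
Qed.

End Static.

Lemma inv3_static s : inv3 n.-1 s ->
  exists qs par, [/\ elim_order G x0 qs par, static qs par s & zero_from 8 s].
Proof.
case=> cs hd [qs [[[uq tl qE] leq_n] cU nbU qsU el]] z.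
have n1 : n.-1 < n by lia.
have : #|rest qs n.-1| = 1 by rewrite card_rest //; lia.
move/eqP/cards1P => [r rE].
have nb0 : nb G (rest qs n.-1) r = set0.
  apply/setP => u; rewrite rE in_set0 in_set in_set1; case: eqP => // ->.
  by rewrite adj_irrefl.
have rU : r \in rest qs n.-1 by rewrite rE set11.
have rq : r \in qs by rewrite qsU // nb0 cards0.
have sz : size qs = n.
  apply/eqP; rewrite eqn_leq uniq_size_le //=.
  move: rU; rewrite !inE in_take // -leqNgt => h.
  by have := leq_ltn_trans h (etrans (index_mem _ _) rq); rewrite prednK.
have mem v : v \in qs := mem_full v uq sz.
have rootE : tree_root x0 qs = r.
  apply/set1P; rewrite -rE /tree_root; apply: nth_rest => //.
  by rewrite leqnn sz n1.
have [_ sr er] := nbU r rU; rewrite nb0 !big_set0 in sr er.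
pose par v := insubd x0 (ar s aSN v).
have elp v : v != tree_root x0 qs ->
  [/\ par v \in rest qs (elim_index qs v).+1, ar s aSN v = par v,
      ar s aSE v = eidx es v (par v), adj G v (par v) &
      forall u, u \in rest qs (elim_index qs v) -> adj G v u -> u = par v].
  move=> vr; have vn : nth x0 qs (elim_index qs v) = v by rewrite nth_index.
  have rv : elim_index qs v < n.-1.
    have lt_n : elim_index qs v < n by rewrite /elim_index -[X in _ < X]sz index_mem.
    rewrite ltn_neqAle -ltnS prednK // lt_n andbT.
    by apply: contra_neq vr => e; rewrite -vn e.
  have [p] := el _ rv; rewrite vn => -[h1 h2 h3 h4 h5].
  by have -> : par v = p by rewrite /par h2 valKd.
exists qs, par; split=> //; split=> //.
- by move=> v /elp[].
- move=> v /elp[+ _ _ _ _]; rewrite !inE in_take // -leqNgt.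
  by rewrite /elim_index.
- move=> u v a lt_uv.
  have ur : u != tree_root x0 qs.
    apply: contraTneq lt_uv => ->; rewrite -leqNgt /elim_index.
    have -> : index (tree_root x0 qs) qs = n.-1 by rewrite /tree_root index_uniq // sz.
    by rewrite -ltnS prednK // -[X in _ < X]sz index_mem.
  have [_ _ _ _ h] := elp u ur; apply/esym/h => //.
  by rewrite !inE in_take // -leqNgt ltnW.
- by move=> j hj; rewrite qE // sz.
(* The root has no remaining neighbour, so its neighbour sum is 0 and vertex 0 serves as its dummy
   parent. *)
- move=> v; have [->|/elp[_ -> //]] := eqVneq v (tree_root x0 qs).
  by rewrite rootE /par sr val_insubd n_gt0.
- by move=> v /elp[].
- by rewrite rootE.
Qed.
Local Notation ok := (ok w N).

Lemma scan_guard xb (b1 b2 : bool) :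
  (if xb != 0 then 0 else if (b1 : nat) != 0 then b2 : nat else 0) =
  [&& xb == 0, b1 & b2].
Proof. by case: eqP; case: b1. Qed.

Lemma ok_scan_update e l s1 v j1 xb X0 X1 k F L Q :
  vr s1 rxb = xb -> vr s1 (rx false) = X0 -> vr s1 (rx true) = X1 ->
  vr s1 rj1 = j1 -> vr s1 rk = k -> vr s1 rv = v -> v < n ->
  ar s1 (aF e) v = F -> ar s1 (aL e) v = L ->
  X0 <= n -> X1 <= n -> j1 <= n -> k <= n ->
  let g := [&& xb == 0, X0 + e < j1 & j1 + X1 < k + 2 + e] in
  ok l (seta (seta (setv s1 rg g) (aL e) v (if g then j1 else L)) (aF e) v
    (if g then (if F != 0 then F else j1) else F)) Q ->
  ok (scan_update e ++ l) s1 Q.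
Proof.
move=> rb r0 r1 rj rkE rvE lv eF eL b0 b1 bj bk g okl.
have W1 := W_lin.
apply: (ok_asg (a := g)).
- rewrite /= rb r0 r1 rj rkE.
  by case: (_ != 0); case: e {eF eL g okl} => /=; repeat split; lia || case: ifP => _; repeat split; lia.
- by rewrite /= rb r0 r1 rj rkE scan_guard /g addnA.
have vN : v < N by lia.
apply: (ok_st (x := v) (a := if g then j1 else L)) => //.
- by case: e {okl} @g eF eL => g eF eL /=; rewrite rvE; case: ifP => _; repeat split; lia.
- by case: e {okl} @g eF eL => g eF eL /=; rewrite ?rvE ?rj ?eL; case: (g).
apply: (ok_st (x := v) (a := if g then (if F != 0 then F else j1) else F)) => //.
- by case: e {okl} @g eF eL => g eF eL /=; rewrite rvE eF; case: ifP => _; repeat split; try lia; case: ifP => _; repeat split; lia.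
- by case: e {okl} @g eF eL => g eF eL /=; rewrite ?rvE ?rj ?eF; case: (g).
Qed.

Lemma ok_target e l s1 v b F L bp dp Q :
  vr s1 rv = v -> v < n -> ar s1 aBASE v = b -> ar s1 (aF e) v = F ->
  ar s1 (aL e) v = L -> vr s1 rbp = bp -> vr s1 rdp = dp ->
  b + F * C < 2 ^ w -> bp < 2 ^ w -> C < 2 ^ w ->
  (let X := b + F * C in
   ok l (setv (setv (setv s1 rX X) rq (if bp < X then (X - bp) %/ C else 0)) (rt e)
    (slot b C F L bp dp)) Q) ->
  ok (target C e ++ l) s1 Q.
Proof.
move=> rvE lv eb eF eL rb rd bX bb bC okl; have W1 := W_lin.
have vN : v < N by lia.
set X := b + F * C in bX okl.
have FX : F * C <= X by rewrite leq_addl.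
pose q := if bp < X then (X - bp) %/ C else 0.
have bq : bp + q * C < 2 ^ w.
  rewrite /q; case: ifP => [lt|_]; last by lia.
  by have := leq_trunc_div (X - bp) C; lia.
have q1 : q * C < 2 ^ w by apply: leq_ltn_trans bq; rewrite leq_addl.
apply: (ok_asg (a := X)).
- by case: e {okl} eF eL => eF eL /=; rewrite rvE eb eF; repeat split; lia.
- by case: e {okl} eF eL => eF eL /=; rewrite rvE eb eF.
apply: (ok_asg (a := q)).
- rewrite /= rb; split; first by split.
  by case: ltnP => /= h; repeat split; lia.
- by rewrite /= rb /q; case: ltnP.
apply: (ok_asg (a := slot b C F L bp dp)) => //.
- by case: e {okl} eF eL => eF eL /=; rewrite rvE eF eL rb rd;
    repeat first [ by [] | lia | split | case: ifP => _ ].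
- by case: e {okl} eF eL => eF eL /=; rewrite rvE eF eL rb rd /slot -/X -/q !eqb0 !negbK.
Qed.

Definition scan_regs := [:: rn; rn1; rA; ri; rv; rd1; ro; rinc; rk; 14; 15; rcb].
Definition keep (rs : seq nat) (s s' : state) : bool :=
  all (fun r => vr s' r == vr s r) rs.

(** Admissibility as read from the counters before the scan; the scan itself writes only the first
    and last values. *)
Definition scan_loc (s : state) (e : bool) (j : nat) : bool :=
  let o := vr s ro in
  [&& vr s rcb + ar s aCB (o + j) == 0,
      vr s (rc false) + ar s (aC false) (o + j) + e < j &
      j + (vr s (rc true) + ar s (aC true) (o + j)) < vr s rk + 2 + e].

Record scanned (s : state) (v m : nat) (s' : state) : Prop := Scanned {
  sc_regs : keep scan_regs s s';
  sc_ar : forall k x, k \notin [:: 10; 11; 12; 13] -> ar s' k x = ar s k x;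
  sc_other : forall (e : bool) x, x != v ->
    ar s' (aF e) x = ar s (aF e) x /\ ar s' (aL e) x = ar s (aL e) x;
  sc_fl : forall e, first_last (scan_loc s e) m (ar s' (aF e) v) (ar s' (aL e) v) }.

Lemma triple_scan s (v d : nat) : v < n -> d < n -> vr s rv = v -> vr s rd1 = d.+1 ->
  vr s ro + d.+1 < N -> vr s rk <= n ->
  (forall e, ar s (aF e) v = 0 /\ ar s (aL e) v = 0) ->
  (forall j, 0 < j <= d.+1 ->
     [/\ vr s rcb + ar s aCB (vr s ro + j) <= n,
         vr s (rc false) + ar s (aC false) (vr s ro + j) <= n &
         vr s (rc true) + ar s (aC true) (vr s ro + j) <= n]) ->
  triple scan s (300 * d.+1 + 20) (scanned s v d.+1).
Proof.
move=> lv ld rvE rdE oN kn z bnd; have W1 := W_lin.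
apply: (Tforc (M := d.+1) (b := 250)) => //; try lia.
- by rewrite /=; lia.
- split=> //=.
  + by rewrite /keep /= !eqxx.
  + by move=> e; left; have [-> ->] := z e; split=> // -[].
- move=> i s' [kp _ _ _] _; move: kp; rewrite /keep /=.
  by do 5![case/andP => _]; case/andP=> /eqP-> _.
move=> i s1 lt_i [kp ka ko fl] ji.
apply: Tblk => //.
have := kp; rewrite /keep /=.
do 4![case/andP => _]; case/andP=> /eqP k1 /andP[_ /andP[/eqP k2 /andP[_ /andP[/eqP k3]]]].
case/and4P=> /eqP k4 /eqP k5 /eqP k6 _.
have [h1 h2 h3] := bnd i.+1 ltac:(lia).
apply: (ok_asg (a := i.+1)) => /=; [by rewrite ji; repeat split; lia | by rewrite ji addn1 | ].
have a14 := ka 14 (vr s ro + i.+1) isT.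
have a15 := ka 15 (vr s ro + i.+1) isT.
have a16 := ka 16 (vr s ro + i.+1) isT.
apply: (ok_asg (a := vr s 14 + ar s 14 (vr s ro + i.+1))) => /=.
- by rewrite k2 k4 a14; repeat split; lia.
- by rewrite k2 k4 a14.
apply: (ok_asg (a := vr s 15 + ar s 15 (vr s ro + i.+1))) => /=.
- by rewrite k2 k5 a15; repeat split; lia.
- by rewrite k2 k5 a15.
apply: (ok_asg (a := vr s rcb + ar s 16 (vr s ro + i.+1))) => /=.
- by rewrite k2 k6 a16; repeat split; lia.
- by rewrite k2 k6 a16.
apply: (ok_scan_update (e := false) (l := scan_update true) (v := v) (j1 := i.+1)) => //=; rewrite ?k1 ?k3 //; first by lia.
set g0 := [&& _, _ & _].
apply: (ok_scan_update (e := true) (l := [::]) (v := v) (j1 := i.+1)) => //=; rewrite ?k1 ?k3 //; first by lia.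
set g1 := [&& _, _ & _].
apply: ok_nil; split=> //; split.
- exact: kp.
- move=> k x hk; have := ka k x hk; move: hk; rewrite !inE !negb_or.
  case/and4P=> /negbTE h10 /negbTE h11 /negbTE h12 /negbTE h13.
  by rewrite /= h10 h11 h12 h13.
- by case=> x xv; rewrite /= (negbTE xv); [apply: (ko true) | apply: (ko false)].
- have f0 := first_last_step (fl false).
  have f1 := first_last_step (fl true).
  by case; rewrite /= eqxx; [exact: f1 | exact: f0].
Qed.
Lemma ok_push s1 (v p : 'I_n) inc Q :
  let t e := slot (base v) C (ar s1 (aF e) v) (ar s1 (aL e) v) (base p) (deg p + 2) in
  let tb := both_slot (t false) (t true) (deg p + 2) in
  vr s1 rv = v -> ar s1 aSN v = p -> ar s1 aBASE p = base p ->
  ar s1 aD0 p = deg p -> ar s1 aOFF p = offs p -> ar s1 aBASE v = base v ->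
  vr s1 rinc = inc -> inc <= 1 ->
  (forall e, ar s1 (aF e) v <= n) ->
  (forall t, t < deg p + 3 -> [/\ ar s1 14 (offs p + t) <= n,
     ar s1 15 (offs p + t) <= n & ar s1 16 (offs p + t) <= n]) ->
  (forall vr', keep [:: rn; rn1; rA; ri] s1 (State vr' (ar s1)) ->
   Q (seta (seta (seta (State vr' (ar s1))
     14 (offs p + t false) (ar s1 14 (offs p + t false) + inc))
     15 (offs p + t true) (ar s1 15 (offs p + t true) + inc))
     16 (offs p + tb) (ar s1 16 (offs p + tb) + inc))) ->
  ok (push C) s1 Q.
Proof.
move=> t tb rvE ep ebp edp eop ebv rinc inc1 hF hC q.
have W1 := W_lin; have lv := ltn_ord v; have lp := ltn_ord p; have dp := deg_lt p.
have hbv e : base v + ar s1 (aF e) v * C < 2 ^ w.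
  by apply: code_ltW; apply: leq_trans (hF e) _.
have hbp : base p < 2 ^ w by have := @code_ltW p 0 isT; rewrite mul0n addn0.
have hC' : C < 2 ^ w.
  by have := @small_W C n.+1 1; rewrite muln1 => /(_ _ _ _); nia.
have tl e : t e < deg p + 3 by have := slot_le (base v) C (ar s1 (aF e) v) (ar s1 (aL e) v) (base p) (deg p + 2); rewrite -/(t e); lia.
have tbl : tb < deg p + 3.
  have : tb <= deg p + 2.
    by apply: both_slot_le; [have := tl false | have := tl true]; lia.
  by lia.
have o0 := offs_lt (tl false); have o1 := offs_lt (tl true); have ob := offs_lt tbl.
have oz := offs_lt (v := p) (t := 0) ltac:(lia).
apply: (ok_asg (a := p)) => /=; [by rewrite rvE; split=> //; lia | by rewrite rvE | ].
apply: (ok_asg (a := base p)) => //=; [by split=> //; lia | ].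
apply: (ok_asg (a := deg p + 2)) => /=; [by rewrite edp; repeat split; lia | by rewrite edp | ].
apply: (ok_asg (a := offs p)) => //=; [by split=> //; lia | ].
apply: (ok_target (e := false) (v := v) (b := base v) (bp := base p) (dp := deg p + 2)
  (F := ar s1 10 v) (L := ar s1 12 v)) => //=.
  by apply: hbv false.
apply: (ok_target (e := true) (v := v) (b := base v) (bp := base p) (dp := deg p + 2)
  (F := ar s1 11 v) (L := ar s1 13 v)) => //=.
  by apply: hbv true.
rewrite -/(t false) -/(t true).
apply: (ok_asg (a := tb)) => /=.
- by repeat first [ by [] | lia | split | case: ifP => _ ].
- by rewrite /tb /both_slot !eqb0 !negbK.
have [c0 _ _] := hC _ (tl false).
have [_ c1 _] := hC _ (tl true).
have [_ _ cb] := hC _ tbl.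
apply: (ok_st (x := offs p + t false) (a := ar s1 14 (offs p + t false) + inc)) => //=.
- by repeat split; lia.
- by rewrite rinc; repeat split; lia.
- by rewrite rinc.
- by lia.
apply: (ok_st (x := offs p + t true) (a := ar s1 15 (offs p + t true) + inc)) => //=.
- by repeat split; lia.
- by rewrite rinc; repeat split; lia.
- by rewrite rinc.
- by lia.
apply: (ok_st (x := offs p + tb) (a := ar s1 16 (offs p + tb) + inc)) => //=.
- by repeat split; lia.
- by rewrite rinc; repeat split; lia.
- by rewrite rinc.
- by lia.
by apply: ok_nil; apply: q; rewrite /keep /= !eqxx.
Qed.

(** * The bottom-up pass *)

Section Phase4.
Variables (qs : seq 'I_n) (par : 'I_n -> 'I_n).
Hypothesis EO : elim_order G x0 qs par.
Hypothesis C_gt0 : 0 < C.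
Local Notation tree_root := (tree_root x0 qs).
Local Notation child := (is_child x0 qs par).
Local Notation elim_index := (elim_index qs).
Local Notation loc s := (admissible x0 qs par base C (pk s)).
Local Notation nch := (nch x0 qs par).

(** Admissibility at [v] depends only on the tables of its children, which are final once [v] is
    visited; later writes therefore preserve it. *)
Lemma loc_eq s s' v e j :
  (forall (c : 'I_n) e, child c v ->
     ar s' (aF e) c = ar s (aF e) c /\ ar s' (aL e) c = ar s (aL e) c) ->
  loc s' v e j = loc s v e j.
Proof.
move=> h; have pkE c b sg : child c v -> pk s' c b sg = pk s c b sg.
  by move=> cv; rewrite /pk; have [-> ->] := h c b cv.
by rewrite /admissible; congr [&& _ == 0, _ + _ < _ & _ + _ < _];
  apply: eq_bigr => c cv; rewrite !pkE.
Qed.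

Lemma nch_deg v : nch v = deg v - (elim_index v < n.-1).
Proof. by rewrite /deg (deg_nch EO) -(elim_index_nonroot EO) addKn. Qed.

Lemma sum_le_nch v (f : 'I_n -> bool) : \sum_(c | child c v) f c <= n.
Proof.
apply: (@leq_trans (nch v)); first by apply: leq_sum => c _; case: (f c).
by rewrite nch_deg; have := deg_lt v; lia.
Qed.

Lemma sum_deg_qs : \sum_(i < n) deg (nth x0 qs i) + 2 = 2 * n.
Proof.
rewrite -sum_deg; congr (_ + 2).
transitivity (\sum_(v <- qs) deg v).
  by rewrite (big_nth x0) (eo_size EO) big_mkord.
apply: perm_big.
apply: uniq_perm; rewrite ?(eo_uniq EO) ?index_enum_uniq // => v.
by rewrite mem_index_enum (mem_qs EO).
Qed.

Lemma triple_phase4 s : static qs par s -> zero_from 8 s ->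
  triple (phase4 C) s (4000 * n) (inv4 qs par n).
Proof.
move=> st0 z0; have W1 := W_lin.
pose B4 i := 300 * (deg (nth x0 qs i)).+1 + 800.
(* A visit costs a constant plus a multiple of the degree, and the degrees sum to [2n - 2]. *)
have hB : \sum_(i < n) (B4 i + (esize (Var rn) + 12)) + (esize (Var rn) + 12) <= 4000 * n.
  rewrite big_split /= sum_nat_const card_ord big_split /= sum_nat_const card_ord.
  rewrite -big_distrr /= (eq_bigr (fun i : 'I_n => deg (nth x0 qs i) + 1)); last by move=> *; rewrite addn1.
  rewrite big_split /= sum_nat_const card_ord; have := sum_deg_qs.
  by set S := \sum_(i < n) _ => hS; clear -hS n_gt0; lia.
apply: triple_weaken hB _; last by move=> s' h; exact: h.
apply: (triple_for W_gt1 W_mem W_narr (B := B4)) => //; try lia.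
- split=> //=.
  + case: st0 => -[*]; split=> //.
  + move=> e v t ht; have := offs_lt ht => ho.
    rewrite /cnt big_pred0 // z0 //; first by case: e.
    by lia.
  + move=> v t ht; have := offs_lt ht => ho.
    by rewrite /cntb big_pred0 // z0 //; lia.
  + by move=> v e _; have lv := ltn_ord v; rewrite !z0 //; case: e => //; lia.
- by move=> i s' [[[]]].
move=> i s1 lt_i [st hc hcb hfl hz] vi.
have [v vdef] : exists v, nth x0 qs i = v by eexists.
have ev : elim_index v = i by rewrite -vdef (elim_index_nth EO).
have lv := ltn_ord v; have dv := deg_lt v.
case: (st) => -[cn cn1 cA] hd hq hsn _ _.
have [d1 d2 d3] := hd v.
have o1 := offs_lt (v := v) (t := 0) ltac:(lia).
have o2 := offs_lt (v := v) (t := (deg v).+1) ltac:(lia).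
have hloc c : elim_index c < elim_index v -> forall e, exists lc,
    first_last lc (deg c).+1 (ar s1 (aF e) c) (ar s1 (aL e) c).
  by rewrite ev => h e; exists (loc s1 c e); apply: hfl.
have key e j : 0 < j <= (deg v).+1 ->
    ar s1 (aC e) (offs v + j) + ar s1 (aC e) (offs v) =
    \sum_(c | child c v) (pk s1 c e (base v + j * C) == 0).
  move=> hj; rewrite hc; last by lia.
  have := hc e v 0 ltac:(lia); rewrite addn0 => ->.
  rewrite (cnt_select EO) ?ev //; first by lia.
  by move=> c hcv; apply: hloc; rewrite ev.
have keyb j : 0 < j <= (deg v).+1 ->
    ar s1 aCB (offs v + j) + ar s1 aCB (offs v) =
    \sum_(c | child c v) ((pk s1 c false (base v + j * C) == 0) &&
                          (pk s1 c true (base v + j * C) == 0)).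
  move=> hj; rewrite hcb; last by lia.
  have := hcb v 0 ltac:(lia); rewrite addn0 => ->.
  rewrite (cntb_select EO) ?ev //; first by lia.
  by move=> c e hcv; apply: hloc; rewrite ev.
have lv5 : v < 5 * n by lia.
apply: (triple_weaken (B := 200 + ((300 * (deg v).+1 + 20) + 580))
   (Q := fun s2 => vr s2 ri = i /\ inv4 qs par i.+1 (setv s2 ri i.+1))) => //; last first.
  by rewrite /B4 vdef; lia.
pose inc : nat := i < n.-1.
pose sV := setv (setv (setv (setv (setv (setv (setv (setv (setv s1 rv v) rd (deg v))
  rd1 (deg v).+1) ro (offs v)) rinc inc) rk (nch v)) 14 (ar s1 14 (offs v)))
  15 (ar s1 15 (offs v))) rcb (ar s1 16 (offs v)).
have nchE := nch_deg v; rewrite ev in nchE.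
have hdinc : inc <= deg v by rewrite /inc -ev -(elim_index_nonroot EO) /deg (deg_nch EO) leq_addr.
have inc1 : inc <= 1 by rewrite /inc; case: (_ < _).
apply: (Tseq (Q1 := fun s' => s' = sV)).
  apply: Tblk; [by [] | | by []].
  apply: (ok_asg (a := v)) => /=; [by rewrite vi; split=> //; lia | by rewrite vi hq // vdef | ].
  apply: (ok_asg (a := deg v)) => //=; first by split=> //; lia.
  apply: (ok_asg (a := (deg v).+1)) => /=; [by repeat split; lia | by rewrite addn1 | ].
  apply: (ok_asg (a := offs v)) => //=; first by split=> //; lia.
  apply: (ok_asg (a := inc)) => /=; [by [] | by rewrite vi cn1 | ].
  by apply: (ok_asg (a := nch v)) => /=; [split | rewrite nchE | ] => //;
   apply: (ok_asg (a := ar s1 14 (offs v))) => //=; [split=> //; lia | ];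
   apply: (ok_asg (a := ar s1 15 (offs v))) => //=; [split=> //; lia | ];
   apply: (ok_asg (a := ar s1 16 (offs v))) => //=; split=> //; lia.
move=> _ ->.
apply: (Tseq (Q1 := scanned sV v (deg v).+1)).
  apply: triple_scan => //=; try lia.
  - by move=> e; apply: hz; rewrite ev.
  - move=> j hj; have := keyb j hj; have := key false j hj; have := key true j hj.
    rewrite /= ![ar s1 _ (offs v) + _]addnC => -> -> ->.
    by split; apply: sum_le_nch.
move=> s2 [kp ka ko fl].
apply: Tblk; [by [] | | by []].
have := kp; rewrite /keep /= => /and5P[/eqP r1 /eqP r2 /eqP r3 /eqP r4].
case/and5P=> /eqP r5 _ _ /eqP r23 _ {kp}.
have FLs2 (c : 'I_n) e : c != v -> ar s2 (aF e) c = ar s1 (aF e) c /\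
    ar s2 (aL e) c = ar s1 (aL e) c by move=> cv; apply: ko.
have [p1 p2 p3] := hd (par v).
have Fle e : ar s2 (aF e) v <= n.
  by have [+ _] := first_last_le (fl e); move/leq_trans; apply.
have cle (f : 'I_n -> bool) (P : pred 'I_n) : \sum_(c | P c) f c <= n.
  apply: (@leq_trans (\sum_(c : 'I_n) 1)); last by rewrite sum1_card card_ord.
  by rewrite [X in X <= _]big_mkcond; apply: leq_sum => c _; case: (P c); case: (f c).
rewrite -[ar sV]/(ar s1) in ka.
apply: (@ok_push _ v (par v) inc) => //; try by rewrite ka.
- move=> t ht; rewrite !ka //; have := hc false _ _ ht; have := hc true _ _ ht.
  by move=> /= -> ->; rewrite hcb //; split; apply: cle.
move=> vr' /=; rewrite /keep /= => /and5P[/eqP q1 /eqP q2 /eqP q3 /eqP q4 _].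
pose t (e : bool) := slot (base v) C (ar s2 (aF e) v) (ar s2 (aL e) v)
  (base (par v)) (deg (par v) + 2).
rewrite -[slot _ _ (ar s2 10 v) _ _ _]/(t false) -[slot _ _ (ar s2 11 v) _ _ _]/(t true).
set tb := both_slot _ _ _.
set s3 := seta _ 16 _ _.
have FL3 e (c : 'I_n) : c != v -> ar s3 (aF e) c = ar s1 (aF e) c /\
    ar s3 (aL e) c = ar s1 (aL e) c.
  by move=> cv; have := FLs2 c e cv; case: e.
have FL3v e : ar s3 (aF e) v = ar s2 (aF e) v /\ ar s3 (aL e) v = ar s2 (aL e) v.
  by case: e.
have sltE e : slt s3 e v (par v) = t e.
  by rewrite /slt; have [-> ->] := FL3v e.
have tl e : t e < deg (par v) + 3.
  have : t e <= deg (par v) + 2 by apply: slot_le.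
  by lia.
have tbl : tb < deg (par v) + 3.
  have : tb <= deg (par v) + 2 by apply: both_slot_le; apply: slot_le.
  by lia.
have lt_v (c : 'I_n) : elim_index c < i -> c != v.
  by apply: contraTneq => ->; rewrite ev ltnn.
(* Adding [inc] at the parent thus adds exactly the indicator that [v] is a child, and nothing at
   the root. *)
have childE v' : child v v' = (inc == 1) && (v' == par v).
  by rewrite /is_child (elim_index_nonroot EO) ev /inc eq_sym; case: (i < n.-1).
have kE k x : k \notin [:: 10; 11; 12; 13; 14; 15; 16] -> ar s3 k x = ar s1 k x.
  move=> hk; rewrite -ka; last first.
    by move: hk; rewrite !inE !negb_or; case/and5P=> -> -> -> -> _.
  move: hk; rewrite /s3 /= !inE !negb_or.
  by case/and5P=> _ _ _ _ /and3P[/negbTE-> /negbTE-> /negbTE->].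
have cntE e (v' : 'I_n) t' : t' < deg v' + 3 ->
    ar s3 (aC e) (offs v' + t') = cnt qs par s3 e i.+1 v' t'.
  move=> ht'; rewrite /cnt (sum_elim_indexS EO _ _ ev).
  rewrite -/(cnt qs par s3 e i v' t') (@cnt_eq _ _ s1); last first.
    by move=> c /lt_v; apply: FL3.
  rewrite -hc // childE.
  have -> : ar s3 (aC e) (offs v' + t') =
    if offs v' + t' == offs (par v) + t e then ar s1 (aC e) (offs (par v) + t e) + inc
    else ar s1 (aC e) (offs v' + t').
    by rewrite -!ka; case: e.
  rewrite (offs_inj ht' (tl e)).
  have [->|nv] := eqVneq v' (par v); last by rewrite andbF mul0n addn0.
  rewrite andbT sltE [t e == t']eq_sym; have [->|nt] /= := eqVneq t' (t e).
    by move: inc1; case: (inc) => [|[|]].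
  by rewrite muln0 addn0.
have cntbE (v' : 'I_n) t' : t' < deg v' + 3 ->
    ar s3 aCB (offs v' + t') = cntb qs par s3 i.+1 v' t'.
  move=> ht'; rewrite /cntb (sum_elim_indexS EO _ _ ev).
  rewrite -/(cntb qs par s3 i v' t') (@cntb_eq _ _ s1); last first.
    by move=> c e /lt_v; apply: FL3.
  rewrite -hcb // childE.
  have -> : ar s3 aCB (offs v' + t') =
    if offs v' + t' == offs (par v) + tb then ar s1 aCB (offs (par v) + tb) + inc
    else ar s1 aCB (offs v' + t').
    by rewrite -!ka.
  rewrite (offs_inj ht' tbl).
  have [->|nv] := eqVneq v' (par v); last by rewrite andbF mul0n addn0.
  rewrite andbT !sltE -/tb [tb == t']eq_sym.
  have [->|nt] /= := eqVneq t' tb; last by rewrite muln0 addn0.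
  by move: inc1; case: (inc) => [|[|]].
split; first by rewrite /s3 /= q4 r4 vi.
split.
- have arE k x : k \notin [:: 10; 11; 12; 13; 14; 15; 16] ->
    ar (setv s3 ri i.+1) k x = ar s1 k x by apply: kE.
  case: (st) => _ _ _ _ hse hr; split.
  + by split; rewrite /= ?q1 ?q2 ?q3 ?r1 ?r2 ?r3.
  + by move=> u; rewrite !arE.
  + by move=> j hj; rewrite arE // hq.
  + by move=> u; rewrite arE.
  + by move=> u ur; rewrite arE // hse.
  + by rewrite arE.
- exact: cntE.
- exact: cntbE.
- move=> c e; rewrite ltnS leq_eqVlt -{1}ev (inj_eq (elim_index_inj EO)).
  case/orP=> [/eqP->|lt_c].
    have [hF hL] := FL3v e.
    rewrite -[ar (setv _ _ _)]/(ar s3) hF hL.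
    (* By [key] and [keyb], the scanned guard is the admissibility predicate of [v]. *)
    apply: first_last_eq (fl e) => j hj.
    have locE : loc (setv s3 ri i.+1) v e j = loc s1 v e j.
      by apply: loc_eq => c' e' /(child_elim_index EO); rewrite ev => /lt_v; apply: FL3.
    rewrite locE /scan_loc /admissible /= ![ar s1 _ (offs v) + _]addnC.
    by rewrite keyb // (key false j hj) (key true j hj).
  have cv := lt_v c lt_c; have [hF hL] := FL3 e c cv.
  rewrite -[ar (setv _ _ _)]/(ar s3) hF hL.
  apply: first_last_eq (hfl c e lt_c) => j hj; apply/esym/loc_eq => c' e' cc'.
  by apply: FL3; apply: lt_v; apply: ltn_trans (child_elim_index EO cc') lt_c.
- move=> c e lt_c; have cv : c != v by apply: contraTneq lt_c => ->; rewrite ev ltnn.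
  by have [-> ->] := FL3 e c cv; apply: hz; apply: ltnW.
Qed.

Lemma ok_select e l s1 v b F L sg Q :
  vr s1 rv = v -> v < n -> ar s1 aBASE v = b -> ar s1 (aF e) v = F ->
  ar s1 (aL e) v = L -> vr s1 rX = sg -> b + F * C < 2 ^ w -> b + L * C < 2 ^ w ->
  C < 2 ^ w ->
  ok l (setv s1 (rx e) (select b C F L sg)) Q ->
  ok (Asg (rx e) (pick_expr C e) :: l) s1 Q.
Proof.
move=> rvE lv eb eF eL rX bF bL bC okl; have W1 := W_lin.
have vN : v < N by lia.
have bF' : F * C < 2 ^ w by apply: leq_ltn_trans bF; rewrite leq_addl.
have bL' : L * C < 2 ^ w by apply: leq_ltn_trans bL; rewrite leq_addl.
apply: (ok_asg (a := select b C F L sg)) => //.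
- by case: e {okl} eF eL => eF eL /=; rewrite rvE eb eF eL;
    repeat first [ by [] | lia | split | case: ifP => _ ].
- by case: e {okl} eF eL => eF eL /=; rewrite rvE eb eF eL rX /select !eqb0 !negbK.
Qed.

Lemma ok_phase5 s1 i v p o b sv J (F L : bool -> nat) Q :
  let sg := if i != 0 then ar s1 aBASE p + J * C else 0 in
  let X e := select b C (F e) (L e) sg in
  let rem := ar s1 aREM p in
  let e := (i != 0) && (if X false != 0 then (X true != 0) && (0 < rem) else true) in
  let dec := [&& i != 0, X false != 0, X true != 0 & 0 < rem] in
  let j1 := if e then X true else X false in
  let r := j1 - (1 + e + ar s1 14 (o + j1) + ar s1 14 o) in
  vr s1 ri = i -> i < n -> vr s1 rn1 = n.-1 -> ar s1 aQ (n.-1 - i) = v -> v < n ->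
  ar s1 aSN v = p -> p < n -> ar s1 aOFF v = o -> ar s1 aBASE v = b ->
  ar s1 aSE v = sv -> sv < n -> ar s1 aJ p = J -> C < 2 ^ w ->
  (i != 0 -> ar s1 aBASE p + J * C < 2 ^ w) ->
  (forall e, ar s1 (aF e) v = F e) -> (forall e, ar s1 (aL e) v = L e) ->
  (forall e, b + F e * C < 2 ^ w) -> (forall e, b + L e * C < 2 ^ w) ->
  o + j1 < N -> j1 <= n -> 1 + e + ar s1 14 (o + j1) + ar s1 14 o <= j1 ->
  (forall vr', keep [:: rn; rn1; rA; ri; rlim] s1 (State vr' (ar s1)) ->
   Q (seta (seta (seta (seta (State vr' (ar s1)) aREM p (rem - dec)) aJ v j1)
        aREM v r) aIO sv.+1 e)) ->
  ok (phase5_body C) s1 Q.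
Proof.
move=> sg X rem e dec j1 r vi lt_i vn1 qi lv ep lp eo eb es' lsv eJ bC bJ eF eL bF bL
  oN j1n rle q.
have W1 := W_lin.
have bJ' : i != 0 -> J * C < 2 ^ w.
  by move/bJ; apply: leq_ltn_trans; rewrite leq_addl.
apply: (ok_asg (a := v)) => /=.
- by rewrite vi vn1; repeat split; lia.
- by rewrite vi vn1.
apply: (ok_asg (a := p)) => //=; first by split=> //; lia.
apply: (ok_asg (a := o)) => //=; first by split=> //; lia.
apply: (ok_asg (a := sg)) => /=.
- rewrite vi; split=> //; case: ifP => i0; last by lia.
  have := bJ i0; have := bJ' i0; rewrite eJ.
  by repeat split; lia.
- by rewrite vi eJ.
apply: (ok_select (e := false) (v := v) (b := b) (F := F false) (L := L false) (sg := sg)) => //=.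
- by apply: (eF false).
- by apply: (eL false).
apply: (ok_select (e := true) (v := v) (b := b) (F := F true) (L := L true) (sg := sg)) => //=.
- by apply: (eF true).
- by apply: (eL true).
rewrite -/(X false) -/(X true).
apply: (ok_asg (a := 0 < rem)) => /=; [by repeat split; lia | by [] | ].
apply: (ok_asg (a := e)) => /=.
- by repeat first [ by [] | lia | split | case: ifP => _ ].
- rewrite vi /e; case: (i != 0) => //; case: (X false != 0) => //.
  by case: (X true != 0).
apply: (ok_asg (a := dec)) => /=.
- by repeat first [ by [] | lia | split | case: ifP => _ ].
- rewrite vi /dec; case: (i != 0) => //; case: (X false != 0) => //.
  by case: (X true != 0).
have decle : dec <= rem.
  by rewrite /dec; case: (i != 0) => //; case: (X false != 0) => //; case: (X true != 0) => //=; case: (rem).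
apply: (ok_st (x := p) (a := rem - dec)) => //=; first by repeat split; lia.
  by lia.
apply: (ok_asg (a := j1)) => /=.
- by case: (e).
- by rewrite eqb0 negbK.
apply: (ok_st (x := v) (a := j1)) => //=; first by lia.
have lo : o < N by lia.
have le1 : e <= 1 by case: (e).
apply: (ok_st (x := v) (a := r)) => //=; first by repeat split; lia.
  by lia.
apply: (ok_st (x := sv.+1) (a := e)) => //=.
- by repeat split; lia.
- by rewrite es' addn1.
- by lia.
apply: ok_nil; clearbody r j1 dec e rem X sg.
match goal with |- Q ?s => have := q (vr s) end.
move=> q'; apply: q'.
rewrite /keep /=.
by rewrite !eqxx.
Qed.

(** * The top-down choice of weights *)

Section Phase5.
Variables (s0 : state).
Hypothesis I4 : inv4 qs par n s0.
Let pk0 := pk s0.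

Lemma fl0 (v : 'I_n) e :
  first_last (loc s0 v e) (deg v).+1 (ar s0 (aF e) v) (ar s0 (aL e) v).
Proof. by case: I4 => _ _ _ h _; apply: h; apply: elim_index_lt EO v. Qed.

Lemma cnt0 (v : 'I_n) j : 0 < j <= (deg v).+1 ->
  ar s0 14 (offs v + j) + ar s0 14 (offs v) =
  \sum_(c | child c v) (pk0 c false (base v + j * C) == 0).
Proof.
case: I4 => _ hc _ _ _ hj.
have := hc false v j ltac:(lia) => /= ->.
have := hc false v 0 ltac:(lia); rewrite addn0 /= => ->.
rewrite (cnt_select EO) //; last by move=> c _; exists (loc s0 c false); apply: fl0.
- exact: ltnW (elim_index_lt EO v).
- by lia.
Qed.

(** Ensures that writing the bit of one parent edge never overwrites that of another. If the edges
    coincided with [u] and [v] distinct, each would be the parent of the other. *)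
Lemma eidx_par_inj u v : u != tree_root -> v != tree_root ->
  eidx es u (par u) = eidx es v (par v) -> u = v.
Proof.
move=> ur vr e; have au := eo_adj EO ur; have av := eo_adj EO vr.
have : [set u; par u] = [set v; par v].
  by rewrite -(nth_eidx es_G e0 au) -(nth_eidx es_G e0 av) e.
move/setP => h; have := h u; have := h v; rewrite !inE !eqxx /=.
case/orP=> [/eqP-> //|/eqP vpu] /esym/orP[/eqP//|/eqP upv].
have := eo_lt EO ur; have := eo_lt EO vr; rewrite -vpu -upv; lia.
Qed.

(* [v] has its final weighted degree; its children of elimination index at    *)
(* least [k] have their bits [x], and the other ones must be able to supply   *)
(* the [aREM] bits that are still missing beyond the forced ones.             *)
Record settled (x : 'I_n -> bool) (s : state) (k : nat) (v : 'I_n) : Prop := Settled {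
  se_J : 0 < ar s aJ v <= (deg v).+1;
  se_root : v == tree_root -> x v = false;
  se_edge : v != tree_root ->
    base v + ar s aJ v * C != base (par v) + ar s aJ (par v) * C /\
    ar s aIO (eidx es v (par v)).+1 = x v;
  se_sum : ar s aREM v + 1 + x v + \sum_(c | child c v && (k <= elim_index c)) x c +
    \sum_(c | child c v && (elim_index c < k)) (pk0 c false (base v + ar s aJ v * C) == 0) =
    ar s aJ v;
  se_rem : ar s aREM v <= \sum_(c | child c v && (elim_index c < k))
    ((pk0 c false (base v + ar s aJ v * C) != 0) &&
     (pk0 c true (base v + ar s aJ v * C) != 0));
  se_ok : forall c, child c v -> (pk0 c false (base v + ar s aJ v * C) != 0) ||
     (pk0 c true (base v + ar s aJ v * C) != 0) }.

Record inv5 (i : nat) (s : state) : Prop := Inv5 {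
  i5_c : consts s;
  i5_lim : vr s rlim = n;
  i5_ar : forall k x, k \notin [:: 0; 8; 9] -> ar s k x = ar s0 k x;
  i5_io : ar s aIO 0 = 1;
  i5_x : exists x : 'I_n -> bool,
    forall v, n - i <= elim_index v -> settled x s (n - i) v }.
Lemma settled_eq (x x' : 'I_n -> bool) s s' k k' (v : 'I_n) :
  ar s' aJ v = ar s aJ v -> (v != tree_root -> ar s' aJ (par v) = ar s aJ (par v)) ->
  ar s' aREM v = ar s aREM v -> x' v = x v ->
  (v != tree_root -> ar s' aIO (eidx es v (par v)).+1 = ar s aIO (eidx es v (par v)).+1) ->
  (forall c, child c v -> (k' <= elim_index c) = (k <= elim_index c)) ->
  (forall c, child c v -> k <= elim_index c -> x' c = x c) ->
  settled x s k v -> settled x' s' k' v.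
Proof.
move=> eJ eJp eR ex eio ek exc [h1 h2 h3 h4 h5 h6].
have lk c : child c v && (elim_index c < k') = child c v && (elim_index c < k).
  by case cv: (child c v) => //=; rewrite !ltnNge ek.
split; rewrite ?eJ ?eR ?ex //.
- by move=> vr; rewrite eio // eJp //; apply: h3.
- rewrite -[RHS]h4 (eq_bigl _ _ lk); congr (_ + _ + _).
  apply: eq_big => [c|c /andP[cv hc]].
    by case cv: (child c v) => //=; rewrite ek.
  by rewrite (exc c cv) // -ek.
- by rewrite (eq_bigl _ _ lk).
Qed.

Lemma sum_child_step (f : 'I_n -> nat) (v p : 'I_n) : child v p ->
  \sum_(c | child c p && (elim_index v <= elim_index c)) f c =
    f v + \sum_(c | child c p && (elim_index v < elim_index c)) f c /\
  \sum_(c | child c p && (elim_index c < (elim_index v).+1)) f c =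
    f v + \sum_(c | child c p && (elim_index c < elim_index v)) f c.
Proof.
move=> vp; split; rewrite (bigD1 v) /= ?vp ?leqnn //; congr (_ + _);
  apply: eq_bigl => c; rewrite -andbA; congr (_ && _).
  by rewrite -(inj_eq (elim_index_inj EO)) [_ < _]ltn_neqAle andbC [elim_index v == _]eq_sym.
by rewrite -(inj_eq (elim_index_inj EO)) ltnS [RHS]ltn_neqAle andbC.
Qed.

(** When [v] gets its value, all its children are still pending. The upper bound in admissibility
    says that the free children are numerous enough to supply the missing bits. *)
Lemma settled_new (x : 'I_n -> bool) s (v : 'I_n) : 0 < ar s aJ v <= (deg v).+1 ->
  (v == tree_root -> x v = false) ->
  (v != tree_root ->
    base v + ar s aJ v * C != base (par v) + ar s aJ (par v) * C /\
    ar s aIO (eidx es v (par v)).+1 = x v) ->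
  loc s0 v (x v) (ar s aJ v) ->
  ar s aREM v + 1 + x v +
    \sum_(c | child c v) (pk0 c false (base v + ar s aJ v * C) == 0) = ar s aJ v ->
  settled x s (elim_index v) v.
Proof.
move=> h1 h2 h3 /and3P[nb n0 n1] h4.
have all c : child c v && (elim_index c < elim_index v) = child c v.
  by case cv: (child c v); rewrite // (child_elim_index EO cv).
have none c : child c v && (elim_index v <= elim_index c) = false.
  by case cv: (child c v) => //=; rewrite leqNgt (child_elim_index EO cv).
have okc c : child c v -> (pk0 c false (base v + ar s aJ v * C) != 0) ||
     (pk0 c true (base v + ar s aJ v * C) != 0).
  move=> cv; move: nb; rewrite sum_nat_eq0 => /forall_inP/(_ c cv).
  by rewrite eqb0 negb_and.
split=> //.
- by rewrite (eq_bigl _ _ all) big_pred0 // addn0.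
- rewrite (eq_bigl _ _ all).
  (* No child is blocked for both bits, so the children split into those forced to 1, those forced
     to 0 and the free ones. *)
  have : nch v = \sum_(c | child c v) (pk0 c false (base v + ar s aJ v * C) == 0) +
    (\sum_(c | child c v) (pk0 c true (base v + ar s aJ v * C) == 0) +
     \sum_(c | child c v) ((pk0 c false (base v + ar s aJ v * C) != 0) &&
     (pk0 c true (base v + ar s aJ v * C) != 0))).
    rewrite -!big_split; apply: eq_bigr => c /okc /=.
    by case: (_ == 0) => //=; case: (_ == 0).
  move: n0 n1 h4; rewrite -/pk0; set a1 := \sum_(c | _) _; set a2 := \sum_(c | _) (pk0 c true _ == 0).
  by move: (ar s 8 v) (ar s 9 v) (\sum_(c | _) _) => j r f; clear; case: (x v); lia.
Qed.
(** The sum is preserved because a child forced to 1 moves from the forced count to the bit count,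
    while a free child receiving 1 pays with one unit of [aREM]. A free child receives 0 only when
    [aREM] is 0, so the remaining free children still suffice. *)
Lemma settled_parent (x x' : 'I_n -> bool) s s' (v : 'I_n) (e dec : bool) :
  let p := par v in
  let X b := pk0 v b (base p + ar s aJ p * C) in
  v != tree_root ->
  e = (if X false != 0 then (X true != 0) && (0 < ar s aREM p) else true) ->
  dec = [&& X false != 0, X true != 0 & 0 < ar s aREM p] ->
  ar s' aJ p = ar s aJ p ->
  (p != tree_root -> ar s' aJ (par p) = ar s aJ (par p)) ->
  ar s' aREM p = ar s aREM p - dec ->
  (p != tree_root -> ar s' aIO (eidx es p (par p)).+1 = ar s aIO (eidx es p (par p)).+1) ->
  x' v = e -> (forall u, u != v -> x' u = x u) ->
  settled x s (elim_index v).+1 p -> settled x' s' (elim_index v) p.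
Proof.
move=> p X vr eE decE eJ eJp eR eio xv xu [h1 h2 h3 h4 h5 h6].
have vp : child v p by rewrite /is_child vr eqxx.
have pv : p != v by rewrite -(inj_eq (elim_index_inj EO)) neq_ltn (eo_lt EO vr) orbT.
split; rewrite ?eJ ?xu //.
- by move=> pr; rewrite eio // eJp //; apply: h3.
- have [-> _] := sum_child_step (fun c => x' c) vp.
  have [_ e2] := sum_child_step (fun c => pk0 c false (base p + ar s aJ p * C) == 0) vp.
  move: h4; rewrite e2 -/(X false) eR xv.
  have -> : \sum_(c | child c p && (elim_index v < elim_index c)) x' c =
            \sum_(c | child c p && (elim_index v < elim_index c)) x c.
    apply: eq_bigr => c /andP[_ lt]; rewrite xu //.
    by apply: contraTneq lt => ->; rewrite ltnn.
  rewrite eE decE; move: (ar s 9 p) (ar s 8 p) (\sum_(c | _) _) (\sum_(c | _) _).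
  move: (X false) (X true) (x p) => a b c; clear => rem j s1 s2.
  by case: a => [|a]; case: b => [|b]; case: rem => [|rem] /=; lia.
- move: h5; have [_ ->] := sum_child_step (fun c =>
    (pk0 c false (base p + ar s aJ p * C) != 0) &&
    (pk0 c true (base p + ar s aJ p * C) != 0) : nat) vp.
  rewrite -/(X false) -/(X true) eR decE.
  move: (ar s 9 p) (\sum_(c | _) _) (X false) (X true) => rem s1 a b; clear.
  by case: a => [|a]; case: b => [|b]; case: rem => [|rem] /=; lia.
Qed.

Lemma inv5_step i s1 : i < n -> inv5 i s1 -> vr s1 ri = i -> ar s0 10 tree_root != 0 ->
  ok (phase5_body C) s1 (fun s2 => vr s2 ri = i /\ inv5 i.+1 (setv s2 ri i.+1)).
Proof.
move=> lt_i [[cn cn1 cA] lim fr io [x hx]] vi ans.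
case: (I4) => -[_ hd hq hsn hse hser] _ _ _ _.
have lt_ni : n.-1 - i < n by lia.
have [v vdef] : exists v, nth x0 qs (n.-1 - i) = v by eexists.
have ev : elim_index v = n.-1 - i by rewrite -vdef (elim_index_nth EO).
have vrE : (v != tree_root) = (i != 0) by rewrite (elim_index_nonroot EO) ev; lia.
have k1 : n - i = (elim_index v).+1 by rewrite ev; lia.
have k2 : n - i.+1 = elim_index v by rewrite ev; lia.
have lv := ltn_ord v; have dv := deg_lt v.
pose p := par v; have lp : p < n := ltn_ord p.
have [d1 d2 d3] := hd v; have [p1 p2 p3] := hd p.
rewrite k1 in hx.
have hp : i != 0 -> settled x s1 (elim_index v).+1 p.
  by rewrite -vrE => vr; apply: hx; exact: (eo_lt EO vr).
pose sv := if v != tree_root then eidx es v p else 0.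
have svE : ar s1 aSE v = sv.
  rewrite fr // /sv; case: ifP => [/hse //|/negbFE/eqP->]; exact: hser.
have lsv : sv < n.
  rewrite /sv; case: ifP => // vr.
  by have := eidx_lt es_G (eo_adj EO vr); rewrite size_es => /leq_trans; apply; apply: leq_pred.
have Fle e : ar s0 (aF e) v <= n.+1 /\ ar s0 (aL e) v <= n.+1.
  have [h1 h2] := first_last_le (fl0 v e).
  by split; [apply: leq_trans h1 _ | apply: leq_trans h2 _]; rewrite ltnS ltnW.
have C_W : C < 2 ^ w.
  have := @small_W C n.+1 1; rewrite muln1 => /(_ _ (leqnn _) _) h.
  have : C * n.+1 <= 2 ^ w by apply: h; clear; lia.
  by apply: leq_trans; clear - n_gt0 C_gt0; nia.
pose J := ar s1 aJ p.
pose sg := if i != 0 then base p + J * C else 0.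
pose X e := pk0 v e sg.
pose rem := ar s1 aREM p.
pose e := (i != 0) && (if X false != 0 then (X true != 0) && (0 < rem) else true).
pose dec := [&& i != 0, X false != 0, X true != 0 & 0 < rem].
pose j1 := if e then X true else X false.
have j1E : j1 = X e by rewrite /j1; case: (e).
(* At the root this is the positive answer together with the dummy code 0; elsewhere the parent's
   value does not block [v] for both bits, and [e] is chosen among the possible ones. *)
have j1n0 : j1 != 0.
  rewrite /j1 /e; have [i0|i1] := eqVneq i 0 => /=.
    rewrite /X /pk0 /pk /select /sg i0 /=.
    have -> : v = tree_root by apply/eqP; rewrite -[_ == _]negbK vrE i0.
    by rewrite ans ifF //; move: ans; clear -C_gt0; nia.
  have vp : child v p by rewrite /is_child vrE i1 eqxx.
  have := se_ok (hp i1) vp; rewrite -/J.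
  have -> : base p + J * C = sg by rewrite /sg i1.
  rewrite -/(X false) -/(X true).
  have [X0|X0 _] /= := eqVneq (X false) 0; first by [].
  by have [X1|X1] /= := eqVneq (X true) 0; [ | case: (0 < rem)].
have [j1b locj nsg] : [/\ 0 < j1 <= (deg v).+1, loc s0 v e j1 & base v + j1 * C != sg].
  by rewrite j1E in j1n0 *; exact: select_sound (fl0 v e) j1n0.
have cn0 := cnt0 j1b.
have le_j : 1 + e + ar s0 14 (offs v + j1) + ar s0 14 (offs v) <= j1.
  case/and3P: locj => _ + _; rewrite -cn0.
  move: (ar s0 14 (offs v + j1)) (ar s0 14 (offs v)) (nat_of_bool e) (j1).
  by clear; lia.
have oj := @offs_lt v j1 ltac:(clear -j1b; lia).
pose r := j1 - (1 + e + ar s0 14 (offs v + j1) + ar s0 14 (offs v)).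
have sgE : (if i != 0 then ar s1 aBASE p + J * C else 0) = sg by rewrite fr // p3.
have final vr' : keep [:: rn; rn1; rA; ri; rlim] s1 (State vr' (ar s1)) ->
  let s2 := seta (seta (seta (seta (State vr' (ar s1)) aREM p (rem - dec)) aJ v j1)
    aREM v r) aIO sv.+1 e in
  vr s2 ri = i /\ inv5 i.+1 (setv s2 ri i.+1).
  rewrite /keep /= => /and5P[/eqP q1 /eqP q2 /eqP q3 /eqP q4 /andP[/eqP q5 _]].
  set s2 := seta _ 0 _ _; split; first by rewrite /= q4.
  have nE (u u' : 'I_n) : u != u' -> (u == u' :> nat) = false by move/negbTE.
  have Jv : ar s2 8 v = j1 by rewrite /= eqxx.
  have Jo (u : 'I_n) : u != v -> ar s2 8 u = ar s1 8 u by move=> uv; rewrite /= nE.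
  have Rv : ar s2 9 v = r by rewrite /= eqxx.
  have Rp : p != v -> ar s2 9 p = rem - dec by move=> pv; rewrite /= nE // eqxx.
  have Ro (u : 'I_n) : u != v -> u != p -> ar s2 9 u = ar s1 9 u.
    by move=> uv up; rewrite /= !nE.
  have IOv : ar s2 0 sv.+1 = e by rewrite /= eqxx.
  have IOo y : y != sv -> ar s2 0 y.+1 = ar s1 0 y.+1.
    by move=> ysv; rewrite /= eqSS (negbTE ysv).
  have pnv : v != tree_root -> p != v.
    by move=> vr; rewrite -(inj_eq (elim_index_inj EO)) neq_ltn (eo_lt EO vr) orbT.
  have svr : v != tree_root -> sv = eidx es v p by rewrite /sv => ->.
  split=> //=.
  - by split; rewrite /= ?q1 ?q2 ?q3.
  - by rewrite /= q5.
  - move=> k y hk; rewrite -(fr k y hk); move: hk; rewrite /= !inE !negb_or.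
    by case/and3P=> /negbTE h0 /negbTE h8 /negbTE h9; rewrite h0 h8 h9.
  - exists (fun u => if u == v then e else x u) => u; rewrite k2 => le_u.
    have [->|uv] := eqVneq u v.
      apply: settled_new; rewrite -1?[ar (setv _ _ _)]/(ar s2) ?eqxx ?Jv //.
      + by move/eqP=> vr; rewrite /e -vrE vr eqxx.
      + move=> vr; rewrite Jo ?pnv // -/p -svr // IOv; split=> //.
        by move: nsg; rewrite /sg -vrE vr.
      + by rewrite -cn0 Rv /r; clear -le_j; lia.
    have lt_u : elim_index v < elim_index u.
      by rewrite ltn_neqAle le_u andbT (inj_eq (elim_index_inj EO)) eq_sym.
    have vr : v != tree_root.
      by rewrite (elim_index_nonroot EO); have := elim_index_lt EO u; clear -lt_u; lia.
    have i1 : i != 0 by rewrite -vrE.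
    have io' (u' : 'I_n) : u' != v -> u' != tree_root ->
        ar s2 0 (eidx es u' (par u')).+1 = ar s1 0 (eidx es u' (par u')).+1.
      move=> uv' ur'; apply: IOo; rewrite svr //.
      by apply: contra_neq uv' => /(eidx_par_inj ur' vr).
    have par_nv (u' : 'I_n) : elim_index v < elim_index u' -> u' != tree_root -> par u' != v.
      move=> lt' ur'; have := eo_lt EO ur'; rewrite -(inj_eq (elim_index_inj EO)).
      by clear -lt'; lia.
    have [up|up] := eqVneq u p; last first.
      apply: (settled_eq (s := s1) (x := x) (k := (elim_index v).+1)) (hx u lt_u).
      + exact: Jo.
      + by move=> ur; apply: Jo; apply: par_nv.
      + exact: Ro.
      + by rewrite (negbTE uv).
      + exact: io'.
      + move=> c cu; rewrite leq_eqVlt (inj_eq (elim_index_inj EO)).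
        by case: eqVneq cu => // <- /andP[_ /eqP pu]; rewrite -pu eqxx in up.
      + move=> c cu; rewrite ltnNge; case: eqVneq => // ->; by rewrite leqnn.
    rewrite up in lt_u uv *.
    have sgp : base p + ar s1 aJ p * C = sg by rewrite /sg i1.
    apply: (settled_parent (x := x) (s := s1) (e := e) (dec := dec)) => //.
    + by rewrite sgp /e i1.
    + by rewrite sgp /dec i1.
    + exact: Jo.
    + by move=> pr; apply: Jo; apply: par_nv.
    + exact: Rp.
    + exact: io'.
    + by rewrite eqxx.
    + by move=> u' /negbTE->.
    + exact: hp.
have := @ok_phase5 s1 i v p (offs v) (base v) sv J
  (fun b => ar s0 (aF b) v) (fun b => ar s0 (aL b) v)
  (fun s2 => vr s2 ri = i /\ inv5 i.+1 (setv s2 ri i.+1)).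
rewrite /= sgE (fr 14 (offs v)) //.
rewrite -[select _ _ (ar s0 10 v) _ _]/(X false) -[select _ _ (ar s0 11 v) _ _]/(X true).
rewrite -/rem -/e -/j1 (fr 14 (offs v + j1)) // -/r -/dec.
apply=> //.
- by rewrite fr // hq // vdef.
- by rewrite fr // hsn.
- by rewrite fr.
- by rewrite fr.
- by move=> i0; rewrite fr // p3; apply: code_ltW; have := se_J (hp i0); rewrite -/J; have := deg_lt p; clear; lia.
- by case; rewrite fr.
- by case; rewrite fr.
- by move=> b; apply: code_ltW; case: (Fle b).
- by move=> b; apply: code_ltW; case: (Fle b).
- by clear -oj lv; lia.
- by clear -j1b dv; lia.
Qed.

End Phase5.
Definition proper_bits (x : 'I_n -> bool) : Prop := forall v, v != tree_root ->
  base v + bit_degree x0 qs par x v * C != base (par v) + bit_degree x0 qs par x (par v) * C.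

Definition answer (s : state) : Prop :=
  (ar s aIO 0 = 0 /\ forall x, ~ proper_bits x) \/
  (ar s aIO 0 = 1 /\ exists x, proper_bits x /\
    forall v, v != tree_root -> ar s aIO (eidx es v (par v)).+1 = x v).

(** With no pending child, [se_rem] forces [aREM] to 0, and the intended value is the actual
    count. *)
Lemma settled_bits s0 x s v : settled s0 x s 0 v -> ar s aJ v = bit_degree x0 qs par x v.
Proof.
case=> _ hr _ hs hrem _.
have none c : child c v && (elim_index c < 0) = false by rewrite ltn0 andbF.
rewrite (big_pred0 _ _ _ _ none) in hrem; rewrite (big_pred0 _ _ _ _ none) in hs.
have all c : child c v && (0 <= elim_index c) = child c v by rewrite leq0n andbT.
rewrite (eq_bigl _ _ all) in hs.
rewrite -hs /bit_degree; have -> : (v != tree_root) && x v = x v.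
  by have [/eqP/hr->|] := eqVneq v tree_root.
by move: hrem; rewrite leqn0 => /eqP->; rewrite add0n addn0 addn1 -addnA add1n.
Qed.

Lemma triple_phase5 s0 : inv4 qs par n s0 -> triple (phase5 C) s0 (4000 * n) answer.
Proof.
move=> I4; have W1 := W_lin.
have [[[cn cn1 cA] hd hq _ _ _] _ _ _ _] := I4.
pose ans := ar s0 10 tree_root.
pose Q1 s := [/\ consts s, vr s rlim = (if ans != 0 then n else 0),
  (forall k x, k \notin [:: 0; 8; 9] -> ar s k x = ar s0 k x) &
  ar s aIO 0 = (ans != 0)].
have ltr := ltn_ord tree_root.
apply: (triple_weaken (B := 200 + 2900 * n) (Q := answer)) => //; last by clear -n_gt0; lia.
apply: (Tseq (Q1 := Q1)).
  apply: Tblk; [by [] | | by []].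
  apply: (ok_asg (a := tree_root)) => /=.
  - by split=> //; clear -cn1 n_gt0; lia.
  - by rewrite cn1 hq //; clear -n_gt0; lia.
  apply: (ok_st (x := 0) (a := ans != 0)) => //=.
  - by clear -W1; lia.
  - by repeat split; try (case: ifP => _); clear -W1 ltr; lia.
  - by clear -n_gt0; lia.
  apply: (ok_asg (a := if ans != 0 then n else 0)) => /=.
  - by repeat split; try (case: ifP => _) => //; clear -W1 ltr; lia.
  - by rewrite cn.
  apply: ok_nil; split=> //=.
  by move=> k x; rewrite !inE !negb_or => /and3P[/negbTE->].
move=> s [cs lim fr io]; have [a0|a1] := eqVneq ans 0.
- rewrite a0 /= in lim io.
  apply: (triple_weaken (B := 2900 * n) (Q := fun s' => vr s' rlim = 0 /\ ar s' aIO 0 = 0)) => //.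
    apply: (Tforc (M := 0) (b := 0) (I := fun _ s' => vr s' rlim = 0 /\ ar s' aIO 0 = 0)) => //.
    + by clear -W1; lia.
    + by rewrite /=; clear -n_gt0; lia.
    + by move=> i s' [h _] _; split.
  move=> s' [_ io']; left; split=> // x px.
  (* A proper assignment would give an admissible value at the root, whereas its first admissible
     value is recorded as 0. *)
  have := admissible_bit_degree EO C_gt0 (fun v e sg => erefl (pk s0 v e sg)) (fl0 I4) px tree_root.
  rewrite eqxx /= => lr; case: (fl0 I4 tree_root false).
    by case=> _ _ /(_ (bit_degree x0 qs par x tree_root)); rewrite lr (bits_le EO) /bit_degree addn1 => /(_ isT).
  by case=> -[/andP[h _] _] _ _ _; rewrite -/ans a0 in h.
- rewrite a1 /= in lim io.
  apply: (triple_weaken (B := 2900 * n) (Q := fun s' => inv5 s0 n s')) => //.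
    apply: (Tforc (M := n) (b := 2000) (I := inv5 s0)) => //.
    + by clear -W1; lia.
    + by rewrite /=; clear -n_gt0; lia.
    + split=> //=; first by case: cs.
      exists (fun=> false) => v; rewrite subn0 leqNgt.
      by rewrite (elim_index_lt EO v).
    + by move=> i s' [_ h _ _ _] _; split.
    move=> i s' lt_i I5 vi; apply: Tblk; [by [] | | by []].
    exact: inv5_step.
  move=> s' [_ _ _ io' [x hx]]; right; split=> //; rewrite subnn in hx.
  exists x; split=> v vr; have [_ _ /(_ vr)[h1 h2] _ _ _] := hx v (leq0n _) => //.
  rewrite -(settled_bits (hx v (leq0n _))) -(settled_bits (hx (par v) (leq0n _))).
  exact: h1.
Qed.

End Phase4.

Lemma triple_algorithm : 0 < C -> triple (algorithm al be B C) (start n (encode es)) (4000 * (3 * n))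
  (fun s => exists qs par, elim_order G x0 qs par /\ answer qs par s).
Proof.
move=> C0.
have h2 s : inv3 n.-1 s -> triple (Seq (phase4 C) (phase5 C)) s (4000 * (2 * n))
    (fun s => exists qs par, elim_order G x0 qs par /\ answer qs par s).
  move=> I3; have [qs [par [EO st z]]] := inv3_static I3.
  apply: (triple_weaken (B := 4000 * n + 4000 * n) (Q := answer qs par)) => //.
  - apply: Tseq (triple_phase4 EO C0 st z) _ => s1 I4; by have := triple_phase5 EO C0 I4.
  - by clear; lia.
  - by move=> s' h; exists qs, par.
apply: (triple_weaken (B := 100 + (400 * n + (400 * n + (400 * n + 4000 * (2 * n)))))
  (Q := fun s => exists qs par, elim_order G x0 qs par /\ answer qs par s)) => //.
  apply: Tseq triple_phase0 _ => s1 h1; apply: Tseq (triple_phase1 h1) _ => s2 hs2.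
  apply: Tseq (triple_phase2 hs2) _ => s3 h3; apply: Tseq (triple_phase3 h3) _ => s4 h4.
  exact: h2.
by clear -n_gt0; lia.
Qed.

End Phases.

(** * Codes and weighted degrees *)

Section Codes.
Local Open Scope ring_scope.
Variables (R : realType) (a b : R).
Hypothesis neq_ab : a <> b.

(** The term [(n - d) * B] stands for a negative multiple of [d], shifted by the constant [n * B] to
    stay natural. *)
Definition code (al be B C n d j : nat) : nat :=
  (d * (al * n + be) + (n - d) * B + j * C)%N.

(** The case distinction is whether [a] is a rational multiple of [b - a]. It concerns the fixed
    weights only, so it selects the program and is not computed by it. *)
Lemma code_exists : exists al be B C : nat, (0 < C)%N /\
  forall n d1 d2 j1 j2 : nat,
    (d1 < n)%N -> (d2 < n)%N -> (j1 <= d1)%N -> (j2 <= d2)%N ->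
    (code al be B C n d1 j1 == code al be B C n d2 j2) =
    (d1%:R * a + j1%:R * (b - a) == d2%:R * a + j2%:R * (b - a)).
Proof.
set c := b - a; have c0 : c != 0 by rewrite subr_eq0 eq_sym; apply/eqP.
have [[p [m [q [q0 qa]]]]|irr] := pselect (exists p m q : nat,
    (0 < q)%N /\ q%:R * a = (p%:R - m%:R) * c).
  (* Multiplying the weighted degree by [q] and dividing by [c] gives the integer
     [d * (p - m) + j * q]. *)
  exists 0%N, p, m, q; split=> // n d1 d2 j1 j2 h1 h2 _ _.
  have qR : (q%:R : R) != 0 by rewrite pnatr_eq0 -lt0n.
  have key d j : (d < n)%N -> q%:R * (d%:R * a + j%:R * c) =
      c * ((code 0 p m q n d j)%:R - n%:R * m%:R).
    move=> dn; rewrite /code mul0n add0n !natrD !natrM natrB ?(ltnW dn) //.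
    rewrite mulrDr mulrCA qa; ring.
  rewrite -(inj_eq (mulfI qR)) !key // (inj_eq (mulfI c0)) (inj_eq (addIr _)).
  by rewrite eqr_nat.
(* Distinct degrees now give distinct weighted degrees, so the pair is encoded in base [n] as
   [d * n + j], with [j <= d < n]. *)
exists 1%N, 0%N, 0%N, 1%N; split=> // n d1 d2 j1 j2 h1 h2 h3 h4.
have codeE d j : code 1 0 0 1 n d j = (d * n + j)%N.
  by rewrite /code; lia.
have main e1 e2 i1 i2 : (e1 < e2)%N ->
    e1%:R * a + i1%:R * c != e2%:R * a + i2%:R * c.
  move=> lt; apply/eqP => e; apply: irr; exists i1, i2, (e2 - e1)%N.
  rewrite subn_gt0 lt natrB ?(ltnW lt) //; split=> //.
  have -> : (e2%:R - e1%:R) * a = e2%:R * a + i2%:R * c - e1%:R * a - i2%:R * c by ring.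
  by rewrite -e; ring.
rewrite !codeE.
have [lt|lt|->] := ltngtP d1 d2.
- rewrite (negbTE (main _ _ _ _ lt)); apply/negbTE.
  have := leq_mul2r n d1.+1 d2; rewrite lt orbT mulSn; lia.
- rewrite eq_sym [RHS]eq_sym (negbTE (main _ _ _ _ lt)); apply/negbTE.
  have := leq_mul2r n d2.+1 d1; rewrite lt orbT mulSn; lia.
- rewrite eqn_add2l (inj_eq (addrI _)) (inj_eq (mulIf c0)).
  by rewrite eqr_nat.
Qed.

End Codes.

(** * Weighted degrees in terms of bits *)

Section Weights.
Variables (R : realType) (a b : R).
Variables (n : nat) (G : sgraph 'I_n) (x0 : 'I_n).
Variables (qs : seq 'I_n) (par : 'I_n -> 'I_n).
Hypothesis EO : elim_order G x0 qs par.
Local Notation tree_root := (tree_root x0 qs).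
Local Notation child := (is_child x0 qs par).
Local Notation bits := (bit_degree x0 qs par).

Lemma weighted_degree_nb (w : {set 'I_n} -> R) v :
  weighted_degree G w v = (\sum_(u in nb G setT v) w [set v; u])%R.
Proof.
rewrite /weighted_degree.
have inj : {in nb G setT v &, injective (fun u => [set v; u])}.
  move=> u u'; rewrite !inE /= => au au' e.
  have : u \in [set v; u'] by rewrite -e set22.
  case/set2P => // uv; rewrite uv adj_irrefl // in au.
rewrite -(big_imset (fun f => w f) inj) /=; apply: eq_bigl => f.
apply/andP/imsetP => [[/imsetP[[x y]]]|[u]].
  rewrite inE /= => axy -> /set2P[->|->]; first by exists y; rewrite ?inE.
  by exists x; rewrite ?inE 1?adj_sym // setUC.
by rewrite !inE /= => au ->; rewrite mem_edges au set21.
Qed.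

Lemma weighted_degree_bits (w : {set 'I_n} -> R) x :
  (forall v, v != tree_root -> w [set v; par v] = if x v then b else a) ->
  forall v, weighted_degree G w v =
    (#|nb G setT v|%:R * a + ((bits x v).-1)%:R * (b - a))%R.
Proof.
move=> hw v; rewrite weighted_degree_nb (big_nb EO) /=.
have wE (y : bool) : (if y then b else a) = (a + y%:R * (b - a))%R.
  by case: y; rewrite ?mul1r ?mul0r ?addr0 // addrC subrK.
have -> : (\sum_(c | child c v) w [set v; c])%R =
    ((nch x0 qs par v)%:R * a + (\sum_(c | child c v) x c)%:R * (b - a))%R.
  rewrite /nch !natr_sum !mulr_suml -big_split; apply: eq_bigr => c /andP[cr /eqP<-].
  by rewrite setUC hw // wE mul1r.
rewrite (deg_nch EO) /bit_degree addn1 /=.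
case: ifP => vr /=; last by rewrite !add0n add0r.
by rewrite hw // wE !natrD !mulrDl mul1r addrACA.
Qed.

End Weights.

(** * From bits to the required output *)

Section Correct.
Variables (R : realType) (a b : R).
Variables (al be B C n : nat) (G : sgraph 'I_n) (es : seq ('I_n * 'I_n)).
Variables (x0 : 'I_n) (qs : seq 'I_n) (par : 'I_n -> 'I_n).
Hypothesis codeP : forall d1 d2 j1 j2 : nat,
  d1 < n -> d2 < n -> j1 <= d1 -> j2 <= d2 ->
  (code al be B C n d1 j1 == code al be B C n d2 j2) =
  (d1%:R * a + j1%:R * (b - a) == d2%:R * a + j2%:R * (b - a))%R.
Hypothesis es_G : edge_list G es.
Hypothesis n_gt0 : 0 < n.
Hypothesis EO : elim_order G (Ordinal n_gt0) qs par.
Local Notation tree_root := (tree_root (Ordinal n_gt0) qs).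
Local Notation bits := (bit_degree (Ordinal n_gt0) qs par).
Local Notation base := (base G al be B).

Lemma code_degree (w : {set 'I_n} -> R) x :
  (forall v, v != tree_root -> w [set v; par v] = if x v then b else a) ->
  forall u v, (base u + bits x u * C == base v + bits x v * C) =
    (weighted_degree G w u == weighted_degree G w v).
Proof.
move=> hw u v; rewrite !(weighted_degree_bits EO hw).
have bp y : bits x y = (bits x y).-1.+1 by rewrite /bit_degree addn1.
have bl y : (bits x y).-1 <= #|nb G setT y|.
  by rewrite -ltnS -bp; apply: bits_le EO x y.
rewrite -codeP ?deg_lt // /code.
(* The shift of [j] by one adds the same [C] to both codes. *)
rewrite {1}[bits x u]bp {1}[bits x v]bp !mulSn !addnA ![base _ + C]addnC -!addnA eqn_add2l.
by rewrite /base /deg.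
Qed.

Lemma proper_bits_weighting (w : {set 'I_n} -> R) x :
  (forall v, v != tree_root -> w [set v; par v] = if x v then b else a) ->
  proper_bits G al be B C n_gt0 qs par x <->
  (forall u v, adj G u v -> weighted_degree G w u <> weighted_degree G w v).
Proof.
move=> hw; split=> [px u v auv|pw v vr]; last first.
  by rewrite (code_degree hw); apply/eqP/pw/(eo_adj EO).
have : v \in nb G setT u by rewrite !inE.
rewrite (mem_nbT EO) => /orP[/andP[ur /eqP->]|/andP[vr /eqP<-]].
  by apply/eqP; rewrite -(code_degree hw); apply: px.
by apply/nesym/eqP; rewrite -(code_degree hw); apply: px.
Qed.

Lemma correct_answer s m :
  answer G es al be B C n_gt0 qs par s ->
  (forall x, x < 6 * n -> m x = ar s 0 x) -> size es + 1 = n ->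
  correct_output a b G es m.
Proof.
move=> ans hm sz.
case: ans => [[s0 nox]|[s1 [x [px hx]]]].
  have no : ~ admits_proper_weighting a b G.
    case=> w [ew pw]; pose x v := w [set v; par v] == b.
    have hw v : v != tree_root -> w [set v; par v] = if x v then b else a.
      move=> vr; rewrite /x; case: eqP => // nb.
      have := ew [set v; par v]; rewrite mem_edges (eo_adj EO vr).
      by case=> // /nb.
    by apply: (nox x); apply/(proper_bits_weighting hw).
  by split=> // _; rewrite hm ?muln_gt0.
split=> [_|[]].
  split; first by rewrite hm ?muln_gt0.
  pose w (f : {set 'I_n}) := if m (index f [seq edge_of p | p <- es]).+1 == 0 then a else b.
  have mx v : v != tree_root -> m (eidx es v (par v)).+1 = x v.
    move=> vr; rewrite hm ?hx //.
    by have := eidx_lt es_G (eo_adj EO vr); lia.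
  have hw v : v != tree_root -> w [set v; par v] = if x v then b else a.
    by move=> vr; rewrite /w -/(eidx es v (par v)) mx //; case: (x v).
  exists w; split.
    split; last exact/(proper_bits_weighting hw).
    by move=> f _; rewrite /w; case: eqP; auto.
  move=> i p ip.
  have lt_i : i < size es by rewrite ltnNge; apply/negP => /onth_default; rewrite ip.
  have pE : p = nth (Ordinal n_gt0, Ordinal n_gt0) es i.
    by apply: (@Some_inj _ p); rewrite -ip onthE (nth_map (Ordinal n_gt0, Ordinal n_gt0)).
  have ap := es_adj es_G (Ordinal n_gt0, Ordinal n_gt0) lt_i.
  have ei := eidx_nth es_G (Ordinal n_gt0, Ordinal n_gt0) lt_i.
  rewrite -pE in ap ei.
  have wE : w (edge_of p) = if m i.+1 == 0 then a else b.
    by rewrite /w -ei.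
  have [v mi] : exists v, m i.+1 = x v.
    have : p.2 \in nb G setT p.1 by rewrite !inE.
    rewrite (mem_nbT EO) => /orP[/andP[ur /eqP e]|/andP[vr /eqP e]].
      by exists p.1; rewrite -ei e mx.
    by exists p.2; rewrite -ei -e eidxC mx.
  by rewrite wE mi; case: (x v); auto.
(* After the answer 1, the weighting read back from the output refutes the assumption that none
   exists. *)
pose w (f : {set 'I_n}) := if ar s 0 (index f [seq edge_of p | p <- es]).+1 == 0 then a else b.
have hw v : v != tree_root -> w [set v; par v] = if x v then b else a.
  by move=> vr; rewrite /w -/(eidx es v (par v)) hx //; case: (x v).
exists w; split; last exact/(proper_bits_weighting hw).
by move=> f _; rewrite /w; case: eqP; auto.
Qed.

End Correct.

Theorem corollary15 (R : realType) (a b : R) (neq_ab : a <> b) :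
  exists (P : program) (wordc timec spacec : nat),
    0 < wordc /\
    forall (n : nat) (G : sgraph 'I_n) (es : seq ('I_n * 'I_n)) (w : nat),
      is_tree G -> edge_list G es ->
      wordc * (trunc_log 2 n).+1 <= w ->
      exists (t : nat) (c : config),
        t <= timec * n /\
        run w (spacec * n) P t (init_config (encode es)) = Some c /\
        halted P c /\
        correct_output a b G es (memory c).
Proof.
have [al [be [B [C [C0 codeP]]]]] := code_exists neq_ab.
pose K := 200 + al + be + B + C.
(* The word constant works because [K <= 2 ^ K] and [n.+1 <= 2 ^ L], where
   [K + 2 * L <= (K + 2) * L]. The 4 extra time units pay for [prelude]. *)
exists (program_of (algorithm al be B C)), (K + 2), (4000 * 3 + 4), (narr * 6).
split; first by lia.
move=> n G es w treeG es_G hw.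
have n0 : 0 < n by case: (treeG) => -[]; rewrite card_ord.
have HW : K * (n.+1 * n.+1) <= 2 ^ w.
  set L := (trunc_log 2 n).+1 in hw.
  have nL : n.+1 <= 2 ^ L by apply: trunc_log_ltn.
  have KK : K <= 2 ^ K by apply/ltnW/ltn_expl.
  apply: (@leq_trans (2 ^ (K + (L + L)))).
    by rewrite (expnD 2 K) (expnD 2 L); apply: leq_mul => //; apply: leq_mul.
  rewrite leq_exp2l //; apply: leq_trans hw.
  by rewrite mulnDl mul2n addnn leq_add2r /L leq_pmulr.
have hT := @triple_algorithm n G es w al be B C n0 HW treeG es_G C0.
have hin x : nth 0 (encode es) x <= n by apply: nth_encode_le.
have hm : narr * (6 * n) <= 2 ^ w by apply: W_mem n0 HW.
have [t [cf [s [le_t rn hlt [qs [par [EO ans]]] hmem]]]] :=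
  run_program_of n0 (erefl _ : nth 0 (encode es) 0 = n) hm hin hT.
exists t, cf; split; first by apply: leq_trans le_t _; clear -n0; lia.
split; first exact: rn.
split=> //.
apply: (correct_answer (codeP n) es_G EO ans hmem).
exact: size_edge_list es_G treeG.
Qed.
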